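(* Suppose that the potential $\Phi$ satisfies conditions (A1)--(A4) of the context. Then the function $I:X\times\Lambda\to\mathbb{R}\cup\{+\infty\}$, $$I(u,a)=\Phi(u,a)+J(u)+K(a),$$ is the Onsager-Machlup functional for the measure $\mu$. That is: (i) for each $(u,a),(v,b)\in E\times\mathrm{int}(S)$, $$\lim_{\delta\downarrow 0}\frac{\mu(B^\delta(u,a))}{\mu(B^\delta(v,b))}=\exp\big(I(v,b)-I(u,a)\big);$$ (ii) for each $(u,a)\in E\times\partial S$, $I(u,a)=\lim_{b\to a,\ b\in\mathrm{int}(S)}I(u,b)$; (iii) $I(u,a)=\infty$ whenever $u\notin E$ or $a\notin S$.
   Context: Setting. $X$ is a separable Banach space, $\Lambda\subseteq\mathbb{R}^k$, $Y=\mathbb{R}^J$. $X\times\Lambda$ (as a subset of $X\times\mathbb{R}^k$) is equipped with any complete norm $\|(\cdot,\cdot)\|$ such that $\|(u,a)\|\to0$ implies $\|u\|_X\to0$ and $|a|\to0$; $B^\delta(u,a)$ is the ball in $X\times\Lambda$ of radius $\delta$ centred at $(u,a)$ for this norm. Prior. $\mu_0$ is a Gaussian measure on $X$ with mean zero and Cameron-Martin space $(E,\langle\cdot,\cdot\rangle_E,\|\cdot\|_E)$. $\nu_0$ is a probability measure on $\Lambda$ with compact support $S\subseteq\Lambda$, absolutely continuous with respect to Lebesgue measure, with density $\rho$ continuous on $S$ and positive on $\mathrm{int}(S)$; $S$ is the closure of its interior. The prior on $X\times\Lambda$ is $\mu_0\times\nu_0$. Define $J(u)=\tfrac12\|u\|_E^2$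 if $u\in E$, $J(u)=\infty$ if $u\notin E$; and $K(a)=-\log\rho(a)$ if $a\in\mathrm{int}(S)$, $K(a)=\infty$ if $a\notin S$, $K(a)=-\lim_{b\to a,\,b\in\mathrm{int}(S)}\log\rho(b)$ if $a\in\partial S$. Potential. $\Phi:X\times\Lambda\times Y\to\mathbb{R}$ satisfies: (A1) for every $\varepsilon>0$ there is $M_1(\varepsilon)\in\mathbb{R}$ such that for all $u\in X$, $a\in\Lambda$ (and all $y\in Y$), $\Phi(u,a;y)\ge M_1(\varepsilon)-\varepsilon\|u\|_X^2$; (A2) for each $u\in X$ and $y\in Y$, $\Phi(u,\cdot;y):\Lambda\to\mathbb{R}$ is continuous; (A3) there is a strictly positive $M_2:\mathbb{R}^+\times\mathbb{R}^+\times\mathbb{R}^+\to\mathbb{R}^+$, monotonic non-decreasing separately in each argument, such that for each $r>0$, $u\in X$, $a\in\Lambda$ and $y_1,y_2\in Y$ with $|y_1|,|y_2|<r$, $|\Phi(u,a;y_1)-\Phi(u,a;y_2)|\le M_2(r,\|u\|_X,|a|)|y_1-y_2|$; (A4) there is a strictly positive $M_3:\mathbb{R}^+\times\Lambda\times Y\to\mathbb{R}^+$, continuous in its second component, such that for each $r>0$, $a\in\Lambda$, $y\in Y$ and $u_1,u_2\in X$ with $\|u_1\|_X,\|u_2\|_X<r$, $|\Phi(u_1,a;y)-\Phi(u_2,a;y)|\le M_3(r,a,y)\|u_1-u_2\|_X$. Posterior. Fix $y\in Y$ and write $\Phi(u,a)=\Phi(u,a;y)$. $\mu$ is the probability measure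 on $X\times\Lambda$ given by $\mu(du,da)=\frac1Z\exp(-\Phi(u,a))\,\mu_0(du)\nu_0(da)$, with $Z=\int_{X\times\Lambda}\exp(-\Phi(u,a))\,\mu_0(du)\nu_0(da)$. *)

(* Defs.v *)
From HB Require Import structures.
From mathcomp Require Import all_boot all_order all_algebra.
From mathcomp Require Import all_classical all_reals all_analysis.

Set Implicit Arguments.
Unset Strict Implicit.
Unset Printing Implicit Defensive.

Import Order.TTheory GRing.Theory Num.Theory.
Import numFieldNormedType.Exports.

Local Open Scope classical_set_scope.
Local Open Scope ring_scope.

(* [T] with its Borel sigma-algebra; convertible to [T]. *)
Notation borel T := (g_sigma_algebraType (@open T)).

Definition separable (T : topologicalType) : Prop :=
  exists2 D : set T, countable D & dense D.

(* The library's norm on ['rV[R]_n] is the sup norm (same topology). *)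
Definition enorm (R : realType) (n : nat) (a : 'rV[R]_n) : R :=
  Num.sqrt (\sum_(i < n) (a ord0 i) ^+ 2).

(* Nonnegativity of [N] follows from the first two fields. *)
Record complete_norm (R : realType) (V : lmodType R) (N : V -> R) : Prop := {
  cnorm_triangle : forall x y, N (x + y) <= N x + N y ;
  cnorm_scale : forall c x, N (c *: x) = `|c| * N x ;
  cnorm_eq0 : forall x, N x = 0 -> x = 0 ;
  cnorm_complete : forall w : nat -> V,
    (forall e, 0 < e -> exists n0 : nat, forall m n : nat,
        (n0 <= m)%N -> (n0 <= n)%N -> N (w m - w n) < e) ->
    exists l, N (w n - l) @[n --> \oo] --> (0 : R) }.

Section lebesgue.
Variable R : realType.

Definition row_snoc (n : nat) (p : 'rV[R]_n * R) : 'rV[R]_n.+1 :=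
  \row_(i < n.+1) oapp (p.1 ord0) p.2 (unlift ord_max i).

(* n-dimensional Lebesgue measure, as an iterated product of the
   one-dimensional one; in dimension 0 it is the unit mass at the point. *)
Fixpoint lebesgue_rV (n : nat) : set (borel 'rV[R]_n) -> \bar R :=
  if n isn't n'.+1 then fun A => dirac (0 : borel 'rV[R]_0) A
  else fun A => (@lebesgue_rV n' \x lebesgue_measure)%E
                  (@row_snoc n' @^-1` A).

Definition is_density (n : nat) (nu : set (borel 'rV[R]_n) -> \bar R)
    (rho : borel 'rV[R]_n -> R) : Prop :=
  [/\ measurable_fun setT rho, (forall a, 0 <= rho a) &
      forall A : set (borel 'rV[R]_n), measurable A ->
        nu A = (\int[@lebesgue_rV n]_(a in A) (rho a)%:E)%E].

Definition msupport (T : topologicalType) (nu : set T -> \bar R) : set T :=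
  [set x | forall U : set T, open U -> U x -> (0 < nu U)%E].

End lebesgue.

Section gaussian.
Variables (R : realType) (X : completeNormedModType R).
Variable mu : set (borel X) -> \bar R.

(* The library's [normal_prob] is a density-based law, hence the separate
   degenerate case. *)
Definition centred_normal (s : R) (A : set R) : \bar R :=
  if s == 0 then \d_(0 : R) A else normal_prob 0 s A.

Definition centred_gaussian : Prop :=
  forall l : {linear X -> R^o}, continuous l ->
    exists s : R, forall A : set R, measurable A ->
      mu (l @^-1` A) = centred_normal s A.

(* ||h||_E = sup { |l h| : l in X^*, ||l||_{L^2(mu)} <= 1 }, with value +oo off
   the Cameron-Martin space (Bogachev, Gaussian Measures, Chapter 2). *)
Definition cm_norm (h : X) : \bar R :=
  ereal_sup [set `|l h|%:E | l in [set l : {linear X -> R^o} |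
    continuous l /\
    (\int[mu]_(x in [set: borel X]) ((l x : R) ^+ 2)%:E <= 1)%E]].

Definition cm_space : set X := [set h | (cm_norm h < +oo)%E].

Definition J_func (u : X) : \bar R :=
  if u \in cm_space then (2^-1 * fine (cm_norm u) ^+ 2)%:E else +oo%E.

End gaussian.

Section potential.
Variables (R : realType) (X : completeNormedModType R) (k J : nat).
Variables (Lam : set 'rV[R]_k) (Phi : X -> 'rV[R]_k -> 'rV[R]_J -> R).

Definition condA1 : Prop :=
  forall e, 0 < e -> exists M1 : R, forall u a y, Lam a ->
    M1 - e * `|u| ^+ 2 <= Phi u a y.

Definition condA2 : Prop :=
  forall u y, {within Lam, continuous (fun a => Phi u a y)}.

Definition condA3 : Prop :=
  exists M2 : R -> R -> R -> R,
    [/\ (forall r s t, 0 <= r -> 0 <= s -> 0 <= t -> 0 < M2 r s t),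
        (forall r r' s s' t t', 0 <= r <= r' -> 0 <= s <= s' -> 0 <= t <= t' ->
           [/\ M2 r s t <= M2 r' s t, M2 r s t <= M2 r s' t &
               M2 r s t <= M2 r s t']) &
        forall r u a y1 y2, 0 < r -> Lam a -> enorm y1 < r -> enorm y2 < r ->
          `|Phi u a y1 - Phi u a y2| <= M2 r `|u| (enorm a) * enorm (y1 - y2)].

Definition condA4 : Prop :=
  exists M3 : R -> 'rV[R]_k -> 'rV[R]_J -> R,
    [/\ (forall r a y, 0 <= r -> Lam a -> 0 < M3 r a y),
        (forall r y, 0 <= r -> {within Lam, continuous (fun a => M3 r a y)}) &
        forall r a y u1 u2, 0 < r -> Lam a -> `|u1| < r -> `|u2| < r ->
          `|Phi u1 a y - Phi u2 a y| <= M3 r a y * `|u1 - u2|].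

End potential.

(* S is closed in all uses, so the second branch is its boundary. *)
Definition K_func (R : realType) (k : nat) (S : set 'rV[R]_k)
    (rho : 'rV[R]_k -> R) (a : 'rV[R]_k) : \bar R :=
  if a \in (S° : set 'rV[R]_k) then (- ln (rho a))%:E
  else if a \in S then
    (- lim ((ln (rho b))%:E @[b --> within S° (nbhs a)]))%E
  else +oo%E.

Section posterior.
Variables (R : realType) (X : completeNormedModType R) (k : nat).
Variable Lam : set 'rV[R]_k.

Definition ball_on (N : X * 'rV[R]_k -> R) (z0 : X * 'rV[R]_k) (d : R) :
    set (X * 'rV[R]_k) :=
  [set z | Lam z.2 /\ N (z - z0) < d].

(* A measure on X * Lam is represented by the set function on X * R^k which only
   charges X * Lam.  The prior [nu] lives on R^k with support contained in
   [Lam], so the values of [phi] off [Lam] play no role. *)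
Definition posterior (mu : set (borel X) -> \bar R)
    (nu : set (borel 'rV[R]_k) -> \bar R) (phi : X -> 'rV[R]_k -> R)
    (A : set (borel X * borel 'rV[R]_k)) : \bar R :=
  let XLam : set (borel X * borel 'rV[R]_k) := [set z | Lam z.2] in
  ((\int[mu \x nu]_(z in A `&` XLam) (expR (- phi z.1 z.2))%:E)
   / (\int[mu \x nu]_(z in XLam) (expR (- phi z.1 z.2))%:E))%E.

End posterior.

Definition OM_func (R : realType) (X : completeNormedModType R) (k : nat)
    (mu0 : set (borel X) -> \bar R) (S : set 'rV[R]_k) (rho : 'rV[R]_k -> R)
    (phi : X -> 'rV[R]_k -> R) (u : X) (a : 'rV[R]_k) : \bar R :=
  ((phi u a)%:E + J_func mu0 u + K_func S rho a)%E.

(* Main.v *)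
(* Since [Phi] and [rho] are continuous, the posterior mass of a small ball at
   [(u, a)] is [exp (- Phi u a) * rho a / Z * (1 + o(1))] times its mass under
   [mu0 x Lebesgue], so everything reduces to the ratio of the latter masses of
   the balls centred at [(u, a)] and at the origin tending to
   [exp (- |u|_E^2 / 2)].

   By the open mapping theorem [N] is equivalent to the product norm, and by
   Hahn-Banach and separability an [N]-ball is cut out by countably many
   continuous linear functionals.  Slicing it along [R^k] gives sets in [X]
   that only involve the laws of finitely many functionals at a time; these are
   linear images of standard Gaussian vectors, by uniqueness of finite measures
   with given cosine transforms.

   Lower bound: averaging the Cameron-Martin density over [h] and [- h] gives
   [mu0 (K + h) + mu0 (K - h) >= 2 * exp (- |h|_E^2 / 2) * mu0 K], and
   reflecting [R^k] identifies the two terms.  Upper bound: the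
   Prekopa-Leindler inequality for a Gaussian measure gains a factor
   [exp (|x - y|^2 / 4)]; applied to the balls at [u] and [- u] it bounds their
   mass by [exp (- (|f u| - C * d)^2 / 2)] times that of the ball at [0], for
   every functional [f] with [||f||_{L^2(mu0)} <= 1].  Let [d] tend to [0] and
   take the supremum over [f].  The same inequality gives Fernique's theorem,
   hence the finiteness of [Z]. *)
Require Import Defs.
From HB Require Import structures.
From mathcomp Require Import all_boot all_order all_algebra.
From mathcomp Require Import all_classical all_reals all_analysis.
From mathcomp Require Import ring lra.
From mathcomp Require Import measurable_realfun.

Set Implicit Arguments.
Unset Strict Implicit.
Unset Printing Implicit Defensive.

Import Order.TTheory GRing.Theory Num.Theory.
Import numFieldNormedType.Exports.

Local Open Scope classical_set_scope.
Local Open Scope ring_scope.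

(** * The one-dimensional Prekopa-Leindler inequality *)

(** [X] carries no reference measure and the Gaussian hypothesis speaks of one functional at a time.
    Every estimate on [X] is therefore proved for [n] functionals with constants free of [n], and
    passes to countably many by continuity of the measure from above. Hence closed balls come first,
    as intersections of closed strips; open balls are increasing unions of them.

    [N] need not be a product norm, so the section of a ball at height [c] is in general neither
    symmetric nor centred at a point of [X]; its mirror image is the section at [- c]. This is why
    strips have arbitrary real centres, and why the upper bound needs a second use of
    Prekopa-Leindler, over the heights.

    For a general [h] in the Cameron-Martin space, the functional in the exponent of the density is
    only an L^2 limit of continuous ones, so it cannot be bounded on small balls. Averaging over [h]
    and [- h] removes it through [e^y + e^(-y) >= 2]. The upper bound involves one continuous
    functional at a time, which varies by at most [C * d] on a ball of radius [d]. *)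

Definition pushm d d' (T1 : measurableType d) (T2 : measurableType d')
    (R : realType) (m : {measure set T1 -> \bar R}) (f : T1 -> T2)
    (mf : measurable_fun setT f) : {measure set T2 -> \bar R} :=
  measure_function_pushforward__canonical__measure_function_Measure m mf.

Lemma ge0_integral_oppr (R : realType) (f : R -> \bar R) :
  measurable_fun [set: R] f -> (forall x, (0 <= f x)%E) ->
  (\int[lebesgue_measure]_x f (- x)%R = \int[lebesgue_measure]_x f x)%E.
Proof.
move=> mf f0.
transitivity (\int[pushforward lebesgue_measure
    (-%R : R -> measurableTypeR R)]_x f x)%E.
  by rewrite ge0_integral_pushforward.
by apply: eq_measure_integral => A mA _; exact: lebesgue_measureN.
Qed.

Lemma lebesgue_measure_affine (R : realType) (a b : R) (A : set R) :
  0 < a -> measurable A ->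
  (lebesgue_measure A =
    a%:E * lebesgue_measure ((fun x => (a * x + b)%R) @^-1` A))%E.
Proof.
move=> a0 mA.
have mphi : measurable_fun [set: measurableTypeR R]
    ((fun x => a * x + b) : R -> measurableTypeR R).
  by apply: measurable_funD => //; exact: measurable_funM.
pose nu := mscale (NngNum (ltW a0)) (pushm lebesgue_measure mphi).
suff : lebesgue_measure A = nu A by [].
apply: lebesgue_measure_unique => //= _ [[p q]] _ <-.
rewrite /nu /mscale/= /pushforward.
have -> : (fun x => a * x + b) @^-1` `]p, q] = `](p - b) / a, (q - b) / a]%classic.
  apply/seteqP; split => x /=; rewrite !in_itv/= ltr_pdivrMr// ler_pdivlMr//.
    by rewrite mulrC => /andP[? ?]; apply/andP; split; lra.
  by rewrite mulrC => /andP[? ?]; apply/andP; split; lra.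
rewrite !lebesgue_measure_itv/= !lte_fin ltr_pM2r ?invr_gt0// ltrD2r.
case: ifP => _; last by rewrite mule0.
by rewrite -!EFinD -EFinM; congr EFin; field; rewrite gt_eqF.
Qed.

Lemma ge0_integral_affine (R : realType) (a b : R) (f : R -> \bar R) :
  a != 0 -> measurable_fun [set: R] f -> (forall x, (0 <= f x)%E) ->
  (\int[lebesgue_measure]_x f x =
   `|a|%:E * \int[lebesgue_measure]_x f (a * x + b)%R)%E.
Proof.
move=> + mf f0; wlog a0 : a f mf f0 / 0 < a => [H|_].
  rewrite neq_lt => /orP[a0|a0]; last by apply: H; rewrite ?gt_eqF.
  rewrite -(normrN a) (H (- a) f)// ?oppr_gt0// ?oppr_eq0 ?lt_eqF//.
  congr (_ * _)%E.
  rewrite -[RHS]ge0_integral_oppr//.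
  - by apply: eq_integral => x _; congr f; ring.
  - apply: measurableT_comp => //.
    by apply: measurable_funD => //; exact: measurable_funM.
have mphi : measurable_fun [set: measurableTypeR R]
    ((fun x => a * x + b) : R -> measurableTypeR R).
  by apply: measurable_funD => //; exact: measurable_funM.
pose nu := mscale (NngNum (ltW a0)) (pushm lebesgue_measure mphi).
transitivity (\int[nu]_x f x)%E.
  by apply: eq_measure_integral => A mA _; exact: lebesgue_measure_affine.
rewrite ge0_integral_mscale// gtr0_norm//; congr (_ * _)%E.
by rewrite ge0_integral_pushforward.
Qed.

Lemma ge0_integral_shift (R : realType) (b : R) (f : R -> \bar R) :
  measurable_fun [set: R] f -> (forall x, (0 <= f x)%E) ->
  (\int[lebesgue_measure]_x f (x + b)%R = \int[lebesgue_measure]_x f x)%E.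
Proof.
move=> mf f0; rewrite [RHS](@ge0_integral_affine _ 1 b)// normr1 mul1e.
by under [RHS]eq_integral do rewrite mul1r.
Qed.

(* Translate two compact subsets so that the midpoint set contains halves of
   both, overlapping in a single point. *)
Lemma brunn_minkowski1 (R : realType) (A B C : set R) :
  measurable A -> measurable B -> measurable C ->
  A !=set0 -> B !=set0 ->
  (forall x y, A x -> B y -> C ((x + y) / 2)) ->
  (lebesgue_measure A + lebesgue_measure B <= 2%:E * lebesgue_measure C)%E.
Proof.
move=> mA mB mC [x0 Ax0] [y0 By0] ABC.
have compactcase (K L : set R) : compact K -> compact L -> K !=set0 -> L !=set0 ->
    K `<=` A -> L `<=` B ->
    (lebesgue_measure K + lebesgue_measure L <= 2%:E * lebesgue_measure C)%E.
  move=> cK cL K0 L0 KA LB.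
  have cid (D : set R) : {within D, continuous (fun x : R => x)}.
    by apply: continuous_subspaceT => x; exact: cvg_id.
  have [a /set_mem Ka amax] := compact_EVT_max K0 cK (cid K).
  have [b /set_mem Lb bmin] := compact_EVT_min L0 cL (cid L).
  have mK := compact_measurable cK; have mL := compact_measurable cL.
  (* [K'] is [(K + b) / 2] and [L'] is [(a + L) / 2]. As [a] is the maximum of [K] and [b] the
     minimum of [L], the first lies to the left of [(a + b) / 2] and the second to the right. *)
  pose K' := [set z | K (2 * z + - b)]; pose L' := [set z | L (2 * z + - a)].
  have mD c : measurable_fun [set: R] (fun z : R => 2 * z + c).
    by apply: measurable_funD => //; exact: measurable_funM.
  have mK' : measurable K' by rewrite -[K']setTI; exact: mD.
  have mL' : measurable L' by rewrite -[L']setTI; exact: mD.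
  rewrite (@lebesgue_measure_affine _ 2 (- b) K)//.
  rewrite (@lebesgue_measure_affine _ 2 (- a) L)// -ge0_muleDr//.
  rewrite lee_wpmul2l//.
  rewrite -[X in (lebesgue_measure X + _)%E]/K' -[X in (_ + lebesgue_measure X)%E]/L'.
  have cK'L' : K' `&` L' `<=` [set (a + b) / 2].
    move=> z [/mem_set/amax /= z1 /mem_set/bmin /= z2]; lra.
  have mKL : measurable (K' `&` L') by exact: measurableI.
  have KL0 : lebesgue_measure (K' `&` L') = 0%E.
    apply/eqP; rewrite -measure_le0 -(lebesgue_measure_set1 ((a + b) / 2)).
    by apply: le_measure; rewrite ?inE.
  apply: (@le_trans _ _ (lebesgue_measure (K' `|` L'))).
    have -> : lebesgue_measure L' = lebesgue_measure (L' `\` K').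
      etransitivity; first exact: (measureDI lebesgue_measure mL' mK').
      by rewrite setIC -[RHS]adde0; congr (_ + _)%E; exact: KL0.
    rewrite -measureU ?setDIK//; last exact: measurableD.
    apply: le_measure; rewrite ?inE.
    - by apply: measurableU => //; exact: measurableD.
    - exact: measurableU.
    - by move=> z [|[]]; [left|right].
  apply: le_measure; rewrite ?inE//; first exact: measurableU.
  move=> z [K'z|L'z].
  - by have := ABC _ _ (KA _ K'z) (LB _ Lb); congr (C _); field.
  - by have := ABC _ _ (KA _ Ka) (LB _ L'z); congr (C _); field.
(* Compact sets from inner regularity may be empty; adding a point of the larger set makes them
   nonempty without lowering the measure. *)
have addpt (K D : set R) x : K `<=` D -> D x -> compact K ->
    [/\ compact (K `|` [set x]), K `|` [set x] !=set0, K `|` [set x] `<=` D &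
    (lebesgue_measure K <= lebesgue_measure (K `|` [set x]))%E].
  move=> KD Dx cK; have cKx : compact (K `|` [set x]).
    by apply: compactU => //; exact: compact_set1.
  split => //; first by exists x; right.
  - by move=> z [/KD//|->].
  - by apply: le_measure; rewrite ?inE; [exact: compact_measurable..|left].
have [->|Coo] := eqVneq (lebesgue_measure C) +oo%E.
  by rewrite gt0_muley ?lte_fin// leey.
have Cfin : (2%:E * lebesgue_measure C)%E \is a fin_num.
  by rewrite fin_numM// ge0_fin_numE// ltey.
have KLC K L : compact K -> compact L -> K `<=` A -> L `<=` B ->
    (lebesgue_measure K + lebesgue_measure L <= 2%:E * lebesgue_measure C)%E.
  move=> cK cL KA LB.
  have [cK' K'0 K'A KK'] := addpt _ _ _ KA Ax0 cK.
  have [cL' L'0 L'B LL'] := addpt _ _ _ LB By0 cL.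
  by apply: le_trans (compactcase _ _ cK' cL' K'0 L'0 K'A L'B); exact: leeD.
have fin_of x y : (0 <= x -> 0 <= y -> x + y <= 2%:E * lebesgue_measure C ->
    y \is a fin_num)%E.
  move=> x0' y0' xy; rewrite ge0_fin_numE//.
  apply: (le_lt_trans (leeDr _ x0')); apply: (le_lt_trans xy).
  by rewrite -ge0_fin_numE// mule_ge0.
(* The supremum over [L] is taken first, then the one over [K]. Each time the other summand has to
   be finite before it can be moved across the inequality. *)
have KB K : compact K -> K `<=` A ->
    (lebesgue_measure K + lebesgue_measure B <= 2%:E * lebesgue_measure C)%E.
  move=> cK KA; have Kfin : lebesgue_measure K \is a fin_num.
    apply: (fin_of 0%E) => //; rewrite add0e.
    by have := KLC K set0 cK compact0 KA (@sub0set _ _); rewrite measure0 adde0.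
  rewrite -leeBrDl// (lebesgue_regularity_inner_sup mB).
  by apply: ge_ereal_sup => _ [L [cL LB] <-]; rewrite leeBrDl//; exact: KLC.
have Bfin : lebesgue_measure B \is a fin_num.
  apply: (fin_of 0%E) => //.
  by have := KB set0 compact0 (@sub0set _ _); rewrite measure0.
rewrite -leeBrDr// (lebesgue_regularity_inner_sup mA).
by apply: ge_ereal_sup => _ [K [cK KA] <-]; rewrite leeBrDr//; exact: KB.
Qed.

(** Tonelli for the region [E] under the graph: one family of sections consists of the intervals
    [[0, f x[], the other of the superlevel sets. *)
Lemma layer_cake (R : realType) (f : R -> \bar R) :
  measurable_fun [set: R] f -> (forall x, (0 <= f x)%E) ->
  (\int[lebesgue_measure]_x f x = \int[lebesgue_measure]_(t in `[0%R, +oo[)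
     lebesgue_measure [set x | t%:E < f x])%E.
Proof.
move=> mf f0.
pose E : set (measurableTypeR R * measurableTypeR R) :=
  [set z | 0 <= z.2] `&` [set z | (z.2%:E < f z.1)%E].
have mE : measurable E.
  apply: measurableI.
    rewrite -[X in measurable X]setTI.
    by apply: (@measurable_fun_ler _ _ _ _ (cst 0) snd) => //; exact: measurable_snd.
  rewrite -[X in measurable X]setTI; apply: measurable_lte => //.
    by apply/measurable_EFinP; exact: measurable_snd.
  by apply: measurableT_comp => //; exact: measurable_fst.
transitivity (\int[lebesgue_measure]_x lebesgue_measure (xsection E x))%E.
  apply: eq_integral => x _.
  have := f0 x; case fx: (f x) => [r| |]// r0.
  - have -> : xsection E x = `[0, r[%classic.
      apply/seteqP; split => t; rewrite /xsection/E /= inE/= in_itv/= fx lte_fin.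
        by move=> [-> ->].
      by move=> /andP[].
    rewrite lebesgue_measure_itv/= lte_fin sube0; case: ltP => // r0'.
    by congr EFin; apply/eqP; rewrite eq_le r0' -lee_fin r0.
  - have -> : xsection E x = `[0, +oo[%classic.
      apply/seteqP; split => t; rewrite /xsection/E /= inE/= in_itv/= fx ltry andbT.
        by move=> [->].
      by [].
    by rewrite lebesgue_measure_itv/= ltry.
transitivity (\int[lebesgue_measure]_y lebesgue_measure (ysection E y))%E.
  have := @indic_fubini_tonelli _ _ _ _ R lebesgue_measure lebesgue_measure E mE.
  by rewrite (indic_fubini_tonelli_FE _ mE) (indic_fubini_tonelli_GE _ mE).
rewrite [RHS]integral_mkcond; apply: eq_integral => t _.
rewrite patchE /ysection/= mem_setE in_itv/= andbT; case: ifPn => t0.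
  congr lebesgue_measure; apply/seteqP; split => x /=; rewrite inE.
    by move=> [].
  by split.
rewrite (_ : [set x | _] = set0) ?measure0//.
by apply/seteqP; split => x //=; rewrite inE /E/= (negbTE t0) => -[].
Qed.

(** Divide [f] and [g] by their suprema [a] and [b], and [h] by [sqrt (a * b)]. Superlevel sets at a
    common level then satisfy the midpoint hypothesis of [brunn_minkowski1]; integrating over the
    levels gives an arithmetic mean inequality, which is stronger than the geometric one.
    Boundedness makes the suprema finite. *)
Lemma prekopa_leindler1_bounded (R : realType) (f g h : R -> \bar R) (M : R) :
  measurable_fun [set: R] f -> measurable_fun [set: R] g ->
  measurable_fun [set: R] h ->
  (forall x, (0 <= f x <= M%:E)%E) -> (forall x, (0 <= g x <= M%:E)%E) ->
  (forall x, (0 <= h x)%E) ->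
  (forall x y, (f x * g y <= h ((x + y) / 2)%R * h ((x + y) / 2)%R)%E) ->
  (\int[lebesgue_measure]_x f x * \int[lebesgue_measure]_x g x <=
   \int[lebesgue_measure]_x h x * \int[lebesgue_measure]_x h x)%E.
Proof.
move=> mf mg mh fM gM h0 fgh.
have f0 x : (0 <= f x)%E by have /andP[] := fM x.
have g0 x : (0 <= g x)%E by have /andP[] := gM x.
have supfin (u : R -> \bar R) : (forall x, (0 <= u x <= M%:E)%E) ->
    exists2 a : R, 0 <= a & ereal_sup (range u) = a%:E.
  move=> uM; have /andP[u00 _] := uM 0.
  have s0 : (0 <= ereal_sup (range u))%E.
    by apply: le_trans u00 _; apply: ereal_sup_ubound; exists 0.
  have sM : (ereal_sup (range u) <= M%:E)%E.
    by apply: ge_ereal_sup => _ [x _ <-]; have /andP[] := uM x.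
  exists (fine (ereal_sup (range u))); first exact: fine_ge0.
  by rewrite fineK// ge0_fin_numE// (le_lt_trans sM)// ltry.
have [a a0 fa] := supfin _ fM; have [b b0 gb] := supfin _ gM.
have zero (u : R -> \bar R) : (forall x, 0 <= u x)%E ->
    ereal_sup (range u) = 0%:E -> (\int[lebesgue_measure]_x u x = 0)%E.
  move=> u0 us; rewrite integral0_eq// => x _; apply/eqP.
  by rewrite eq_le u0 andbT -[leRHS]us; apply: ereal_sup_ubound; exists x.
have HH0 : (0 <= \int[lebesgue_measure]_x h x * \int[lebesgue_measure]_x h x)%E.
  by apply: mule_ge0; exact: integral_ge0.
move: a0; rewrite le_eqVlt => /predU1P[a0|a0].
  by rewrite (zero f)// ?a0 ?mul0e.
move: b0; rewrite le_eqVlt => /predU1P[b0|b0].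
  by rewrite (zero g)// ?b0 ?mule0.
pose c := Num.sqrt (a * b).
have c0 : 0 < c by rewrite sqrtr_gt0 mulr_gt0.
have layer (u : R -> \bar R) (d : R) : 0 < d -> measurable_fun [set: R] u ->
    (forall x, 0 <= u x)%E ->
    (d^-1%:E * \int[lebesgue_measure]_x u x =
     \int[lebesgue_measure]_(t in `[0%R, +oo[)
       lebesgue_measure [set x | (d * t)%:E < u x])%E.
  move=> d0 mu u0; rewrite -ge0_integralZl//; last by rewrite lee_fin invr_ge0 ltW.
  rewrite layer_cake//; last 2 first.
  - exact: measurable_funeM.
  - by move=> x; rewrite mule_ge0// lee_fin invr_ge0 ltW.
  apply: eq_integral => t _; congr lebesgue_measure.
  by apply/funext => x /=; rewrite muleC lte_pdivlMr// -EFinM mulrC.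
have mlev (u : R -> \bar R) (d : R) : measurable_fun [set: R] u ->
    measurable_fun [set: R] (fun t : R => lebesgue_measure [set x | ((d * t)%:E < u x)%E]).
  move=> mu; pose E : set (measurableTypeR R * measurableTypeR R) :=
    [set z | ((d * z.2)%:E < u z.1)%E].
  have mE : measurable E.
    rewrite -[X in measurable X]setTI; apply: measurable_lte => //.
      by apply/measurable_EFinP; apply: measurable_funM => //; exact: measurable_snd.
    by apply: measurableT_comp => //; exact: measurable_fst.
  have := measurable_fun_ysection lebesgue_measure mE.
  apply: eq_measurable_fun => t _ /=; congr lebesgue_measure.
  by apply/seteqP; split => x; rewrite /ysection /= inE.
have key : (a^-1%:E * \int[lebesgue_measure]_x f x +
    b^-1%:E * \int[lebesgue_measure]_x g x <=
    2%:E * (c^-1%:E * \int[lebesgue_measure]_x h x))%E.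
  rewrite !layer//.
  rewrite -ge0_integralD//; last 2 first.
  - by apply: measurable_funTS; exact: mlev.
  - by apply: measurable_funTS; exact: mlev.
  rewrite -ge0_integralZl//; last by apply: measurable_funTS; exact: mlev.
  apply: ge0_le_integral => //.
  - by move=> t _; rewrite adde_ge0.
  - by apply: measurable_funTS; apply: emeasurable_funD; exact: mlev.
  - by apply: measurable_funTS; apply: measurable_funeM; exact: mlev.
  move=> t /=; rewrite in_itv/= andbT => t0.
  have mset (u : R -> \bar R) (d : R) : measurable_fun [set: R] u ->
      measurable [set x | (d%:E < u x)%E].
    by move=> mu; rewrite -[X in measurable X]setTI; exact: measurable_lte.
  (* Brunn-Minkowski needs nonempty sets. Below the normalised supremum 1 both superlevel sets are
     nonempty, from 1 on both are empty. *)
  have [t1|t1] := leP 1 t.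
    have empty (u : R -> \bar R) (d : R) : 0 < d -> ereal_sup (range u) = d%:E ->
        [set x | ((d * t)%:E < u x)%E] = set0.
      move=> d0 ud; apply/seteqP; split => x //=; rewrite ltNge.
      have ux : (u x <= d%:E)%E by rewrite -ud; apply: ereal_sup_ubound; exists x.
      by rewrite (le_trans ux)// lee_fin ler_peMr// ltW.
    by rewrite (empty f a)// (empty g b)// measure0 adde0 mule_ge0.
  apply: brunn_minkowski1; [exact: mset|exact: mset|exact: mset| | |].
  + have : ((a * t)%:E < ereal_sup (range f))%E.
      by rewrite fa lte_fin gtr_pMr.
    by move=> /ereal_sup_gt[_ [x _ <-] ?]; exists x.
  + have : ((b * t)%:E < ereal_sup (range g))%E.
      by rewrite gb lte_fin gtr_pMr.
    by move=> /ereal_sup_gt[_ [x _ <-] ?]; exists x.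
  + move=> x y /= ax bx; rewrite ltNge; apply/negP => ch.
    have : ((c * t)%:E * (c * t)%:E < f x * g y)%E.
      have /andP[_ fxM] := fM x; have /andP[_ gyM] := gM y; move: ax bx.
      rewrite -(@fineK _ (f x)); last by rewrite ge0_fin_numE// (le_lt_trans fxM) ?ltry.
      rewrite -(@fineK _ (g y)); last by rewrite ge0_fin_numE// (le_lt_trans gyM) ?ltry.
      rewrite -!EFinM !lte_fin; move: (fine (f x)) (fine (g y)) => p q ap bq.
      have -> : c * t * (c * t) = (a * t) * (b * t).
        have cc : c * c = a * b by rewrite -expr2 sqr_sqrtr// mulr_ge0// ltW.
        by rewrite mulrACA cc mulrACA.
      by apply: ltr_pM => //; rewrite mulr_ge0// ltW.
    move=> cfg; have := lt_le_trans cfg (fgh x y); rewrite ltNge => /negP; apply.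
    by apply: lee_pmul.
set F := (\int[lebesgue_measure]_x f x)%E in key *; set G := (\int[lebesgue_measure]_x g x)%E in key *.
set H := (\int[lebesgue_measure]_x h x)%E in key HH0 *.
have F0 : (0 <= F)%E by exact: integral_ge0.
have G0 : (0 <= G)%E by exact: integral_ge0.
have H0 : (0 <= H)%E by exact: integral_ge0.
have [->|Hoo] := eqVneq H +oo%E; first by rewrite mulyy leey.
have Hfin : H \is a fin_num by rewrite ge0_fin_numE// ltey.
have keyoo : (a^-1%:E * F + b^-1%:E * G < +oo)%E.
  by rewrite (le_lt_trans key)// ltey_eq !fin_numM.
have ai : (0 < a^-1%:E)%E by rewrite lte_fin invr_gt0.
have bi : (0 < b^-1%:E)%E by rewrite lte_fin invr_gt0.
have Ffin : F \is a fin_num.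
  rewrite ge0_fin_numE// ltey; apply: contraTneq keyoo => ->.
  by rewrite gt0_muley// addye// -ltNye (lt_le_trans ltNy0)// mule_ge0// ltW.
have Gfin : G \is a fin_num.
  rewrite ge0_fin_numE// ltey; apply: contraTneq keyoo => ->.
  by rewrite gt0_muley// addey// -ltNye (lt_le_trans ltNy0)// mule_ge0// ltW.
move: key F0 G0 H0; rewrite -(fineK Ffin) -(fineK Gfin) -(fineK Hfin).
rewrite -!EFinM -EFinD !lee_fin.
move: (fine F) (fine G) (fine H) => p q r key p0 q0 r0.
have cc : c * c = a * b by rewrite -expr2 sqr_sqrtr// mulr_ge0// ltW.
have -> : p * q = c * c * ((a^-1 * p) * (b^-1 * q)).
  by rewrite cc; field; rewrite !gt_eqF.
have -> : r * r = c * c * ((c^-1 * r) * (c^-1 * r)).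
  by field; rewrite gt_eqF.
apply: ler_wpM2l; first by rewrite mulr_ge0 ?ltW.
have p'0 : 0 <= a^-1 * p by rewrite mulr_ge0// invr_ge0 ltW.
have q'0 : 0 <= b^-1 * q by rewrite mulr_ge0// invr_ge0 ltW.
have r'0 : 0 <= c^-1 * r by rewrite mulr_ge0// invr_ge0 ltW.
move: (a^-1 * p) (b^-1 * q) (c^-1 * r) key p'0 q'0 r'0 => x y z key x0 y0 z0.
(* Arithmetic-geometric mean: [x + y <= 2 * z] gives [x * y <= z * z]. *)
have : (x + y) * (x + y) <= (2 * z) * (2 * z) by apply: ler_pM; rewrite ?addr_ge0.
by have := sqr_ge0 (x - y); nra.
Qed.

(** [f] and [g] are truncated at height [n]; [h] stays, because the hypothesis only asks it to be
    large. *)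
Lemma prekopa_leindler1 (R : realType) (f g h : R -> \bar R) :
  measurable_fun [set: R] f -> measurable_fun [set: R] g ->
  measurable_fun [set: R] h ->
  (forall x, (0 <= f x)%E) -> (forall x, (0 <= g x)%E) ->
  (forall x, (0 <= h x)%E) ->
  (forall x y, (f x * g y <= h ((x + y) / 2)%R * h ((x + y) / 2)%R)%E) ->
  (\int[lebesgue_measure]_x f x * \int[lebesgue_measure]_x g x <=
   \int[lebesgue_measure]_x h x * \int[lebesgue_measure]_x h x)%E.
Proof.
move=> mf mg mh f0 g0 h0 fgh.
pose tr (u : R -> \bar R) (n : nat) (x : R) := Order.min (u x) n%:R%:E.
have mtr u n : measurable_fun [set: R] u -> measurable_fun [set: R] (tr u n).
  by move=> mu; exact: measurable_mine.
have tr0 u n x : (0 <= u x)%E -> (0 <= tr u n x)%E.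
  by move=> u0; rewrite le_min u0 lee_fin ler0n.
have trle u n x : (tr u n x <= u x)%E by rewrite ge_min lexx.
have trcvg u : measurable_fun [set: R] u -> (forall x, 0 <= u x)%E ->
    ((\int[lebesgue_measure]_x tr u n x) @[n --> \oo] -->
     \int[lebesgue_measure]_x u x)%E.
  move=> mu u0.
  have -> : (\int[lebesgue_measure]_x u x =
      \int[lebesgue_measure]_x (limn (tr u ^~ x)))%E.
    apply: eq_integral => x _; apply/esym/cvg_lim => //.
    have := u0 x; rewrite /tr; case: (u x) => [r| |]// r0.
      apply: cvg_near_cst; near=> n; apply/min_idPl.
      by rewrite lee_fin; near: n; exact: nbhs_infty_ger.
    rewrite (_ : (fun n => _) = (fun n => n%:R%:E)); last first.
      by apply/funext => n; rewrite minC miney.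
    by apply/cvgenyP; exact: cvg_id.
  apply: cvg_monotone_convergence => //.
  - by move=> n; exact: mtr.
  - by move=> n x _; exact: tr0.
  - move=> x _ m n mn; rewrite /tr le_min ge_min lexx/= ge_min lee_fin.
    by rewrite ler_nat mn orbT.
have bnd n : (\int[lebesgue_measure]_x tr f n x * \int[lebesgue_measure]_x tr g n x <=
   \int[lebesgue_measure]_x h x * \int[lebesgue_measure]_x h x)%E.
  apply: (@prekopa_leindler1_bounded _ _ _ _ n%:R) => //; try exact: mtr.
  - by move=> x; rewrite tr0// ge_min lexx orbT.
  - by move=> x; rewrite tr0// ge_min lexx orbT.
  - by move=> x y; apply: le_trans (fgh x y); apply: lee_pmul; rewrite ?tr0.
set F := (\int[lebesgue_measure]_x f x)%E; set G := (\int[lebesgue_measure]_x g x)%E.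
have F0 : (0 <= F)%E by exact: integral_ge0.
have G0 : (0 <= G)%E by exact: integral_ge0.
have HH0 : (0 <= \int[lebesgue_measure]_x h x * \int[lebesgue_measure]_x h x)%E.
  by apply: mule_ge0; exact: integral_ge0.
(* Zero integrals are set aside because multiplication in the extended reals is not continuous at
   [0 * +oo]. *)
have [->|F1] := eqVneq F 0%E; first by rewrite mul0e.
have [->|G1] := eqVneq G 0%E; first by rewrite mule0.
have FG : mule_def F G by rewrite mule_defE (negbTE F1) (negbTE G1).
have FGcvg : ((\int[lebesgue_measure]_x tr f n x *
    \int[lebesgue_measure]_x tr g n x) @[n --> \oo] --> F * G)%E.
  by apply: cvgeM => //; exact: trcvg.
rewrite -(cvg_lim _ FGcvg)//; apply: lime_le; last by near=> n; exact: bnd.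
by apply/cvg_ex; exists (F * G)%E.
Unshelve. all: by end_near. Qed.

(** * Lebesgue measure on row vectors *)

Lemma measurable_borelT (R : realType) (T : ptopologicalType) (f : T -> R) :
  continuous f -> measurable_fun [set: borel T] (f : borel T -> R).
Proof.
move=> cf; apply: (measurability _ (RGenOpens.measurableE R)).
move=> _ [_ [a [b ->]] <-]; rewrite setTI; apply: sub_gen_smallest.
by apply: open_comp; [move=> x _; exact: cf|exact: interval_open].
Qed.

Lemma measurable_coord (R : realType) (n : nat) (i : 'I_n) :
  measurable_fun [set: borel 'rV[R]_n] (fun a : borel 'rV[R]_n => a ord0 i).
Proof. by apply: measurable_borelT => a; exact: coord_continuous. Qed.

(** Balls of the sup norm are boxes, and those with rational centres and radii [1 / q.+1] form a
    countable base; so every open set is a countable union of sets cut out by coordinates. *)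
Lemma measurable_rV (R : realType) (n : nat) d (T : measurableType d)
    (f : T -> borel 'rV[R]_n) :
  (forall i, measurable_fun setT (fun x => f x ord0 i)) -> measurable_fun setT f.
Proof.
move=> mf; apply: (@measurability _ _ T (borel 'rV[R]_n) setT f (@open 'rV[R]_n)) => //.
move=> _ [U oU <-]; rewrite setTI.
pose b (q : 'rV[rat]_n * nat) := ball (map_mx ratr q.1 : 'rV[R]_n) q.2.+1%:R^-1.
have -> : f @^-1` U = \bigcup_(q in [set: 'rV[rat]_n * nat])
    (if `[<b q `<=` U>] then f @^-1` b q else set0).
  apply/seteqP; split => [x Ux|x [q _]]; last first.
    by case: ifPn => // /asboolP bU; exact: bU.
  have /nbhs_ballP[e /= e0 eU] := open_nbhs_nbhs (conj oU Ux).
  have e20 : 0 < e / 2 by rewrite divr_gt0.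
  (* The rational centre is taken within [1 / N.+1 < e / 2] of the point, so the ball of that radius
     around it contains the point and stays in the [e]-ball. *)
  have [N _ /(_ N (leqnn N)) /= Ne] := near_infty_natSinv_lt (PosNum e20).
  have N0 : 0 < N.+1%:R^-1 :> R by rewrite invr_gt0.
  have rq (i : 'I_n) : exists q : rat, ball (ratr q : R) N.+1%:R^-1 (f x ord0 i).
    have := @rat_in_itvoo R (f x ord0 i - N.+1%:R^-1) (f x ord0 i + N.+1%:R^-1).
    case; first by rewrite ltrBlDr -addrA ltrDl addr_gt0.
    move=> q; rewrite in_itv/= => /andP[q1 q2]; exists q.
    rewrite -ball_normE /ball_/= ltr_norml; move: (ratr q) q1 q2 => r q1 q2.
    by apply/andP; split; move: (N.+1%:R^-1) q1 q2 => s q1 q2; lra.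
  have /choice[q qx] := rq.
  exists (\row_i q i, N) => //; case: ifPn => [_|/asboolP].
    by split => // i j; rewrite !mxE ord1; exact: qx.
  case=> z [_ bz]; apply: eU; split => // i j.
  have := qx j; have := bz i j; rewrite !mxE ord1 -!ball_normE /ball_/= => z1 x1.
  rewrite -(subrK (ratr (q j)) (f x ord0 j)) -addrA.
  by rewrite (le_lt_trans (ler_normD _ _))// [X in X + _]distrC;
  move: (`|_|) (`|_|) (N.+1%:R^-1) Ne z1 x1 => p r u Ne z1 x1; lra.
apply: countable_bigcupT_measurable; first exact: countableP.
move=> q; case: ifPn => // _.
have -> : f @^-1` b q = \bigcap_(i in [set: 'I_n])
    ((fun x => f x ord0 i) @^-1` ball (ratr (q.1 ord0 i) : R) q.2.+1%:R^-1).
  apply/seteqP; split => x /=.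
    by move=> [_ bx] i _ /=; have := bx ord0 i; rewrite mxE.
  by move=> bx; split=> [|i j]; rewrite ?invr_gt0// mxE ord1; exact: bx.
apply: fin_bigcap_measurable; first exact: finite_finset.
move=> i _; rewrite -[X in measurable X]setTI.
by apply: mf => //; exact: measurable_ball.
Qed.

Lemma row_snoc_lift (R : realType) n (p : 'rV[R]_n * R) (i : 'I_n) :
  row_snoc p ord0 (lift ord_max i) = p.1 ord0 i.
Proof. by rewrite mxE liftK. Qed.

Lemma row_snoc_max (R : realType) n (p : 'rV[R]_n * R) :
  row_snoc p ord0 ord_max = p.2.
Proof. by rewrite mxE unlift_none. Qed.

Definition row_split (R : realType) n (v : 'rV[R]_n.+1) : 'rV[R]_n * R :=
  (\row_i v ord0 (lift ord_max i), v ord0 ord_max).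

Lemma row_splitK (R : realType) n : cancel (@row_split R n) (@row_snoc R n).
Proof.
move=> v; apply/rowP => i; rewrite mxE; case: unliftP => [j|] -> //=.
by rewrite mxE.
Qed.

Lemma row_snocK (R : realType) n : cancel (@row_snoc R n) (@row_split R n).
Proof.
move=> [v x]; congr pair; last exact: row_snoc_max.
by apply/rowP => i; rewrite mxE row_snoc_lift.
Qed.

Lemma row_snocD (R : realType) n (p q : 'rV[R]_n * R) :
  row_snoc p + row_snoc q = row_snoc (p.1 + q.1, p.2 + q.2).
Proof. by apply/rowP => i; rewrite !mxE; case: unlift => [j|] //=; rewrite !mxE. Qed.

Lemma row_snocZ (R : realType) n (a : R) (p : 'rV[R]_n * R) :
  a *: row_snoc p = row_snoc (a *: p.1, a * p.2).
Proof. by apply/rowP => i; rewrite !mxE; case: unlift => [j|] //=; rewrite !mxE. Qed.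

(** Stated for any commutative monoid, to serve both the product in [gauss_pdf] and the sum in
    [rdot]. *)
Lemma big_row_snoc (R : realType) (V : Type) (idx : V) (op : Monoid.com_law idx) n
    (F : 'I_n.+1 -> R -> V) (p : 'rV[R]_n * R) :
  \big[op/idx]_(i < n.+1) F i (row_snoc p ord0 i) =
  op (F ord_max p.2) (\big[op/idx]_(i < n) F (lift ord_max i) (p.1 ord0 i)).
Proof.
rewrite big_ord_recr/= row_snoc_max Monoid.mulmC; congr (op _ _).
apply: eq_bigr => i _; have -> : widen_ord (leqnSn n) i = lift ord_max i.
  by apply: val_inj; rewrite /= /bump leqNgt ltn_ord.
by rewrite row_snoc_lift.
Qed.

Lemma measurable_row_snoc (R : realType) n :
  measurable_fun [set: borel 'rV[R]_n * measurableTypeR R]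
    (@row_snoc R n : borel 'rV[R]_n * measurableTypeR R -> borel 'rV[R]_n.+1).
Proof.
apply: measurable_rV => i; case: (unliftP ord_max i) => [j|] ->.
  under eq_fun do rewrite row_snoc_lift.
  exact: (@measurableT_comp _ _ _ _ _ _ (fun a : borel 'rV[R]_n => a ord0 j) _ fst
    (measurable_coord j) measurable_fst).
under eq_fun do rewrite row_snoc_max.
exact: measurable_snd.
Qed.

Lemma measurable_row_split (R : realType) n :
  measurable_fun [set: borel 'rV[R]_n.+1]
    (@row_split R n : borel 'rV[R]_n.+1 -> borel 'rV[R]_n * measurableTypeR R).
Proof.
apply: measurable_fun_pair; last exact: measurable_coord.
apply: measurable_rV => i; under eq_fun do rewrite mxE.
exact: measurable_coord.
Qed.

Section sigma_finite_packing.
Context d (T : measurableType d) (R : realType).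
Context (m : {measure set T -> \bar R}) (mS : sigma_finite setT m).

(** The vacuous argument keeps the proof of sigma-finiteness inside the term, where the instance
    declared next can find it. [probability_pack] and [finite_pack] are built in the same way. *)
Definition sigma_finite_pack of sigma_finite setT m : set T -> \bar R := m.
HB.instance Definition _ := Measure.copy (sigma_finite_pack mS) m.
HB.instance Definition _ :=
  Measure_isSigmaFinite.Build _ _ _ (sigma_finite_pack mS) mS.

End sigma_finite_packing.

(** Sigma-finiteness is carried along the induction, since products and Tonelli rest on it. The
    exhausting sets are products, pulled back along [row_split]. *)
Lemma lebesgue_rV_measure (R : realType) n :
  exists m : {sigma_finite_measure set (borel 'rV[R]_n) -> \bar R},
    (m : set _ -> \bar R) = @lebesgue_rV R n.
Proof.
elim: n => [|n [m mE]]; first by exists (dirac (0 : borel 'rV[R]_0)).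
pose m1 := pushm (m \x lebesgue_measure)%E (@measurable_row_snoc R n).
have m1S : sigma_finite setT m1.
  have [F FT mF] : sigma_finite setT (m \x @lebesgue_measure R)%E.
    have /sigma_finiteP[F [TF ndF Foo]] := sigma_finiteT m.
    have /sigma_finiteP[G [TG ndG Goo]] := sigma_finiteT (@lebesgue_measure R).
    exists (fun n => F n `*` G n).
      rewrite -setXTT TF TG predeqE => -[x y]; split; last first.
        by move=> [k _ []/= ? ?]; split; exists k.
      move=> [/= [i _ Fnx] [k _ Gky]]; exists (maxn i k) => //; split.
      - by move: x Fnx; exact/subsetPset/ndF/leq_maxl.
      - by move: y Gky; exact/subsetPset/ndG/leq_maxr.
    move=> k; have [? ?] := Foo k; have [? ?] := Goo k.
    split; first exact: measurableX.
    by rewrite product_measure1E// lte_mul_pinfty// ge0_fin_numE.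
  exists (fun k => (@row_split R n) @^-1` F k).
    by rewrite -preimage_bigcup -FT.
  move=> k; have [mFk Fkoo] := mF k; split.
    by rewrite -[X in measurable X]setTI; exact: measurable_row_split.
  suff E : @row_snoc R n @^-1` (@row_split R n @^-1` F k) = F k.
    by rewrite /m1 /pushm/= /pushforward E.
  by apply/funext => p /=; rewrite row_snocK.
exists (sigma_finite_pack m1S).
by apply/funext => A; rewrite /= -mE.
Qed.

Definition leb_rV (R : realType) n : {sigma_finite_measure set (borel 'rV[R]_n) -> \bar R} :=
  projT1 (cid (lebesgue_rV_measure R n)).

Lemma leb_rVE (R : realType) n : (leb_rV R n : set _ -> \bar R) = @lebesgue_rV R n.
Proof. exact: projT2 (cid (lebesgue_rV_measure R n)). Qed.

Lemma ge0_integral_rV0 (R : realType) (f : borel 'rV[R]_0 -> \bar R) :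
  measurable_fun setT f -> (forall a, 0 <= f a)%E ->
  (\int[leb_rV R 0]_a f a = f (0%R : 'rV[R]_0))%E.
Proof.
move=> mf f0; rewrite leb_rVE/= -[LHS]/(\int[dirac ((0%R : 'rV[R]_0) : borel 'rV[R]_0)]_a f a)%E.
by rewrite integral_dirac// diracT mul1e.
Qed.

Section row_snoc_integral.
Context (R : realType) (n : nat) (f : borel 'rV[R]_n.+1 -> \bar R).
Hypotheses (mf : measurable_fun setT f) (f0 : forall a, (0 <= f a)%E).

Lemma measurable_fun_row_snoc : measurable_fun
  [set: borel 'rV[R]_n * measurableTypeR R] (fun p => f (row_snoc p)).
Proof. exact: (measurableT_comp mf (@measurable_row_snoc R n)). Qed.

Lemma measurable_integral_row_snoc :
  measurable_fun [set: borel 'rV[R]_n]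
    (fun v => \int[lebesgue_measure]_x f (row_snoc (v, x)))%E.
Proof.
exact: (@measurable_fun_fubini_tonelli_F _ _ _ _ _ (@lebesgue_measure R) _
  measurable_fun_row_snoc).
Qed.

Lemma integral_row_snoc_ge0 v :
  (0 <= \int[lebesgue_measure]_x f (row_snoc (v, x)))%E.
Proof. exact: integral_ge0. Qed.

Lemma ge0_integral_rVS :
  (\int[leb_rV R n.+1]_a f a =
   \int[leb_rV R n]_v \int[lebesgue_measure]_x f (row_snoc (v, x)))%E.
Proof.
transitivity (\int[pushm (leb_rV R n \x @lebesgue_measure R)%E
   (@measurable_row_snoc R n)]_a f a)%E.
  apply: eq_measure_integral => A mA _.
  have E : (leb_rV R n.+1 : set _ -> _) A =
      (leb_rV R n \x @lebesgue_measure R)%E (@row_snoc R n @^-1` A).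
    by rewrite (leb_rVE R n.+1) (leb_rVE R n).
  exact: E.
rewrite ge0_integral_pushforward//; last exact: measurable_row_snoc.
by rewrite preimage_setT
  (fubini_tonelli1 _ measurable_fun_row_snoc (fun p => f0 (row_snoc p))).
Qed.

End row_snoc_integral.

Lemma measurable_rVD (R : realType) n (b : 'rV[R]_n) :
  measurable_fun [set: borel 'rV[R]_n] (fun a : borel 'rV[R]_n => (a + b : borel 'rV[R]_n)).
Proof.
apply: measurable_rV => i; under eq_fun do rewrite mxE.
by apply: measurable_funD => //; exact: measurable_coord.
Qed.

Lemma measurable_rVN (R : realType) n :
  measurable_fun [set: borel 'rV[R]_n] (fun a : borel 'rV[R]_n => (- a : borel 'rV[R]_n)).
Proof.
apply: measurable_rV => i; under eq_fun do rewrite mxE.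
apply: measurable_funN; exact: measurable_coord.
Qed.

Lemma measurable_row_section (R : realType) n (f : borel 'rV[R]_n.+1 -> \bar R) v :
  measurable_fun setT f ->
  measurable_fun [set: R] (fun x : R => f (row_snoc (v, x))).
Proof.
move=> mf; exact: (measurableT_comp (measurable_fun_row_snoc mf)
  (measurable_pair1 (v : borel 'rV[R]_n))).
Qed.

Lemma leb_rV_shift (R : realType) n (b : 'rV[R]_n) (f : borel 'rV[R]_n -> \bar R) :
  measurable_fun setT f -> (forall a, 0 <= f a)%E ->
  (\int[leb_rV R n]_a f (a + b)%R = \int[leb_rV R n]_a f a)%E.
Proof.
elim: n => [|n IH] in b f *.
  move=> mf f0; rewrite !ge0_integral_rV0//.
    by congr f; apply/rowP => -[].
  exact (measurableT_comp mf (measurable_rVD b)).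
move=> mf f0; rewrite (ge0_integral_rVS mf f0).
rewrite (ge0_integral_rVS (measurableT_comp mf (measurable_rVD b)) (fun a => f0 (a + b))).
transitivity (\int[leb_rV R n]_v \int[lebesgue_measure]_x
    f (row_snoc ((v + (row_split b).1)%R, x)))%E; last first.
  exact: (IH _ _ (measurable_integral_row_snoc mf f0) (integral_row_snoc_ge0 f0)).
apply: eq_integral => v _.
transitivity (\int[lebesgue_measure]_x
    f (row_snoc ((v + (row_split b).1)%R, (x + (row_split b).2)%R)))%E.
  by apply: eq_integral => x _; rewrite /= -[b in LHS]row_splitK row_snocD.
by rewrite (ge0_integral_shift _ (measurable_row_section _ mf)).
Qed.

Lemma leb_rV_opp (R : realType) n (f : borel 'rV[R]_n -> \bar R) :
  measurable_fun setT f -> (forall a, 0 <= f a)%E ->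
  (\int[leb_rV R n]_a f (- a)%R = \int[leb_rV R n]_a f a)%E.
Proof.
elim: n => [|n IH] in f *.
  move=> mf f0; rewrite !ge0_integral_rV0//.
    by congr f; apply/rowP => -[].
  exact (measurableT_comp mf (@measurable_rVN R 0)).
move=> mf f0; rewrite (ge0_integral_rVS mf f0).
rewrite (ge0_integral_rVS (measurableT_comp mf (@measurable_rVN R n.+1)) (fun a => f0 (- a))).
transitivity (\int[leb_rV R n]_v \int[lebesgue_measure]_x
    f (row_snoc ((- v)%R, x)))%E; last first.
  exact: (IH _ (measurable_integral_row_snoc mf f0) (integral_row_snoc_ge0 f0)).
apply: eq_integral => v _.
transitivity (\int[lebesgue_measure]_x f (row_snoc ((- v)%R, (- x)%R)))%E.
  by apply: eq_integral => x _; rewrite /= -scaleN1r row_snocZ scaleN1r/= mulN1r.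
by rewrite (ge0_integral_oppr (measurable_row_section _ mf)).
Qed.

(** Tensorisation: the one-dimensional inequality on the last coordinate, with the others fixed, is
    precisely the hypothesis of the inequality in one dimension less for the integrated
    functions. *)
Lemma prekopa_leindler_rV (R : realType) n (f g h : borel 'rV[R]_n -> \bar R) :
  measurable_fun setT f -> measurable_fun setT g -> measurable_fun setT h ->
  (forall x, (0 <= f x)%E) -> (forall x, (0 <= g x)%E) ->
  (forall x, (0 <= h x)%E) ->
  (forall x y, (f x * g y <= h (2^-1 *: (x + y))%R * h (2^-1 *: (x + y))%R)%E) ->
  (\int[leb_rV R n]_x f x * \int[leb_rV R n]_x g x <=
   \int[leb_rV R n]_x h x * \int[leb_rV R n]_x h x)%E.
Proof.
elim: n => [|n IH] in f g h *.
  move=> mf mg mh f0 g0 h0 fgh; rewrite !ge0_integral_rV0//.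
  by have := fgh 0 0; rewrite addr0 scaler0.
move=> mf mg mh f0 g0 h0 fgh.
rewrite (ge0_integral_rVS mf f0) (ge0_integral_rVS mg g0) (ge0_integral_rVS mh h0).
refine (IH _ _ _ (measurable_integral_row_snoc mf f0) (measurable_integral_row_snoc mg g0)
  (measurable_integral_row_snoc mh h0) (integral_row_snoc_ge0 f0) (integral_row_snoc_ge0 g0)
  (integral_row_snoc_ge0 h0) _).
move=> v w; refine (prekopa_leindler1 (measurable_row_section v mf)
  (measurable_row_section w mg) (measurable_row_section (2^-1 *: (v + w)) mh) _ _ _ _).
- by move=> x; exact: f0.
- by move=> x; exact: g0.
- by move=> x; exact: h0.
move=> x y; have := fgh (row_snoc (v, x)) (row_snoc (w, y)).
by rewrite row_snocD row_snocZ/= [2^-1 * _]mulrC.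
Qed.

(** Used in [bmass_gt0], to exclude that all balls are null. *)
Lemma leb_rV_setT_gt0 (R : realType) n : (0 < leb_rV R n setT)%E.
Proof.
have TI : (@lebesgue_measure R setT = +oo)%E.
  by rewrite -set_itvNyy lebesgue_measure_itv.
elim: n => [|n IH].
  have -> : (leb_rV R 0 : set _ -> _) setT = dirac ((0%R : 'rV[R]_0) : borel 'rV[R]_0) setT.
    by rewrite (leb_rVE R 0).
  by rewrite diracT.
have -> : leb_rV R n.+1 setT = (\int[leb_rV R n.+1]_a 1)%E.
  by rewrite integral_cst// mul1e.
rewrite (@ge0_integral_rVS _ _ (fun=> 1%E))//.
rewrite (eq_integral (cst +oo%E)); first by rewrite integral_cst// gt0_mulye.
by move=> v _; rewrite integral_cst// mul1e; exact: TI.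
Qed.

Definition box_rV (R : realType) n (r : R) : set (borel 'rV[R]_n) :=
  [set a | forall i, `|(a : 'rV[R]_n) ord0 i| <= r].

Lemma measurable_box_rV (R : realType) n (r : R) : measurable (@box_rV R n r).
Proof.
have -> : @box_rV R n r =
    \bigcap_(i in [set: 'I_n]) ((fun a : borel 'rV[R]_n => `|a ord0 i|) @^-1` `]-oo, r]).
  apply/seteqP; split => a /= ar i; first by move=> _; rewrite /= in_itv/=; exact: ar.
  by have := ar i Logic.I; rewrite /= in_itv.
apply: fin_bigcap_measurable; first exact: finite_finset.
move=> i _; rewrite -[X in measurable X]setTI.
have : measurable_fun setT (fun a : borel 'rV[R]_n => `|a ord0 i|).
  exact: (measurableT_comp (@normr_measurable R setT) (measurable_coord i)).
by apply => //; exact: measurable_itv.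
Qed.

Lemma leb_rV_box (R : realType) n (r : R) : (leb_rV R n (box_rV r) < +oo)%E.
Proof.
elim: n => [|n IH].
  have -> : (leb_rV R 0 : set _ -> _) = dirac ((0%R : 'rV[R]_0) : borel 'rV[R]_0).
    by rewrite (leb_rVE R 0).
  by rewrite (le_lt_trans (probability_le1 _ _)) ?ltry//; exact: measurable_box_rV.
have mB := @measurable_box_rV R n.+1 r.
have -> : leb_rV R n.+1 (box_rV r) = (\int[leb_rV R n.+1]_a (\1_(box_rV r) a)%:E)%E.
  by rewrite integral_indic// setIT.
rewrite (@ge0_integral_rVS _ _ (EFin \o \1_(box_rV r))); last 2 first.
  by apply/measurable_EFinP; exact: measurable_indic.
  by move=> a; rewrite lee_fin.
have -> : (\int[leb_rV R n]_v \int[lebesgue_measure]_x (EFin \o \1_(@box_rV R n.+1 r)) (row_snoc (v, x)) =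
  \int[leb_rV R n]_v ((lebesgue_measure (`[(- r)%R, r]%classic : set R)) * (\1_(@box_rV R n r) v)%:E))%E.
  apply: eq_integral => v _.
  have E x : \1_(@box_rV R n.+1 r) (row_snoc (v, x)) =
      \1_(`[(- r), r]%classic : set R) x * \1_(@box_rV R n r) v :> R.
    rewrite !indicE -natrM mulnb; congr (_ %:R); congr nat_of_bool.
    apply/idP/andP => [/set_mem bx|[/set_mem + /set_mem bv]].
      split; apply/mem_set.
        by rewrite /= in_itv/= -ler_norml; have := bx ord_max; rewrite row_snoc_max.
      by move=> i; have := bx (lift ord_max i); rewrite row_snoc_lift.
    rewrite /= in_itv/= -ler_norml => xr; apply/mem_set => i.
    case: (unliftP ord_max i) => [j|] ->; first by rewrite row_snoc_lift; exact: bv.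
    by rewrite row_snoc_max.
  under eq_integral => x _ do rewrite /= E EFinM.
  rewrite ge0_integralZr//.
  - by rewrite integral_indic// setIT.
  - by apply/measurable_EFinP; exact: measurable_indic.
rewrite ge0_integralZl//; last first.
  by apply/measurable_EFinP; apply: measurable_indic; exact: measurable_box_rV.
rewrite integral_indic// ?setIT; last exact: measurable_box_rV.
rewrite lte_mul_pinfty//.
by rewrite lebesgue_measure_itv/=; case: ifP.
Qed.

(** * Gaussian measures on row vectors *)

Section density.
Local Open Scope ereal_scope.
Context d (T : measurableType d) (R : realType).
Variables (lam nu : {measure set T -> \bar R}) (rho : T -> R).
Hypotheses (mrho : measurable_fun setT rho) (rho0 : forall x, (0 <= rho x)%R).
Hypothesis nuE : forall A, measurable A -> nu A = \int[lam]_(x in A) (rho x)%:E.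

Import HBNNSimple.

Let integral_density_nnsfun (f : {nnsfun T >-> R}) :
  \int[nu]_x (f x)%:E = \int[lam]_x ((f x)%:E * (rho x)%:E).
Proof.
under [LHS]eq_integral do rewrite fimfunE -fsumEFin//.
rewrite [LHS]ge0_integral_fsum//; last 2 first.
  - by move=> r; exact/measurable_EFinP/measurableT_comp.
  - by move=> n x _; rewrite EFinM nnfun_muleindic_ge0.
under [RHS]eq_integral.
  move=> x _; rewrite fimfunE -fsumEFin// muleC ge0_mule_fsumr; last first.
    by move=> r; rewrite EFinM nnfun_muleindic_ge0.
  over.
rewrite [RHS]ge0_integral_fsum//; last 2 first.
  - move=> r; apply: emeasurable_funM; first exact/measurable_EFinP.
    by apply/measurable_EFinP; apply/measurableT_comp.
  - move=> n x _; rewrite mule_ge0//; first by rewrite lee_fin.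
    by rewrite EFinM nnfun_muleindic_ge0.
apply: eq_fsbigr => r _.
rewrite integralZl_indic_nnsfun// integral_indic// setIT nuE//.
under [RHS]eq_integral do rewrite EFinM muleCA.
have [r0|r0] := leP 0%R r.
  rewrite ge0_integralZl//; last 2 first.
  - by apply: emeasurable_funM; apply/measurable_EFinP => //; exact: measurable_indic.
  - by move=> x _; rewrite mule_ge0// lee_fin.
  congr (_ * _); rewrite integral_mkcond; apply: eq_integral => x _.
  by rewrite patchE indicE; case: (x \in _); rewrite ?mule1 ?mule0.
rewrite preimage_nnfun0// integral_set0 mule0 integral0_eq// => x _.
by rewrite indic0 mule0 mule0.
Qed.

Lemma ge0_integral_density (f : T -> \bar R) :
  measurable_fun setT f -> (forall x, 0 <= f x) ->
  \int[nu]_x f x = \int[lam]_x (f x * (rho x)%:E).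
Proof.
move=> mf f0; pose f_ := nnsfun_approx measurableT mf.
transitivity (lim (\int[nu]_x (f_ n x)%:E @[n --> \oo])).
  rewrite -monotone_convergence//=.
  - apply: eq_integral => x _; apply/esym/cvg_lim => //=.
    exact/cvg_nnsfun_approx.
  - by move=> n; apply/measurable_EFinP.
  - by move=> n x _; rewrite lee_fin.
  - by move=> x _ a b ab; rewrite lee_fin; exact/lefP/nd_nnsfun_approx.
rewrite (_ : (fun n => \int[nu]_x (f_ n x)%:E) =
    (fun n => \int[lam]_x ((f_ n x)%:E * (rho x)%:E))); last first.
  by apply/funext => n; rewrite integral_density_nnsfun.
rewrite -monotone_convergence//=.
- apply: eq_integral => x _; apply/cvg_lim => //=.
  by apply: cvgeMr => //; exact/cvg_nnsfun_approx.
- move=> n; apply: emeasurable_funM; exact/measurable_EFinP.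
- by move=> n x _; rewrite mule_ge0// lee_fin.
- by move=> x _ a b ab; rewrite lee_wpmul2r// lee_fin//; exact/lefP/nd_nnsfun_approx.
Qed.

End density.

(** * Centred normal laws on the line *)

Section normal.
Context (R : realType).
Implicit Types s t x y c : R.

Lemma integral_normal_prob s (f : R -> \bar R) :
  measurable_fun [set: R] f -> (forall x, 0 <= f x)%E ->
  (\int[normal_prob 0 s]_x f x =
   \int[lebesgue_measure]_x (f x * (normal_pdf 0 s x)%:E))%E.
Proof.
move=> mf f0; apply: ge0_integral_density => //.
- exact: measurable_normal_pdf.
- by move=> x; exact: normal_pdf_ge0.
Qed.

Lemma integral_normal_fun s : 0 < s ->
  (\int[lebesgue_measure]_x (normal_fun 0 s x)%:E = (s * Num.sqrt (pi *+ 2))%:E)%E.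
Proof.
move=> s0; have p0 : 0 < normal_peak s by rewrite normal_peak_gt0// gt_eqF.
have := integral_normal_pdf (0 : R) s; rewrite normal_pdfE ?gt_eqF//.
under eq_integral do rewrite EFinM.
rewrite ge0_integralZl//; last 3 first.
- by apply/measurable_EFinP; exact: measurable_normal_fun.
- by move=> x _; rewrite lee_fin normal_fun_ge0.
- by rewrite lee_fin ltW.
move=> H; have : ((normal_peak s)^-1%:E * ((normal_peak s)%:E * \int[lebesgue_measure]_x (normal_fun 0 s x)%:E) = (normal_peak s)^-1%:E)%E by rewrite H mule1.
rewrite muleA -EFinM mulVf ?gt_eqF// mul1e => ->.
rewrite /normal_peak invrK -mulrnAr sqrtrM ?sqr_ge0//.
by rewrite sqrtr_sqr gtr0_norm.
Qed.

(** [centred_gaussian] leaves the sign of the deviation free. *)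
Lemma normal_pdfN s : normal_pdf 0 (- s) = normal_pdf 0 s :> (R -> R).
Proof.
apply/funext => x; rewrite /normal_pdf oppr_eq0; case: ifP => // _.
by rewrite /normal_peak /normal_fun sqrrN.
Qed.

Lemma normal_probN s : normal_prob 0 (- s) = normal_prob 0 s :> (set R -> \bar R).
Proof. by apply/funext => A; rewrite /normal_prob normal_pdfN. Qed.

(* [exp (-x^2/(2t^2))] is convex in [1/t^2]: comparing it with its tangent
   brackets the second moment between secant slopes, all integrals being
   known. *)
Lemma normal_fun_moment2 s t : 0 < s -> s < t ->
  let m a := (\int[lebesgue_measure]_x (x ^+ 2 * normal_fun 0 a x)%:E)%E in
  ((s + t)%:E * m s <= (2 * s ^+ 2 * t ^+ 2 * Num.sqrt (pi *+ 2))%:E /\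
   (2 * s ^+ 2 * t ^+ 2 * Num.sqrt (pi *+ 2))%:E <= (s + t)%:E * m t)%E.
Proof.
move=> s0 st; have t0 := lt_trans s0 st; set K := Num.sqrt _.
(* [normal_fun 0 t] is [normal_fun 0 s] times [expR (c * x ^+ 2)]. The two bounds are
   [expR y >= 1 + y] at [y = c * x ^+ 2] and at [y = - (c * x ^+ 2)]. *)
pose c := 2^-1 * (s ^- 2 - t ^- 2).
have c0 : 0 < c.
  rewrite mulr_gt0// subr_gt0 ltf_pV2 ?posrE ?exprn_gt0//.
  by rewrite ltr_pXn2r// nnegrE ltW.
have mN a : measurable_fun [set: R] (EFin \o normal_fun 0 a).
  by apply/measurable_EFinP; exact: measurable_normal_fun.
have mM a : measurable_fun [set: R] (fun x => (x ^+ 2 * normal_fun 0 a x)%:E).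
  apply/measurable_EFinP; apply: measurable_funM; last exact: measurable_normal_fun.
  exact: measurable_funX.
have M0 a x : (0 <= (x ^+ 2 * normal_fun 0 a x)%:E)%E.
  by rewrite lee_fin mulr_ge0 ?sqr_ge0 ?normal_fun_ge0.
have N0 a x : (0 <= (normal_fun 0 a x)%:E)%E by rewrite lee_fin normal_fun_ge0.
have ets x : normal_fun 0 t x = normal_fun 0 s x * expR (c * x ^+ 2).
  rewrite /normal_fun -expRD; congr expR; rewrite /c subr0.
  by field; rewrite !gt_eqF.
have cint a : (\int[lebesgue_measure]_x (c * (x ^+ 2 * normal_fun 0 a x))%:E =
    c%:E * \int[lebesgue_measure]_x (x ^+ 2 * normal_fun 0 a x)%:E)%E.
  under eq_integral do rewrite EFinM.
  by apply: ge0_integralZl => //; [exact: mM|rewrite lee_fin ltW].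
have mcM a : measurable_fun [set: R] (fun x => (c * (x ^+ 2 * normal_fun 0 a x))%:E).
  by under eq_fun do rewrite EFinM; exact: measurable_funeM.
have cM0 a x : (0 <= (c * (x ^+ 2 * normal_fun 0 a x))%:E)%E.
  by rewrite EFinM mule_ge0// lee_fin ltW.
have up : (c%:E * \int[lebesgue_measure]_x (x ^+ 2 * normal_fun 0 s x)%:E +
    (s * K)%:E <= (t * K)%:E)%E.
  rewrite -!integral_normal_fun// -cint -ge0_integralD//; try exact: mN; try exact: mcM.
  apply: ge0_le_integral => //.
  - by move=> x _; rewrite adde_ge0.
  - exact: emeasurable_funD (mcM _) (mN _).
  - exact: mN.
  move=> x _; rewrite -EFinD lee_fin ets.
  have := expR_ge1Dx (c * x ^+ 2); have := normal_fun_ge0 0 s x.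
  by move: (normal_fun _ _ _) (expR _) => p q p0 pq; nra.
have lo : ((t * K)%:E <=
    c%:E * \int[lebesgue_measure]_x (x ^+ 2 * normal_fun 0 t x)%:E + (s * K)%:E)%E.
  rewrite -!integral_normal_fun// -cint -ge0_integralD//; try exact: mN; try exact: mcM.
  apply: ge0_le_integral => //.
  - exact: mN.
  - exact: emeasurable_funD (mcM _) (mN _).
  move=> x _; rewrite -EFinD lee_fin.
  have -> : normal_fun 0 s x = normal_fun 0 t x * expR (- (c * x ^+ 2)).
    by rewrite ets -mulrA -expRD subrr expR0 mulr1.
  have := expR_ge1Dx (- (c * x ^+ 2)); have := normal_fun_ge0 0 t x.
  by move: (normal_fun _ _ _) (expR _) => p q p0 pq; nra.
(* This identity turns the secant slope [(t - s) / c] into the constant of the statement. *)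
have cE : (s + t) * (t - s) = (2 * s ^+ 2 * t ^+ 2) * c.
  by rewrite /c; field; rewrite !gt_eqF.
have ts0 : 0 < t - s by rewrite subr_gt0.
have K0 : 0 < K by rewrite sqrtr_gt0 mulrn_wgt0// pi_gt0.
split.
- move: up; rewrite -leeBrDr// -EFinB -mulrBl => up.
  rewrite -(@lee_pmul2l _ (c%:E))//.
  rewrite muleCA; apply: (@le_trans _ _ ((s + t)%:E * ((t - s) * K)%:E)%E).
    by rewrite lee_pmul2l// lte_fin addr_gt0.
  by rewrite -!EFinM mulrA cE lee_fin; nra.
- move: lo; rewrite -leeBlDr// -EFinB -mulrBl => lo.
  rewrite -(@lee_pmul2l _ (c%:E))//.
  rewrite muleCA; apply: (@le_trans _ _ ((s + t)%:E * ((t - s) * K)%:E)%E); last first.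
    by rewrite lee_pmul2l// lte_fin addr_gt0.
  rewrite -!EFinM lee_fin [leRHS]mulrA cE le_eqVlt; apply/orP; left; apply/eqP; ring.
Qed.

(** [normal_fun_moment2] squeezes the variance [V] between [t ^+ 2] for [t < s] and [t ^+ 2] for
    [t > s]. If [V] differed from [s ^+ 2], the midpoint of [s] and [sqrt V] would violate one of
    these bounds. *)
Lemma normal_moment2 s : s != 0 ->
  (\int[normal_prob 0 s]_x (x ^+ 2)%:E = (s ^+ 2)%:E)%E.
Proof.
wlog s0 : s / 0 < s => [H|_].
  rewrite neq_lt => /orP[s0|s0]; last by apply: H; rewrite ?gt_eqF.
  by rewrite -normal_probN (H (- s)) ?sqrrN ?oppr_gt0// oppr_eq0 lt_eqF.
rewrite integral_normal_prob; last 2 first.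
- by apply/measurable_EFinP; exact: measurable_funX.
- by move=> x; rewrite lee_fin sqr_ge0.
set K := Num.sqrt ((pi : R) *+ 2).
have K0 : 0 < K by rewrite sqrtr_gt0 mulrn_wgt0// pi_gt0.
have pk : normal_peak s = (s * K)^-1.
  by rewrite /normal_peak -mulrnAr sqrtrM ?sqr_ge0// sqrtr_sqr gtr0_norm.
pose m := (\int[lebesgue_measure]_x (x ^+ 2 * normal_fun 0 s x)%:E)%E.
have -> : (\int[lebesgue_measure]_x ((x ^+ 2)%:E * (normal_pdf 0 s x)%:E) =
    (s * K)^-1%:E * m)%E.
  rewrite /m -ge0_integralZl//; last 3 first.
  - apply/measurable_EFinP; apply: measurable_funM; last exact: measurable_normal_fun.
    exact: measurable_funX.
  - by move=> x _; rewrite lee_fin mulr_ge0 ?sqr_ge0 ?normal_fun_ge0.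
  - by rewrite lee_fin invr_ge0 mulr_ge0 ?ltW.
  apply: eq_integral => x _; rewrite normal_pdfE ?gt_eqF// pk -!EFinM.
  by congr EFin; rewrite mulrCA.
have m0 : (0 <= m)%E.
  by apply: integral_ge0 => x _; rewrite lee_fin mulr_ge0 ?sqr_ge0 ?normal_fun_ge0.
have mfin : m \is a fin_num.
  rewrite ge0_fin_numE// ltey; apply/negP => /eqP moo.
  have [] := @normal_fun_moment2 s (s + 1) s0; first by rewrite ltrDl.
  by rewrite -/m moo gt0_muley ?leye_eq// lte_fin; lra.
move: m0; rewrite -(fineK mfin) -EFinM lee_fin => m0; congr EFin.
have sK0 : 0 < s * K by rewrite mulr_gt0.
set V := (s * K)^-1 * fine m.
have mE : fine m = V * (s * K) by rewrite /V mulrAC mulVf ?mul1r// gt_eqF.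
have V0 : 0 <= V by rewrite mulr_ge0// invr_ge0 ltW.
have up t : s < t -> V <= t ^+ 2.
  move=> st; have [+ _] := normal_fun_moment2 s0 st.
  rewrite -/m -(fineK mfin) -EFinM lee_fin mE -/K => h.
  rewrite -(@ler_pM2r _ ((s + s) * s * K)); last by rewrite !mulr_gt0// addr_gt0.
  apply: le_trans (_ : (s + t) * (V * (s * K)) <= _); last by apply: le_trans h _; lra.
  have -> : V * ((s + s) * s * K) = (s + s) * (V * (s * K)) by ring.
  apply: ler_wpM2r; first by rewrite mulr_ge0// ltW.
  by rewrite lerD2l ltW.
have lo t : 0 < t -> t < s -> t ^+ 2 <= V.
  move=> t0 ts; have [_] := normal_fun_moment2 t0 ts.
  rewrite -/m -(fineK mfin) -EFinM lee_fin mE -/K => h.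
  rewrite -(@ler_pM2r _ ((s + s) * s * K)); last by rewrite !mulr_gt0// addr_gt0.
  apply: (@le_trans _ _ ((t + s) * (V * (s * K)))); first by apply: le_trans h; lra.
  have -> : V * ((s + s) * s * K) = (s + s) * (V * (s * K)) by ring.
  apply: ler_wpM2r; first by rewrite mulr_ge0// ltW.
  by rewrite lerD2r ltW.
have VE : Num.sqrt V ^+ 2 = V by rewrite sqr_sqrtr.
have sV0 := sqrtr_ge0 V.
apply/eqP; rewrite eq_le; apply/andP; split; rewrite leNgt; apply/negP => Vs.
- have sV : s < Num.sqrt V by rewrite -(@ltr_pXn2r _ 2)// ?nnegrE ?VE// ltW.
  have := up ((s + Num.sqrt V) / 2); rewrite -[leLHS]VE => H.
  have : s < (s + Num.sqrt V) / 2 by lra.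
  by move/H; rewrite ler_pXn2r// ?nnegrE; lra.
- have sV : Num.sqrt V < s by rewrite -(@ltr_pXn2r _ 2)// ?nnegrE ?VE// ltW.
  have := lo ((s + Num.sqrt V) / 2); rewrite -[leRHS]VE => H.
  have h1 : 0 < (s + Num.sqrt V) / 2 by lra.
  have : (s + Num.sqrt V) / 2 < s by lra.
  by move/(H h1); rewrite ler_pXn2r// ?nnegrE; lra.
Qed.

Lemma normal_scale s (f : R -> \bar R) : s != 0 ->
  measurable_fun [set: R] f -> (forall x, 0 <= f x)%E ->
  (\int[normal_prob 0 1]_x f (s * x)%R = \int[normal_prob 0 s]_x f x)%E.
Proof.
move=> s0 mf f0.
have mfs : measurable_fun [set: R] (fun x => f (s * x)%R).
  by apply: measurableT_comp => //; exact: measurable_funM.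
rewrite (integral_normal_prob s mf f0) (integral_normal_prob 1 mfs (fun x => f0 (s * x))).
have mp u : measurable_fun [set: R] (fun x => (normal_pdf 0 u x)%:E).
  by apply/measurable_EFinP; exact: measurable_normal_pdf.
have p0 u x : (0 <= (normal_pdf 0 u x)%:E)%E by rewrite lee_fin normal_pdf_ge0.
rewrite [RHS](@ge0_integral_affine _ s 0 _ s0 (emeasurable_funM mf (mp s))); last first.
  by move=> x; rewrite mule_ge0.
rewrite -ge0_integralZl//; last 2 first.
- apply: (@measurableT_comp _ _ _ _ _ _ (fun x => f x * (normal_pdf 0 s x)%:E)%E _ (fun x => s * x + 0)).
    by apply: emeasurable_funM.
  by apply: measurable_funD => //; exact: measurable_funM.
- by move=> x _; rewrite mule_ge0.
apply: eq_integral => x _; rewrite addr0 muleCA; congr (_ * _)%E.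
rewrite -EFinM; congr EFin; rewrite !normal_pdfE// ?oner_eq0//.
rewrite mulrA; congr (_ * _).
  rewrite /normal_peak expr1n mul1r -mulrnAr sqrtrM ?sqr_ge0// sqrtr_sqr invfM mulrA.
  by rewrite divff ?mul1r// normr_eq0.
by rewrite /normal_fun !subr0; congr expR; rewrite expr1n exprMn; field.
Qed.

(** Completing the square: given the sum [y] of two independent normal variables, the first one is
    normal with mean [y * s ^+ 2 / u ^+ 2] and deviation [s * t / u]. *)
Lemma normal_pdf_conv s t x y : s != 0 -> t != 0 ->
  let u := Num.sqrt (s ^+ 2 + t ^+ 2) in
  normal_pdf 0 t (y - x) * normal_pdf 0 s x =
  normal_pdf 0 u y * normal_pdf (y * s ^+ 2 / u ^+ 2) (s * t / u) x.
Proof.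
move=> s0 t0 u.
have uu : u ^+ 2 = s ^+ 2 + t ^+ 2 by rewrite sqr_sqrtr// addr_ge0// sqr_ge0.
have ss : s ^+ 2 != 0 by rewrite expf_neq0.
have tt : t ^+ 2 != 0 by rewrite expf_neq0.
have stp : 0 < s ^+ 2 + t ^+ 2 by rewrite ltr_pwDl ?sqr_ge0// exprn_even_gt0.
have u0 : u != 0 by rewrite gt_eqF// sqrtr_gt0.
rewrite !normal_pdfE// ?mulf_neq0 ?invr_eq0//.
rewrite mulrACA [RHS]mulrACA /normal_peak /normal_fun -!expRD; congr (_ * expR _).
  rewrite -!invfM -!sqrtrM; try by rewrite mulrn_wge0// mulr_ge0 ?sqr_ge0 ?pi_ge0.
  congr (Num.sqrt _)^-1; rewrite expr_div_n exprMn uu.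
  by field; rewrite gt_eqF.
rewrite expr_div_n exprMn uu subr0.
by field; rewrite gt_eqF// s0 t0.
Qed.

(** After Tonelli, the conditional density in [normal_pdf_conv] integrates to one and leaves the
    density of the sum. *)
Lemma normal_convolution s t (f : R -> \bar R) : s != 0 -> t != 0 ->
  measurable_fun [set: R] f -> (forall x, 0 <= f x)%E ->
  (\int[normal_prob 0 s]_x \int[normal_prob 0 t]_y f (x + y)%R =
   \int[normal_prob 0 (Num.sqrt (s ^+ 2 + t ^+ 2))]_x f x)%E.
Proof.
move=> s0 t0 mf f0; set u := Num.sqrt _.
have mp v : measurable_fun [set: R] (fun x => (normal_pdf 0 v x)%:E).
  by apply/measurable_EFinP; exact: measurable_normal_pdf.
have p0 m v x : (0 <= (normal_pdf m v x)%:E)%E by rewrite lee_fin normal_pdf_ge0.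
pose F (p : measurableTypeR R * measurableTypeR R) :=
  (f p.2 * (normal_pdf 0 t (p.2 - p.1) * normal_pdf 0 s p.1)%:E)%E.
have mF : measurable_fun setT F.
  apply: emeasurable_funM; first exact: measurableT_comp.
  apply/measurable_EFinP; apply: measurable_funM.
    apply: measurableT_comp; first exact: measurable_normal_pdf.
    by apply: measurable_funB.
  by apply: measurableT_comp => //; exact: measurable_normal_pdf.
have F0 p : (0 <= F p)%E by rewrite mule_ge0// lee_fin mulr_ge0// normal_pdf_ge0.
transitivity (\int[lebesgue_measure]_x \int[lebesgue_measure]_y F (x, y))%E.
  rewrite integral_normal_prob; last 2 first.
  - have mf2 : measurable_fun [set: measurableTypeR R * measurableTypeR R]
      (fun p => f (p.1 + p.2)%R).
      by apply: measurableT_comp => //; exact: measurable_funD.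
    have := @measurable_fun_fubini_tonelli_F _ _ _ _ R (normal_prob 0 t) _ mf2.
    by apply.
  - by move=> x; exact: integral_ge0.
  apply: eq_integral => x _.
  have mfx : measurable_fun [set: R] (fun y => f (x + y)%R).
    by apply: measurableT_comp => //; exact: measurable_funD.
  rewrite (integral_normal_prob _ mfx)// -ge0_integralZr//; last 2 first.
  - exact: emeasurable_funM mfx (mp t).
  - by move=> y _; rewrite mule_ge0.
  have mg : measurable_fun [set: R] (fun y => F (x, y)) by exact: measurableT_comp.
  rewrite -[RHS](@ge0_integral_shift _ x _ mg)//.
  apply: eq_integral => y _; rewrite /F/= EFinM muleA addrC.
  by rewrite addrK.
rewrite (fubini_tonelli F mF F0).
rewrite (integral_normal_prob _ mf f0); apply: eq_integral => y _.
under eq_integral do rewrite /F/= normal_pdf_conv// EFinM muleA.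
rewrite ge0_integralZl//; last 2 first.
- by apply/measurable_EFinP; exact: measurable_normal_pdf.
- by rewrite mule_ge0.
by rewrite integral_normal_pdf mule1.
Qed.

End normal.

Lemma finite_measure_lty d (T : measurableType d) (R : realType)
    (m : {finite_measure set T -> \bar R}) : (m setT < +oo)%E.
Proof. by rewrite ltey_eq fin_num_measure. Qed.

(** * Cosine transforms *)

Section char.
Context (R : realType).
Implicit Types s t c : R.

Lemma EFin_Rintegral d (T : measurableType d) (m : {measure set T -> \bar R}) (f : T -> R) :
  m.-integrable setT (EFin \o f) ->
  (\int[m]_x (f x)%:E = (\int[m]_x f x)%R%:E)%E.
Proof. by move=> fi; rewrite /Rintegral fineK// integrable_fin_num. Qed.

Section finite.
Context d (T : measurableType d) (m : {measure set T -> \bar R}).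
Hypothesis mfin : (m setT < +oo)%E.
Implicit Type f : T -> R.

Lemma measurable_cos_comp f : measurable_fun setT f -> measurable_fun setT (fun x => cos (f x)).
Proof.
move=> mf; apply: (@measurableT_comp _ _ _ _ _ _ cos) => //.
by apply: continuous_measurable_fun; exact: continuous_cos.
Qed.

Lemma measurable_sin_comp f : measurable_fun setT f -> measurable_fun setT (fun x => sin (f x)).
Proof.
move=> mf; apply: (@measurableT_comp _ _ _ _ _ _ sin) => //.
by apply: continuous_measurable_fun; exact: continuous_sin.
Qed.

(** The transform is taken of [1 + cos] rather than of [cos]: the integrand is nonnegative, so
    Tonelli, pushforwards and densities apply to it at once. The phase added inside the cosine makes
    sines available as well. *)
Lemma measurable_onepcos f :
  measurable_fun setT f -> measurable_fun setT (fun x => (1 + cos (f x))%:E).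
Proof.
move=> mf; apply/measurable_EFinP; apply: measurable_funD => //.
exact: measurable_cos_comp.
Qed.

Lemma onepcos_ge0 (x : R) : (0 <= (1 + cos x)%:E :> \bar R)%E.
Proof. by rewrite lee_fin -lerBlDl sub0r cos_geN1. Qed.

Lemma onepsin_ge0 (x : R) : (0 <= (1 + sin x)%:E :> \bar R)%E.
Proof. by rewrite lee_fin -lerBlDl sub0r sin_geN1. Qed.

Lemma integrable_cos f : measurable_fun setT f ->
  m.-integrable setT (EFin \o (fun x => cos (f x))).
Proof.
move=> mf; apply: measurable_bounded_integrable => //.
  exact: measurable_cos_comp.
exists 1; split => // M M1 x _ /=; apply: le_trans (ltW M1).
by rewrite ler_norml cos_geN1 cos_le1.
Qed.

Lemma integrable_sin f : measurable_fun setT f ->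
  m.-integrable setT (EFin \o (fun x => sin (f x))).
Proof.
move=> mf; apply: measurable_bounded_integrable => //.
  exact: measurable_sin_comp.
exists 1; split => // M M1 x _ /=; apply: le_trans (ltW M1).
by rewrite ler_norml sin_geN1 sin_le1.
Qed.

Lemma integrable_bnd_cst (a : R) : m.-integrable setT (EFin \o (cst a : T -> R)).
Proof.
apply: measurable_bounded_integrable => //.
by exists `|a|; split => // M M1 x _ /=; exact: ltW.
Qed.

Lemma integral_affine_bnd (f : T -> R) (a b : R) :
  m.-integrable setT (EFin \o f) ->
  (\int[m]_x (a + b * f x)%:E = (a * fine (m setT) + b * \int[m]_x f x)%R%:E)%E.
Proof.
move=> fi; have bi : m.-integrable setT (EFin \o (fun x => b * f x)).
  exact: (integrableZl measurableT b fi).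
have ai := integrable_bnd_cst a.
rewrite EFin_Rintegral; last exact: (integrableD measurableT ai bi).
by rewrite RintegralD// RintegralZl// Rintegral_cst.
Qed.

Lemma integral_onepcos f : measurable_fun setT f ->
  (\int[m]_x (1 + cos (f x))%:E = (fine (m setT) + \int[m]_x cos (f x))%R%:E)%E.
Proof.
move=> mf; have := @integral_affine_bnd _ 1 1 (integrable_cos mf).
by under eq_integral do rewrite mul1r; rewrite !mul1r.
Qed.

Lemma integral_onepsin f : measurable_fun setT f ->
  (\int[m]_x (1 + sin (f x))%:E = (fine (m setT) + \int[m]_x sin (f x))%R%:E)%E.
Proof.
move=> mf; have := @integral_affine_bnd _ 1 1 (integrable_sin mf).
by under eq_integral do rewrite mul1r; rewrite !mul1r.
Qed.

Lemma Rintegral_cosD f c : measurable_fun setT f ->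
  (\int[m]_x cos (f x + c) =
   cos c * \int[m]_x cos (f x) - sin c * \int[m]_x sin (f x))%R.
Proof.
move=> mf; under eq_Rintegral do rewrite cosD mulrC [sin _ * _]mulrC.
have ci := integrable_cos mf; have si := integrable_sin mf.
rewrite RintegralB//.
- by rewrite !RintegralZl.
- exact: (integrableZl measurableT (cos c) ci).
- exact: (integrableZl measurableT (sin c) si).
Qed.

End finite.

Lemma prob_affine_bnd d (T : measurableType d) (P : probability T R) (f : T -> R) (a b : R) :
  P.-integrable setT (EFin \o f) ->
  (\int[P]_x (a + b * f x)%:E = (a + b * \int[P]_x f x)%R%:E)%E.
Proof.
move=> fi; have Poo : (P setT < +oo)%E by rewrite probability_setT ltry.
rewrite (integral_affine_bnd Poo _ _ fi); congr (_ + _)%:E.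
by rewrite -[RHS]mulr1; congr (_ * _); exact: (congr1 fine (@probability_setT _ _ _ P)).
Qed.

Lemma prob_onepcos d (T : measurableType d) (P : probability T R) (f : T -> R) :
  measurable_fun setT f ->
  (\int[P]_x (1 + cos (f x))%:E = (1 + \int[P]_x cos (f x))%R%:E)%E.
Proof.
move=> mf; have Poo : (P setT < +oo)%E by rewrite probability_setT ltry.
have := @prob_affine_bnd _ _ P _ 1 1 (integrable_cos Poo mf).
by under eq_integral do rewrite mul1r; rewrite mul1r.
Qed.

Lemma normal_opp s (f : R -> \bar R) : s != 0 ->
  measurable_fun [set: R] f -> (forall x, 0 <= f x)%E ->
  (\int[normal_prob 0 s]_x f (- x)%R = \int[normal_prob 0 s]_x f x)%E.
Proof.
move=> s0 mf f0.
have mfN : measurable_fun [set: R] (fun x => f (- x)) by exact: measurableT_comp.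
rewrite -(normal_scale s0 mfN (fun x => f0 (- x))) -[in RHS]normal_probN.
have Ns0 : - s != 0 by rewrite oppr_eq0.
rewrite -(normal_scale Ns0 mf f0).
by apply: eq_integral => x _; rewrite mulNr.
Qed.

(** Characteristic function at 1 of the centred normal law, read as 1 for the point mass at 0. What
    enters later is its evenness and the multiplicativity [normal_charM]. *)
Definition normal_char s : R :=
  if s == 0 then 1 else (\int[normal_prob 0 s]_x cos x)%R.

Lemma normal_charE s : s != 0 -> (\int[normal_prob 0 s]_x cos x)%R = normal_char s.
Proof. by rewrite /normal_char => /negbTE ->. Qed.

Lemma normal_char0 : normal_char 0 = 1.
Proof. by rewrite /normal_char eqxx. Qed.

Lemma normal_charN s : normal_char (- s) = normal_char s.
Proof.
have E : (\int[normal_prob 0 (- s)]_x (cos x)%:E =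
    \int[normal_prob 0 s]_x (cos x)%:E)%E.
  apply: eq_measure_integral => A mA _.
  exact: (congr1 (fun m => m A) (normal_probN s)).
by rewrite /normal_char oppr_eq0 /Rintegral E.
Qed.

Lemma normal_char_norm s : normal_char `|s| = normal_char s.
Proof. have [s0|s0] := leP 0 s; first by rewrite (ger0_norm s0).
by rewrite (ltr0_norm s0) normal_charN. Qed.

Lemma normal_sin s : s != 0 -> (\int[normal_prob 0 s]_x sin x = 0)%R.
Proof.
move=> s0; have ms : measurable_fun [set: R] (fun x : R => (1 + sin x)%:E).
  apply/measurable_EFinP; apply: measurable_funD => //.
  by apply: continuous_measurable_fun; exact: continuous_sin.
have := normal_opp s0 ms onepsin_ge0.
rewrite (integral_onepsin (finite_measure_lty (normal_prob 0 s)))// (integral_onepsin (finite_measure_lty (normal_prob 0 s)))//.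
under eq_Rintegral do rewrite sinN -mulN1r.
rewrite RintegralZl//; last exact: (integrable_sin (finite_measure_lty (normal_prob 0 s))).
by move=> [] /addrI; lra.
Qed.

Lemma normal_cos s c : s != 0 ->
  (\int[normal_prob 0 s]_x cos (x + c) = cos c * normal_char s)%R.
Proof.
move=> s0; rewrite (Rintegral_cosD (finite_measure_lty (normal_prob 0 s)))// normal_sin// mulr0 subr0.
by rewrite normal_charE.
Qed.

Local Opaque normal_char.

(** The convolution identity tested on [1 + cos]: the sine term of the addition formula vanishes by
    symmetry. *)
Lemma normal_charM s t :
  normal_char (Num.sqrt (s ^+ 2 + t ^+ 2)) = normal_char s * normal_char t.
Proof.
have [->|s0] := eqVneq s 0.
  by rewrite expr0n add0r sqrtr_sqr normal_char_norm normal_char0 mul1r.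
have [->|t0] := eqVneq t 0.
  by rewrite expr0n addr0 sqrtr_sqr normal_char_norm normal_char0 mulr1.
have mc : measurable_fun [set: R] (fun x : R => (1 + cos x)%:E).
  exact: (@measurable_onepcos _ _ id).
have := normal_convolution s0 t0 mc onepcos_ge0.
set u := Num.sqrt _; have u0 : u != 0.
  by rewrite gt_eqF// sqrtr_gt0 ltr_pwDl ?sqr_ge0// exprn_even_gt0.
rewrite prob_onepcos//.
rewrite (normal_charE u0).
have E x : (\int[normal_prob 0 t]_y (1 + cos (x + y))%:E =
    (1 + normal_char t * cos x)%:E)%E.
  under eq_integral => y _ do rewrite [x + y]addrC.
  rewrite prob_onepcos; last exact: measurable_funD.
  by rewrite normal_cos// mulrC.
under eq_integral do rewrite E.
rewrite prob_affine_bnd; last exact: (integrable_cos (finite_measure_lty (normal_prob 0 s))).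
rewrite (normal_charE s0) => H; have {H} /addrI <- := EFin_inj H.
exact: mulrC.
Qed.

End char.

Section probability_packing.
Context d (T : measurableType d) (R : realType).
Context (m : {measure set T -> \bar R}) (m1 : (m setT = 1)%E).

Definition probability_pack of (m setT = 1)%E : set T -> \bar R := m.
HB.instance Definition _ := Measure.copy (probability_pack m1) m.
HB.instance Definition _ :=
  @Measure_isProbability.Build _ _ _ (probability_pack m1) m1.

End probability_packing.

(** * The standard Gaussian measure on row vectors *)

Section gauss_rV.
Local Opaque normal_char.
Context (R : realType).
Implicit Types n : nat.

Lemma pushm_row_snoc_setT n (P : probability (borel 'rV[R]_n) R) (Q : probability (measurableTypeR R) R) :
  (pushm (P \x Q) (@measurable_row_snoc R n) setT = 1)%E.
Proof.
rewrite /pushm/= /pushforward preimage_setT -setXTT product_measure1E//.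
transitivity (1 * 1 : \bar R)%E; last by rewrite mul1e.
by congr (_ * _)%E; exact: probability_setT.
Qed.

Fixpoint gauss_rV n : probability (borel 'rV[R]_n) R :=
  if n isn't n'.+1 then dirac ((0 : 'rV[R]_0) : borel 'rV[R]_0)
  else probability_pack (pushm_row_snoc_setT (gauss_rV n') (normal_prob 0 1)).

Lemma ge0_integral_gauss0 (f : borel 'rV[R]_0 -> \bar R) :
  measurable_fun setT f -> (forall a, 0 <= f a)%E ->
  (\int[gauss_rV 0]_a f a = f (0%R : 'rV[R]_0))%E.
Proof. by move=> mf f0; rewrite /= integral_dirac// diracT mul1e. Qed.

Lemma ge0_integral_gaussS n (f : borel 'rV[R]_n.+1 -> \bar R) :
  measurable_fun setT f -> (forall a, 0 <= f a)%E ->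
  (\int[gauss_rV n.+1]_a f a =
   \int[gauss_rV n]_v \int[normal_prob 0 1]_x f (row_snoc (v, x)))%E.
Proof.
move=> mf f0.
transitivity (\int[pushm (gauss_rV n \x normal_prob 0 1)%E
   (@measurable_row_snoc R n)]_a f a)%E; first by [].
rewrite ge0_integral_pushforward//; last exact: measurable_row_snoc.
by rewrite preimage_setT (fubini_tonelli1 _ (measurable_fun_row_snoc mf) (fun p => f0 (row_snoc p))).
Qed.

Definition gauss_pdf n (z : 'rV[R]_n) : R := \prod_(i < n) normal_pdf 0 1 (z ord0 i).

Lemma gauss_pdf_ge0 n (z : 'rV[R]_n) : 0 <= gauss_pdf z.
Proof. by apply: prodr_ge0 => i _; exact: normal_pdf_ge0. Qed.

Lemma gauss_pdf_snoc n (v : 'rV[R]_n) x :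
  gauss_pdf (row_snoc (v, x)) = normal_pdf 0 1 x * gauss_pdf v.
Proof. exact: (@big_row_snoc R R 1 _ n (fun=> normal_pdf 0 1) (v, x)). Qed.

Lemma measurable_gauss_pdf n :
  measurable_fun [set: borel 'rV[R]_n] (@gauss_pdf n : borel 'rV[R]_n -> R).
Proof.
apply: measurable_prod => i _; apply: measurableT_comp; last exact: measurable_coord.
exact: measurable_normal_pdf.
Qed.

Lemma ge0_integral_gauss n (f : borel 'rV[R]_n -> \bar R) :
  measurable_fun setT f -> (forall a, 0 <= f a)%E ->
  (\int[gauss_rV n]_z f z = \int[leb_rV R n]_z (f z * (gauss_pdf z)%:E))%E.
Proof.
have mp k : measurable_fun [set: borel 'rV[R]_k] (fun z : borel 'rV[R]_k => (gauss_pdf z)%:E).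
  by apply/measurable_EFinP; exact: measurable_gauss_pdf.
elim: n => [|n IH] in f *.
  move=> mf f0; rewrite ge0_integral_gauss0// ge0_integral_rV0.
  - by rewrite /gauss_pdf big_ord0 mule1.
  - exact: emeasurable_funM mf (mp 0).
  - by move=> a; rewrite mule_ge0// lee_fin gauss_pdf_ge0.
move=> mf f0; rewrite (ge0_integral_gaussS mf f0).
have mfp := emeasurable_funM mf (mp n.+1).
have fp0 z : (0 <= f z * (gauss_pdf z)%:E)%E by rewrite mule_ge0// lee_fin gauss_pdf_ge0.
rewrite (ge0_integral_rVS mfp fp0).
rewrite IH; last 2 first.
- exact: (@measurable_fun_fubini_tonelli_F _ _ _ _ _ (normal_prob 0 1) _ (measurable_fun_row_snoc mf)).
- by move=> v; apply: integral_ge0 => x _; exact: f0.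
apply: eq_integral => v _.
have mfv := measurable_row_section v mf.
rewrite (integral_normal_prob 1 mfv (fun x => f0 (row_snoc (v, x)))).
rewrite -ge0_integralZr//.
- by apply: eq_integral => x _; rewrite gauss_pdf_snoc EFinM muleA.
- apply: (emeasurable_funM mfv); apply/measurable_EFinP; exact: measurable_normal_pdf.
- by move=> x _; rewrite mule_ge0// ?lee_fin ?normal_pdf_ge0//; exact: f0.
- by rewrite lee_fin gauss_pdf_ge0.
Qed.

Definition rdot n (z w : 'rV[R]_n) : R := \sum_(i < n) z ord0 i * w ord0 i.

Lemma gauss_pdfE n (z : 'rV[R]_n) :
  gauss_pdf z = normal_peak 1 ^+ n * expR (- (rdot z z / 2)).
Proof.
rewrite /gauss_pdf /rdot mulr_suml -sumrN expR_sum.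
rewrite -[X in _ ^+ X]card_ord -prodr_const -big_split/=; apply: eq_bigr => i _.
rewrite normal_pdfE ?oner_eq0// /normal_fun subr0 expr1n.
by congr (_ * expR _); rewrite expr2 mulNr.
Qed.

Lemma rdotDl n (x y z : 'rV[R]_n) : rdot (x + y) z = rdot x z + rdot y z.
Proof. by rewrite /rdot -big_split/=; apply: eq_bigr => i _; rewrite mxE mulrDl. Qed.

Lemma rdotC n (x y : 'rV[R]_n) : rdot x y = rdot y x.
Proof. by apply: eq_bigr => i _; rewrite mulrC. Qed.

Lemma rdotZl n a (x y : 'rV[R]_n) : rdot (a *: x) y = a * rdot x y.
Proof. by rewrite /rdot mulr_sumr; apply: eq_bigr => i _; rewrite mxE mulrA. Qed.

Lemma rdotDr n (x y z : 'rV[R]_n) : rdot z (x + y) = rdot z x + rdot z y.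
Proof. by rewrite rdotC rdotDl !(rdotC _ z). Qed.

Lemma rdotZr n a (x y : 'rV[R]_n) : rdot x (a *: y) = a * rdot x y.
Proof. by rewrite rdotC rdotZl rdotC. Qed.

Lemma rdotNl n (x y : 'rV[R]_n) : rdot (- x) y = - rdot x y.
Proof. by rewrite -scaleN1r rdotZl mulN1r. Qed.

Lemma rdotNr n (x y : 'rV[R]_n) : rdot x (- y) = - rdot x y.
Proof. by rewrite rdotC rdotNl rdotC. Qed.

Lemma rdot_ge0 n (x : 'rV[R]_n) : 0 <= rdot x x.
Proof. by apply: sumr_ge0 => i _; rewrite -expr2 sqr_ge0. Qed.

Lemma rdot0l n (x : 'rV[R]_n) : rdot 0 x = 0.
Proof. by rewrite -[0 in LHS](scale0r 0) rdotZl mul0r. Qed.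

Lemma measurable_rdot n (w : 'rV[R]_n) :
  measurable_fun [set: borel 'rV[R]_n] (fun z : borel 'rV[R]_n => rdot w z).
Proof.
apply: measurable_sum => i; apply: measurable_funM => //; exact: measurable_coord.
Qed.

(* Parallelogram identity: the cost [e^{|x-y|^2/4}] is exactly what the
   midpoint loses in the Gaussian density. *)
Lemma gauss_prekopa n (f g h : borel 'rV[R]_n -> \bar R) :
  measurable_fun setT f -> measurable_fun setT g -> measurable_fun setT h ->
  (forall x, (0 <= f x)%E) -> (forall x, (0 <= g x)%E) ->
  (forall x, (0 <= h x)%E) ->
  (forall x y, (f x * g y <= (expR (rdot (x - y) (x - y) / 4))%:E *
     (h (2^-1 *: (x + y))%R * h (2^-1 *: (x + y))%R))%E) ->
  (\int[gauss_rV n]_x f x * \int[gauss_rV n]_x g x <=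
   \int[gauss_rV n]_x h x * \int[gauss_rV n]_x h x)%E.
Proof.
move=> mf mg mh f0 g0 h0 fgh.
rewrite (ge0_integral_gauss mf f0) (ge0_integral_gauss mg g0) (ge0_integral_gauss mh h0).
have mp : measurable_fun [set: borel 'rV[R]_n] (fun z : borel 'rV[R]_n => (gauss_pdf z)%:E).
  by apply/measurable_EFinP; exact: measurable_gauss_pdf.
have p0 (z : 'rV[R]_n) : (0 <= (gauss_pdf z)%:E)%E by rewrite lee_fin gauss_pdf_ge0.
refine (prekopa_leindler_rV (emeasurable_funM mf mp) (emeasurable_funM mg mp)
  (emeasurable_funM mh mp) _ _ _ _).
- by move=> x; exact: mule_ge0.
- by move=> x; exact: mule_ge0.
- by move=> x; exact: mule_ge0.
move=> x y; rewrite muleACA [leRHS]muleACA.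
set m := 2^-1 *: (x + y).
have pE : gauss_pdf x * gauss_pdf y =
    expR (- (rdot (x - y) (x - y) / 4)) * (gauss_pdf m * gauss_pdf m).
  rewrite !gauss_pdfE; move: (normal_peak 1 ^+ n) => C.
  transitivity (C * C * (expR (- (rdot x x / 2)) * expR (- (rdot y y / 2)))).
    by ring.
  transitivity (C * C * (expR (- (rdot (x - y) (x - y) / 4)) *
    (expR (- (rdot m m / 2)) * expR (- (rdot m m / 2))))); last by ring.
  rewrite -!expRD; congr (_ * expR _); rewrite /m rdotZl rdotZr !rdotDl !rdotDr !rdotNl !rdotNr.
  by rewrite (rdotC y x); field.
rewrite -!EFinM pE.
apply: (@le_trans _ _ ((expR (rdot (x - y) (x - y) / 4))%:E * (h m * h m) *
  (expR (- (rdot (x - y) (x - y) / 4)) * (gauss_pdf m * gauss_pdf m))%:E)%E).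
  apply: lee_wpmul2r; last exact: fgh.
  by rewrite lee_fin mulr_ge0 ?expR_ge0// mulr_ge0 ?gauss_pdf_ge0.
rewrite (EFinM (expR _) (gauss_pdf m * gauss_pdf m)) muleACA -[X in (X * _)%E]EFinM.
by rewrite -expRD subrr expR0 mul1e.
Qed.

(** Finite-dimensional Cameron-Martin formula: translate the Lebesgue integral and read off the
    quotient of the densities at [z + b] and [z]. *)
Lemma gauss_shift n (b : 'rV[R]_n) (f : borel 'rV[R]_n -> \bar R) :
  measurable_fun setT f -> (forall a, 0 <= f a)%E ->
  (\int[gauss_rV n]_z f (z - b)%R =
   \int[gauss_rV n]_z (f z * (expR (- rdot b z - rdot b b / 2))%:E))%E.
Proof.
move=> mf f0.
have mp : measurable_fun [set: borel 'rV[R]_n] (fun z : borel 'rV[R]_n => (gauss_pdf z)%:E).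
  by apply/measurable_EFinP; exact: measurable_gauss_pdf.
have p0 (z : 'rV[R]_n) : (0 <= (gauss_pdf z)%:E)%E by rewrite lee_fin gauss_pdf_ge0.
have mfb : measurable_fun setT (fun z : borel 'rV[R]_n => f (z - b)).
  exact: (measurableT_comp mf (measurable_rVD (- b))).
have me : measurable_fun setT (fun z : borel 'rV[R]_n => (expR (- rdot b z - rdot b b / 2))%:E).
  apply/measurable_EFinP; apply: measurableT_comp => //; apply: measurable_funB => //.
  by apply: measurableT_comp => //; exact: measurable_rdot.
rewrite (ge0_integral_gauss mfb (fun z => f0 (z - b))).
rewrite (ge0_integral_gauss (emeasurable_funM mf me)); last first.
  by move=> z; rewrite mule_ge0// lee_fin expR_ge0.
rewrite -(leb_rV_shift b (emeasurable_funM mfb mp)); last first.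
  by move=> z; rewrite mule_ge0.
apply: eq_integral => z _; rewrite addrK -muleA; congr (_ * _)%E.
rewrite -EFinM; congr EFin; rewrite !gauss_pdfE mulrCA -expRD.
by congr (_ * expR _); rewrite !rdotDl !rdotDr (rdotC z b); field.
Qed.

Lemma gauss_opp n (f : borel 'rV[R]_n -> \bar R) :
  measurable_fun setT f -> (forall a, 0 <= f a)%E ->
  (\int[gauss_rV n]_z f (- z)%R = \int[gauss_rV n]_z f z)%E.
Proof.
move=> mf f0.
have mp : measurable_fun [set: borel 'rV[R]_n] (fun z : borel 'rV[R]_n => (gauss_pdf z)%:E).
  by apply/measurable_EFinP; exact: measurable_gauss_pdf.
have p0 (z : 'rV[R]_n) : (0 <= (gauss_pdf z)%:E)%E by rewrite lee_fin gauss_pdf_ge0.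
have mfb : measurable_fun setT (fun z : borel 'rV[R]_n => f (- z)).
  exact: (measurableT_comp mf (@measurable_rVN R n)).
rewrite (ge0_integral_gauss mfb (fun z => f0 (- z))) (ge0_integral_gauss mf f0).
rewrite -[RHS](leb_rV_opp (emeasurable_funM mf mp)); last first.
  by move=> z; rewrite mule_ge0.
apply: eq_integral => z _; congr (_ * _%:E)%E.
by rewrite !gauss_pdfE rdotNl rdotNr opprK.
Qed.

(** The free phase [c] drives the induction: when the last coordinate is integrated, the other
    coordinates are part of the phase. *)
Lemma gauss_onepcos n (t : 'rV[R]_n) (c : R) :
  (\int[gauss_rV n]_z (1 + cos (rdot t z + c))%:E =
   (1 + cos c * normal_char (Num.sqrt (rdot t t)))%:E)%E.
Proof.
have mr k (u : 'rV[R]_k) a : measurable_fun [set: borel 'rV[R]_k]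
    (fun z : borel 'rV[R]_k => rdot u z + a).
  by apply: measurable_funD => //; exact: measurable_rdot.
elim: n t c => [|n IH] t c.
  rewrite ge0_integral_gauss0.
  - by rewrite /rdot !big_ord0 sqrtr0 normal_char0 add0r mulr1.
  - exact: measurable_onepcos (mr _ _ _).
  - by move=> z; exact: onepcos_ge0.
rewrite (ge0_integral_gaussS (measurable_onepcos (mr _ t c)) (fun z => onepcos_ge0 _)).
pose u := (row_split t).1; pose s := (row_split t).2.
have tE : t = row_snoc (u, s) by rewrite -[LHS]row_splitK.
have dS v x : rdot t (row_snoc (v, x)) = s * x + rdot u v.
  rewrite tE /rdot; have := @big_row_snoc R R 0 _ n (fun i a => row_snoc (u, s) ord0 i * a) (v, x).
  move=> /= ->; rewrite row_snoc_max; congr (_ + _).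
  by apply: eq_bigr => i _; rewrite row_snoc_lift.
have sqE : rdot t t = s ^+ 2 + Num.sqrt (rdot u u) ^+ 2.
  by rewrite [in X in rdot _ X]tE dS sqr_sqrtr ?rdot_ge0// expr2.
have inner v : (\int[normal_prob 0 1]_x (1 + cos (rdot t (row_snoc (v, x)) + c))%:E =
    (1 + normal_char s * cos (rdot u v + c))%:E)%E.
  under eq_integral do rewrite dS -addrA.
  (* [normal_scale] needs a nonzero factor; for [s = 0] the last coordinate drops out. *)
  have [s0|s0] := eqVneq s 0.
    under eq_integral do rewrite s0 mul0r add0r.
    rewrite s0 normal_char0 mul1r integral_cst//.
    by have := @probability_setT _ _ _ (normal_prob (0:R) 1) => /= ->; rewrite mule1.
  have mcs : measurable_fun [set: R] (fun x : R => (1 + cos (x + (rdot u v + c)))%:E).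
    have m1 : measurable_fun [set: R] (fun x : R => x + (rdot u v + c)) by exact: measurable_funD.
    exact: (measurable_onepcos m1).
  rewrite (normal_scale s0 mcs (fun x => onepcos_ge0 _)).
  rewrite prob_onepcos; last exact: measurable_funD.
  by rewrite normal_cos// mulrC.
under eq_integral do rewrite inner.
have glt : (gauss_rV n setT < +oo)%E by rewrite probability_setT ltry.
rewrite prob_affine_bnd; last exact: (integrable_cos glt (mr _ u c)).
have := IH u c; rewrite prob_onepcos; last exact: mr.
move=> [] /addrI ->; rewrite sqE normal_charM.
by congr (_ + _)%:E; rewrite mulrCA mulrA mulrC mulrA.
Qed.

End gauss_rV.

(** * Uniqueness of finite measures from cosine transforms *)

Section poisson.
Context (R : realType).
Implicit Types s w t x z a b : R.

Lemma is_derive_scale w t : is_derive t 1 (fun u : R => w * u) w.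
Proof.
have := @is_deriveZ _ _ _ (fun u : R => u) w t 1 1 (is_derive_id t 1).
by rewrite /GRing.scale/= mulr1.
Qed.

Lemma is_derive_poisson s w t : s != 0 ->
  is_derive t 1 (fun u => expR (- s * u) *
     (- s^-1 + (s ^+ 2 + w ^+ 2)^-1 * (w * sin (w * u) - s * cos (w * u))))
   (expR (- s * t) * (1 + cos (t * w))).
Proof.
move=> s0; have sw : s ^+ 2 + w ^+ 2 != 0.
  by rewrite gt_eqF// ltr_pwDl ?sqr_ge0// exprn_even_gt0.
have dE : is_derive t 1 (fun u => expR (- s * u)) (expR (- s * t) * - s).
  exact: (is_derive1_comp (is_derive_expR _) (is_derive_scale (- s) t)).
have dS : is_derive t 1 (fun u => sin (w * u)) (cos (w * t) * w).
  exact: (is_derive1_comp (is_derive_sin _) (is_derive_scale w t)).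
have dC : is_derive t 1 (fun u => cos (w * u)) (- sin (w * t) * w).
  exact: (is_derive1_comp (is_derive_cos _) (is_derive_scale w t)).
have dSC : is_derive t 1 (fun u => w * sin (w * u) - s * cos (w * u))
    (w * (cos (w * t) * w) - s * (- sin (w * t) * w)).
  exact: (is_deriveB (is_deriveZ w dS) (is_deriveZ s dC)).
have dB : is_derive t 1 (fun u => - s^-1 + (s ^+ 2 + w ^+ 2)^-1 * (w * sin (w * u) - s * cos (w * u)))
    (0 + (s ^+ 2 + w ^+ 2)^-1 * (w * (cos (w * t) * w) - s * (- sin (w * t) * w))).
  exact: (is_deriveD (is_derive_cst (- s^-1) t 1) (is_deriveZ _ dSC)).
apply: (is_derive_eq (is_deriveM dE dB)).
by rewrite /GRing.scale/= (mulrC t w); field; rewrite s0 sw.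
Qed.

(** Laplace transform in [t] of [1 + cos (t * w)], by an explicit antiderivative; the summand [s^-1]
    is the contribution of the 1. It leads from cosine transforms to Poisson kernels. *)
Lemma poisson_kernel s w : 0 < s ->
  (\int[lebesgue_measure]_(t in `[0%R, +oo[) (expR (- s * t) * (1 + cos (t * w)))%:E =
   (s^-1 + s / (s ^+ 2 + w ^+ 2))%:E)%E.
Proof.
move=> s0; have s0' : s != 0 by rewrite gt_eqF.
have sw : 0 < s ^+ 2 + w ^+ 2 by rewrite ltr_pwDl ?sqr_ge0// exprn_gt0.
set F := (fun u => expR (- s * u) *
     (- s^-1 + (s ^+ 2 + w ^+ 2)^-1 * (w * sin (w * u) - s * cos (w * u)))).
have dF t : is_derive t 1 F (expR (- s * t) * (1 + cos (t * w))).
  exact: is_derive_poisson.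
have cF t : {for t, continuous F}.
  by apply: differentiable_continuous; apply/derivable1_diffP; have [] := dF t.
rewrite (@ge0_continuous_FTC2y _ _ F _ 0).
- rewrite /F !mulr0 expR0 mul1r sin0 cos0 mulr0 mulr1 sub0r.
  by rewrite -EFinB; congr EFin; field; rewrite s0' gt_eqF.
- by move=> x _; rewrite mulr_ge0 ?expR_ge0// -lerBlDl sub0r cos_geN1.
- apply: continuous_subspaceT => t.
  have cE : {for t, continuous (fun u => expR (- s * u))}.
    have dE : is_derive t 1 (fun u => expR (- s * u)) (expR (- s * t) * - s).
      exact: (is_derive1_comp (is_derive_expR _) (is_derive_scale (- s) t)).
    by apply: differentiable_continuous; apply/derivable1_diffP; have [] := dE.
  have cC : {for t, continuous (fun u => cos (w * u))}.
    have dC : is_derive t 1 (fun u => cos (w * u)) (- sin (w * t) * w).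
      exact: (is_derive1_comp (is_derive_cos _) (is_derive_scale w t)).
    by apply: differentiable_continuous; apply/derivable1_diffP; have [] := dC.
  rewrite (_ : (fun u => _) = (fun u => expR (- s * u) * (1 + cos (w * u)))); last first.
    by apply/funext => u; rewrite (mulrC u).
  apply: cvgM; first exact: cE.
  by apply: cvgD; [exact: cvg_cst|exact: cC].
(* [K] bounds the oscillating factor of [F], so the exponential forces [F] to 0 at infinity. *)
- pose K := `|s^-1| + (s ^+ 2 + w ^+ 2)^-1 * (`|w| + s).
  have eK : (fun u => expR (- s * u) * K) u @[u --> +oo] --> (0 : R).
    rewrite -[X in _ --> X](mul0r K); apply: cvgM; last exact: cvg_cst.
    rewrite (_ : (fun x => expR (- s * x)) =
               (fun z => expR (- z)) \o (fun z => s * z)); last first.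
      by apply/funext => x /=; rewrite mulNr.
    apply: (@cvg_comp _ _ _ _ _ _ (pinfty_nbhs R)); last exact: cvgr_expR.
    exact: gt0_cvgMry.
  have K0 u : `|F u| <= expR (- s * u) * K.
    rewrite /F normrM (ger0_norm (expR_ge0 _)) ler_wpM2l ?expR_ge0//.
    rewrite (le_trans (ler_normD _ _))// normrN lerD2l normrM ger0_norm ?invr_ge0 ?(ltW sw)//.
    rewrite ler_wpM2l ?invr_ge0 ?(ltW sw)// (le_trans (ler_normB _ _))//.
    rewrite !normrM (gtr0_norm s0); apply: lerD.
      by rewrite ler_piMr// ler_norml sin_geN1 sin_le1.
    by rewrite ler_piMr ?(ltW s0)// ler_norml cos_geN1 cos_le1.
  apply: (@squeeze_cvgr _ _ _ _ (fun u => - (expR (- s * u) * K)) (fun u => expR (- s * u) * K)) => //.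
    by near=> u; rewrite -ler_norml.
  by rewrite -oppr0; exact: cvgN.
- by move=> x _; have [] := dF x.
- exact/cvg_at_right_filter/cF.
- by move=> x _; rewrite derive1E; have [_ ->] := dF x.
Unshelve. all: by end_near. Qed.

(** The kernel integrates over an interval to a difference of arctangents, which for small [s]
    approximates [pi] times the indicator of the interval. *)
Lemma poisson_kernel_itv (a b : R) s x : 0 < s -> a < b ->
  (\int[lebesgue_measure]_(z in `[a, b]) (s^-1 + s / (s ^+ 2 + (x - z) ^+ 2))%:E =
   (s^-1 * (b - a) + (atan ((b - x) / s) - atan ((a - x) / s)))%:E)%E.
Proof.
move=> s0 ab; have s0' : s != 0 by rewrite gt_eqF.
have sw z : 0 < s ^+ 2 + (x - z) ^+ 2 by rewrite ltr_pwDl ?sqr_ge0// exprn_gt0.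
pose F (z : R) := s^-1 * z + atan (s^-1 * z - s^-1 * x).
have dF z : is_derive z 1 F (s^-1 + s / (s ^+ 2 + (x - z) ^+ 2)).
  have d1 : is_derive z 1 (fun z => s^-1 * z - s^-1 * x) (s^-1 - 0).
    exact: (is_deriveB (is_derive_scale s^-1 z) (is_derive_cst (s^-1 * x) z 1)).
  have d2 := is_derive1_comp (is_derive1_atan _) d1.
  apply: (is_derive_eq (is_deriveD (is_derive_scale s^-1 z) d2)).
  rewrite subr0; congr (_ + _).
  have -> : (s^-1 * z - s^-1 * x) ^+ 2 = (x - z) ^+ 2 / s ^+ 2.
    by rewrite -mulrBr exprMn exprVn mulrC -sqrrN opprB.
  have h := sw z; move: ((x - z) ^+ 2) h => q h.
  by field; rewrite s0' !gt_eqF//.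
have cF z : {for z, continuous F}.
  by apply: differentiable_continuous; apply/derivable1_diffP; have [] := dF z.
rewrite (@continuous_FTC2 _ _ F)//.
- rewrite /F -EFinB; congr EFin; rewrite -!mulrBr.
  by rewrite ![_ / s]mulrC; ring.
- apply: continuous_subspaceT => z.
  apply: cvgD; first exact: cvg_cst.
  apply: cvgM; first exact: cvg_cst.
  apply: cvgV; first by rewrite gt_eqF.
  apply: cvgD; first exact: cvg_cst.
  apply: (@cvg_comp _ _ _ (fun z => x - z) (fun y => y ^+ 2)); last exact: exprn_continuous.
  by apply: cvgB; [exact: cvg_cst|exact: cvg_id].
- split.
  + by move=> z _; have [] := dF z.
  + exact/cvg_at_right_filter/cF.
  + exact/cvg_at_left_filter/cF.
- by move=> z _; rewrite derive1E; have [_ ->] := dF z.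
Qed.

End poisson.

(** * Uniqueness of finite measures on the line *)

Section uniqueness1.
Context (R : realType).

(* The common scaling makes the limit the indicator of the half-open
   interval, without mass one half at the endpoints. *)
Definition atan_step (n : nat) (y : R) : R := atan (y * n.+1%:R ^+ 2 + n.+1%:R).

Lemma cvg_atan_step y :
  atan_step n y @[n --> \oo] --> (if 0 <= y then pi / 2 else - (pi / 2)).
Proof.
have Noo : (n.+1%:R : R) @[n --> \oo] --> +oo.
  by apply/cvgryPge => A; near=> n; rewrite (@le_trans _ _ n%:R)// ?ler_nat//;
    near: n; exact: nbhs_infty_ger.
have [y0|y0] := leP 0 y.
  apply: (@cvg_comp _ _ _ _ _ _ (pinfty_nbhs R)); last exact: cvgy_atan.
  apply: (ger_cvgy _ Noo); near=> n.
  by rewrite lerDr mulr_ge0// sqr_ge0.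
rewrite (_ : atan_step ^~ y = (fun n => - atan (- (y * n.+1%:R ^+ 2 + n.+1%:R)))); last first.
  by apply/funext => n; rewrite atanN opprK.
apply: cvgN; apply: (@cvg_comp _ _ _ _ _ _ (pinfty_nbhs R)); last exact: cvgy_atan.
apply: (ger_cvgy _ Noo); near=> n.
(* With [N = n.+1], from [y * N <= -2] follows [y * N ^+ 2 + N <= - N]. *)
have h : 2 <= - y * n.+1%:R.
  rewrite mulrC -ler_pdivrMr ?oppr_gt0//; near: n; exact: (cvgryPge _).1 Noo _.
have : 0 < n.+1%:R :> R by [].
by move: (n.+1%:R) h => N h N0; nra.
Unshelve. all: by end_near. Qed.

Lemma atan_step_bound n y : `|atan_step n y| <= pi / 2.
Proof. by rewrite ler_norml !ltW// ?atan_gtNpi2// atan_ltpi2. Qed.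

Section two_measures.
Context (P Q : {finite_measure set (measurableTypeR R) -> \bar R}).
Hypothesis PQ : forall r c : R,
  (\int[P]_x cos (r * x + c) = \int[Q]_x cos (r * x + c))%R.

Lemma cos_setT : P setT = Q setT.
Proof.
have := PQ 0 0; under eq_Rintegral do rewrite mul0r addr0 cos0.
under [in RHS]eq_Rintegral do rewrite mul0r addr0 cos0.
rewrite !Rintegral_cst// !mul1r => h.
by rewrite -[LHS]fineK ?fin_num_measure// -[RHS]fineK ?fin_num_measure// h.
Qed.

(** Tonelli exchanges the integral over [x] with the Laplace integral over [t]; for each [t] the
    inner integral is one of the given transforms. *)
Lemma cos_poisson s z : 0 < s ->
  (\int[P]_x (s^-1 + s / (s ^+ 2 + (x - z) ^+ 2))%:E =
   \int[Q]_x (s^-1 + s / (s ^+ 2 + (x - z) ^+ 2))%:E)%E.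
Proof.
move=> s0.
pose f (p : measurableTypeR R * measurableTypeR R) : \bar R :=
  ((expR (- s * p.2))%:E * (1 + cos (p.2 * (p.1 - z)))%:E * (\1_`[0%R, +oo[ p.2)%:E)%E.
have f0 p : (0 <= f p)%E.
  by rewrite !mule_ge0// ?onepcos_ge0// lee_fin ?expR_ge0.
have m1 : measurable_fun setT
    (fun p : measurableTypeR R * measurableTypeR R => p.2 * (p.1 - z)).
  by apply: measurable_funM => //; exact: measurable_funB.
have mf : measurable_fun setT f.
  apply: emeasurable_funM; first apply: emeasurable_funM.
  - by apply/measurable_EFinP; apply: measurableT_comp => //; exact: measurable_funM.
  - exact: (measurable_onepcos m1).
  - apply/measurable_EFinP.
    exact: (measurableT_comp (measurable_indic (measurable_itv _)) measurable_snd).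
have E (m : {finite_measure set (measurableTypeR R) -> \bar R}) :
    (\int[m]_x (s^-1 + s / (s ^+ 2 + (x - z) ^+ 2))%:E =
     \int[lebesgue_measure]_t ((expR (- s * t))%:E * (\1_`[0%R, +oo[ t)%:E *
       (fine (m setT) + \int[m]_x cos (t * x + - (t * z)))%R%:E))%E.
  transitivity (\int[m]_x \int[lebesgue_measure]_t f (x, t))%E.
    apply: eq_integral => x _; rewrite -poisson_kernel// integral_mkcond.
    apply: eq_integral => t _; rewrite /f/= patchE indicE.
    by case: (t \in _); rewrite ?mule1 ?mule0.
  rewrite (fubini_tonelli f mf f0); apply: eq_integral => t _.
  have mt : measurable_fun [set: R] (fun x : R => t * x - t * z).
    by apply: measurable_funB => //; exact: measurable_funM.
  rewrite -(integral_onepcos (finite_measure_lty m) mt) -[RHS]ge0_integralZl//.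
  - by apply: eq_integral => x _; rewrite /f/= muleAC mulrBr.
  - exact: (measurable_onepcos mt).
rewrite !E; apply: eq_integral => t _.
by rewrite PQ cos_setT.
Qed.

Lemma cos_atan_itv s a b : 0 < s -> a < b ->
  (\int[P]_x (atan ((b - x) / s) - atan ((a - x) / s)) =
   \int[Q]_x (atan ((b - x) / s) - atan ((a - x) / s)))%R.
Proof.
move=> s0 ab; have s0' : s != 0 by rewrite gt_eqF.
pose g (x : R) := atan ((b - x) / s) - atan ((a - x) / s).
have mg : measurable_fun [set: R] g.
  have mh c : measurable_fun [set: R] (fun x => atan ((c - x) / s)).
    apply: (@measurableT_comp _ _ _ _ _ _ (@atan R)).
      by apply: continuous_measurable_fun => x; exact: continuous_atan.
    by apply: measurable_funM => //; exact: measurable_funB.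
  exact: measurable_funB.
have gi (m : {finite_measure set (measurableTypeR R) -> \bar R}) :
    m.-integrable setT (EFin \o g).
  apply: measurable_bounded_integrable => //; first exact: finite_measure_lty.
  exists pi; split; first exact: num_real.
  move=> M M1 x _ /=; apply: le_trans (ltW M1).
  rewrite (le_trans (ler_normB _ _))// [leRHS]splitr.
  by apply: lerD; rewrite ler_norml !ltW// ?atan_gtNpi2// atan_ltpi2.
pose f (p : measurableTypeR R * measurableTypeR R) : \bar R :=
  ((s^-1 + s / (s ^+ 2 + (p.1 - p.2) ^+ 2))%:E * (\1_`[a, b] p.2)%:E)%E.
have k0 (x z : R) : 0 <= s^-1 + s / (s ^+ 2 + (x - z) ^+ 2).
  by rewrite addr_ge0 ?invr_ge0 ?ltW// divr_gt0// ltr_pwDl ?sqr_ge0// exprn_gt0.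
have f0 p : (0 <= f p)%E by rewrite mule_ge0// lee_fin.
have mk : measurable_fun [set: R] (fun w => s^-1 + s / (s ^+ 2 + w ^+ 2)).
  apply: continuous_measurable_fun => w; apply: cvgD; first exact: cvg_cst.
  apply: cvgM; first exact: cvg_cst.
  apply: cvgV; first by rewrite gt_eqF// ltr_pwDl ?sqr_ge0// exprn_gt0.
  by apply: cvgD; [exact: cvg_cst|exact: exprn_continuous].
have mf : measurable_fun setT f.
  apply: emeasurable_funM.
    apply/measurable_EFinP.
    have mxz : measurable_fun setT
        (fun p : measurableTypeR R * measurableTypeR R => p.1 - p.2).
      exact: measurable_funB.
    exact: (measurableT_comp mk mxz).
  apply/measurable_EFinP.
  exact: (measurableT_comp (measurable_indic (measurable_itv _)) measurable_snd).
have E (m : {finite_measure set (measurableTypeR R) -> \bar R}) :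
    ((s^-1 * (b - a) * fine (m setT) + 1 * \int[m]_x g x)%R%:E =
     \int[lebesgue_measure]_z ((\1_`[a, b] z)%:E *
       \int[m]_x (s^-1 + s / (s ^+ 2 + (x - z) ^+ 2))%:E))%E.
  rewrite -(integral_affine_bnd (finite_measure_lty m) _ _ (gi m)).
  transitivity (\int[m]_x \int[lebesgue_measure]_z f (x, z))%E.
    apply: eq_integral => x _; rewrite mul1r -poisson_kernel_itv// integral_mkcond.
    apply: eq_integral => z _; rewrite /f/= patchE indicE.
    by case: (z \in _); rewrite ?mule1 ?mule0.
  rewrite (fubini_tonelli f mf f0); apply: eq_integral => z _.
  rewrite -ge0_integralZl//.
  - by apply: eq_integral => x _; rewrite muleC.
  - have mxz : measurable_fun [set: R] (fun x : R => x - z) by exact: measurable_funB.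
    apply/measurable_EFinP; exact: (measurableT_comp mk mxz).
  - by move=> x _; rewrite lee_fin.
have := E P; have := E Q; rewrite -cos_setT => EQ EP.
have : (s^-1 * (b - a) * fine (P setT) + 1 * \int[P]_x g x)%R%:E =
       (s^-1 * (b - a) * fine (P setT) + 1 * \int[Q]_x g x)%R%:E.
  by rewrite EP EQ; apply: eq_integral => z _; rewrite cos_poisson.
by case=> h; apply: (@addrI _ (s^-1 * (b - a) * fine (P setT))); rewrite !mul1r in h.
Qed.

(** Integrals of arctangent steps agree by [cos_atan_itv]. They converge boundedly to [pi] times the
    indicator of []a, b]], and half-open intervals determine a finite measure. *)
Lemma cos_unique1 A : measurable A -> P A = Q A.
Proof.
have Pk (i : nat) : (P (`](- i%:R)%R, i%:R%R]%classic : set R) < +oo)%E.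
  by rewrite ltey_eq fin_num_measure.
apply: (@measure_unique _ R (measurableTypeR R) (@ocitv R)
  (fun k => `](- k%:R), k%:R]%classic)) => //.
- exact: ocitvI.
- by move=> k; exists (- k%:R, k%:R).
- apply/seteqP; split => // x _.
  have [k _ /(_ k (leqnn k)) /= xk] := nbhs_infty_gtr `|x|.
  exists k => //=; rewrite in_itv/=; move: xk; rewrite ltr_norml => /andP[-> /ltW ->].
  by [].
move=> _ [[a b] _ <-]/=.
have [ab|ba] := ltP a b; last by rewrite set_itv_ge ?measure0// bnd_simp -leNgt.
pose g n (x : R) := atan_step n (b - x) - atan_step n (a - x).
have gE n : (\int[P]_x g n x = \int[Q]_x g n x)%R.
  have n0 : 0 < n.+1%:R :> R by [].
  (* Scale [N ^- 2] and endpoints moved by [N^-1], with [N = n.+1], produce the argument of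
     [atan_step]. *)
  have := @cos_atan_itv (n.+1%:R ^- 2) (a + n.+1%:R^-1) (b + n.+1%:R^-1).
  rewrite invr_gt0 exprn_gt0// ltrD2r => /(_ isT ab).
  have h c x : (c + n.+1%:R^-1 - x) / n.+1%:R ^- 2 = (c - x) * n.+1%:R ^+ 2 + n.+1%:R :> R.
    by field; rewrite gt_eqF.
  under eq_Rintegral do rewrite !h.
  by under [in RHS]eq_Rintegral do rewrite !h.
have mg n : measurable_fun [set: R] (g n).
  have mh c : measurable_fun [set: R] (fun x => atan_step n (c - x)).
    apply: (@measurableT_comp _ _ _ _ _ _ (@atan R)).
      by apply: continuous_measurable_fun => x; exact: continuous_atan.
    apply: measurable_funD => //; apply: measurable_funM => //.
    exact: measurable_funB.
  exact: measurable_funB.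
have gpi n x : `|g n x| <= pi.
  rewrite (le_trans (ler_normB _ _))// [leRHS]splitr.
  by apply: lerD; exact: atan_step_bound.
have gi n (m : {finite_measure set (measurableTypeR R) -> \bar R}) :
    m.-integrable setT (EFin \o g n).
  apply: measurable_bounded_integrable => //; [exact: finite_measure_lty|exact: mg|].
  exists pi; split; first exact: num_real.
  by move=> M M1 x _ /=; apply: le_trans (gpi _ _) (ltW M1).
pose I x : R := pi * \1_(`]a, b]%classic : set R) x.
have gcvg x : g n x @[n --> \oo] --> I x.
  have -> : I x = (if 0 <= b - x then pi / 2 else - (pi / 2)) -
      (if 0 <= a - x then pi / 2 else - (pi / 2)).
    rewrite /I indicE mem_setE in_itv/= !subr_ge0.
    case: (leP x b) => [xb|bx]; case: (leP x a) => [xa|ax]; rewrite ?andbF/= ?mulr0 ?mulr1 ?subrr//.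
    - by rewrite opprK -splitr.
    - by move: (lt_le_trans (lt_trans ab bx) xa); rewrite ltxx.
  by apply: cvgB; exact: cvg_atan_step.
have lim (m : {finite_measure set (measurableTypeR R) -> \bar R}) :
    ((\int[m]_x g n x)%R%:E @[n --> \oo] --> (pi%:E * m `]a, b]%classic))%E.
  have -> : (pi%:E * m `]a, b]%classic)%E = (\int[m]_x (I x)%:E)%E.
    rewrite /I; under eq_integral do rewrite EFinM.
    rewrite ge0_integralZl//; last 2 first.
    - by apply/measurable_EFinP; exact: measurable_indic.
    - by rewrite lee_fin pi_ge0.
    by rewrite integral_indic// setIT.
  rewrite (_ : (fun n => _) = (fun n => \int[m]_x (g n x)%:E)%E); last first.
    by apply/funext => n; rewrite (EFin_Rintegral (gi n m)).
  apply: (@dominated_cvg _ _ _ m setT measurableT (fun n x => (g n x)%:E)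
    (fun x => (I x)%:E) (cst pi%:E)).
  - by move=> n; apply/measurable_EFinP; exact: mg.
  - by move=> x _; apply: cvg_EFin; [near=> n|exact: gcvg].
  - by [].
  - exact: (integrable_bnd_cst (finite_measure_lty m)).
  - by move=> n x _ /=; rewrite lee_fin gpi.
have limP := lim P; have limQ := lim Q.
rewrite (_ : (fun n => (\int[P]_x g n x)%R%:E) = (fun n => (\int[Q]_x g n x)%R%:E)) in limP; last first.
  by apply/funext => n; rewrite gE.
have e : (pi%:E * P `]a, b]%classic = pi%:E * Q `]a, b]%classic)%E.
  exact: cvg_unique limP limQ.
have mab : measurable (`]a, b]%classic : set R) by exact: measurable_itv.
rewrite -[P _]fineK ?fin_num_measure// -[Q _]fineK ?fin_num_measure// in e *.
by case: e => /mulfI ->//; rewrite gt_eqF// pi_gt0.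
Unshelve. all: by end_near. Qed.

End two_measures.
End uniqueness1.

(** * Finite measures with bounded weights *)

Section weighted_measure.
Local Open Scope ereal_scope.
Context d (T : measurableType d) (R : realType).
Context (m : {finite_measure set T -> \bar R}) (w : T -> R) (k : R).
Hypothesis (mw : measurable_fun setT w) (w0 : forall x, (0 <= w x)%R)
  (wk : forall x, (w x <= k)%R).

(* The vacuous [let] makes the hypotheses arguments of [wmeasure], which the
   measure instance needs. *)
Definition wmeasure (A : set T) : \bar R :=
  let _ := (mw, w0, wk) in \int[m]_(x in A) (w x)%:E.

Let wmeasure0 : wmeasure set0 = 0.
Proof. by rewrite /wmeasure integral_set0. Qed.

Let wmeasure_ge0 A : 0 <= wmeasure A.
Proof. by rewrite /wmeasure; apply: integral_ge0 => x _; rewrite lee_fin. Qed.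

Let wmeasure_sigma_additive : semi_sigma_additive wmeasure.
Proof.
apply: semi_sigma_additive_nng_induced; first exact/measurable_EFinP.
by move=> x; rewrite lee_fin.
Qed.

HB.instance Definition _ := isMeasure.Build _ _ _ wmeasure
  wmeasure0 wmeasure_ge0 wmeasure_sigma_additive.

Lemma ge0_integral_wmeasure (f : T -> \bar R) :
  measurable_fun setT f -> (forall x, 0 <= f x) ->
  \int[wmeasure]_x f x = \int[m]_x (f x * (w x)%:E).
Proof. by move=> mf f0; apply: ge0_integral_density. Qed.

Lemma wmeasure_lty : wmeasure setT < +oo.
Proof.
apply: (@le_lt_trans _ _ (\int[m]_x k%:E)).
  apply: ge0_le_integral => //=.
  - by move=> x _; rewrite lee_fin.
  - exact/measurable_EFinP.
  - by move=> x _; rewrite lee_fin.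
rewrite integral_cst//; apply: lte_mul_pinfty => //; last by rewrite ltey_eq fin_num_measure.
by rewrite lee_fin (le_trans (w0 point) (wk _)).
Qed.

End weighted_measure.

Section finite_packing.
Context d (T : measurableType d) (R : realType) (m : {measure set T -> \bar R}).
Hypothesis mS : (m setT < +oo)%E.

Definition finite_pack of (m setT < +oo)%E : set T -> \bar R := m.
HB.instance Definition _ := Measure.copy (finite_pack mS) m.
Let finite_pack_fin : fin_num_fun (finite_pack mS).
Proof. exact: lty_fin_num_fun. Qed.
HB.instance Definition _ :=
  @Measure_isFinite.Build _ _ _ (finite_pack mS) finite_pack_fin.

End finite_packing.

(** * Uniqueness of finite measures on row vectors *)

Section uniqueness.
Context (R : realType) (n : nat).
Local Notation fmeasure := {finite_measure set (borel 'rV[R]_n) -> \bar R}.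

Let measurable_rdotD t c :
  measurable_fun [set: borel 'rV[R]_n] (fun z : borel 'rV[R]_n => rdot t z + c).
Proof. by apply: measurable_funD => //; exact: measurable_rdot. Qed.

Section weight.
Context (w : borel 'rV[R]_n -> R) (k : R).
Hypothesis (mw : measurable_fun setT w) (w0 : forall x, (0 <= w x)%R)
  (wk : forall x, (w x <= k)%R).

Let wcos (m : fmeasure) t c := (\int[m]_z (w z * cos (rdot t z + c)))%R.

Let integrable_wcos (m : fmeasure) t c :
  m.-integrable setT (EFin \o (fun z => w z * cos (rdot t z + c))).
Proof.
apply: measurable_bounded_integrable => //; first exact: finite_measure_lty.
  by apply: measurable_funM => //; exact: (measurable_cos_comp (measurable_rdotD t c)).
exists k; split; first exact: num_real.
move=> M kM x _ /=; apply: le_trans (ltW kM); apply: le_trans (wk x).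
by rewrite normrM (ger0_norm (w0 x)) ler_piMr// ler_norml cos_geN1 cos_le1.
Qed.

Let integral_wonepcos (m : fmeasure) t c :
  (\int[m]_z (w z * (1 + cos (rdot t z + c)))%:E = (wcos m 0 0 + wcos m t c)%:E)%E.
Proof.
have i0 := integrable_wcos m 0 0.
have i1 := integrable_wcos m t c.
rewrite /wcos -(RintegralD measurableT i0 i1).
rewrite -(EFin_Rintegral (integrableD measurableT i0 i1)).
by apply: eq_integral => z _; rewrite rdot0l addr0 cos0 mulrDr.
Qed.

(** Product-to-sum formula. Using one factor as a weight and the other as a test function thus stays
    within the family [wcos], where [P] and [Q] agree. *)
Let integral_wonepcosM (m : fmeasure) t c t' c' :
  (\int[m]_z (w z * (1 + cos (rdot t z + c)) * (1 + cos (rdot t' z + c')))%:E =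
   (wcos m 0 0 + wcos m t c + wcos m t' c' + 2^-1 * wcos m (t + t') (c + c') +
    2^-1 * wcos m (t - t') (c - c'))%:E)%E.
Proof.
have i0 := integrable_wcos m 0 0.
have i1 := integrable_wcos m t c.
have i2 := integrable_wcos m t' c'.
have i3' := integrable_wcos m (t + t') (c + c').
have i4' := integrable_wcos m (t - t') (c - c').
have i3 := integrableZl measurableT 2^-1 i3'.
have i4 := integrableZl measurableT 2^-1 i4'.
have i01 := integrableD measurableT i0 i1.
have i012 := integrableD measurableT i01 i2.
have i0123 := integrableD measurableT i012 i3.
have i01234 := integrableD measurableT i0123 i4.
rewrite /wcos -(RintegralZl 2^-1 measurableT i3') -(RintegralZl 2^-1 measurableT i4').
rewrite -(RintegralD measurableT i0 i1) -(RintegralD measurableT i01 i2).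
rewrite -(RintegralD measurableT i012 i3) -(RintegralD measurableT i0123 i4).
rewrite -(EFin_Rintegral i01234).
apply: eq_integral => z _ /=; congr EFin; rewrite rdot0l addr0 cos0.
rewrite rdotDl rdotDl rdotNl.
have -> : rdot t z + rdot t' z + (c + c') = (rdot t z + c) + (rdot t' z + c') by ring.
have -> : rdot t z - rdot t' z + (c - c') = (rdot t z + c) - (rdot t' z + c') by ring.
move: (rdot t z + c) (rdot t' z + c') => x y; rewrite cosD cosB.
by field.
Qed.

Context (P Q : fmeasure).
Hypothesis PQ : forall t c,
  (\int[P]_z (w z * (1 + cos (rdot t z + c)))%:E =
   \int[Q]_z (w z * (1 + cos (rdot t z + c)))%:E)%E.

Let wcosE t c : wcos P t c = wcos Q t c.
Proof.
have w00 (m : fmeasure) : wcos m 0 (pi / 2) = 0.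
  rewrite /wcos; under eq_Rintegral do rewrite rdot0l add0r cos_pihalf mulr0.
  by rewrite Rintegral_cst// mul0r.
(* The cosine vanishes at phase [pi / 2], so the total weights agree and cancel in the general
   identity. *)
have := PQ 0 (pi / 2); rewrite !integral_wonepcos !w00 !addr0 => -[h0].
have := PQ t c; rewrite !integral_wonepcos h0 => -[].
exact: addrI.
Qed.

(** The hypothesis on the weight [w] is inherited by [w] times the indicator of [A] in coordinate
    [j]. To see it, push the measure with weight [w * (1 + cos ...)] to that coordinate and apply
    uniqueness on the line. *)
Lemma cos_restrict (j : 'I_n) (A : set R) : measurable A -> forall t c,
  (\int[P]_z (w z * \1_A (z ord0 j) * (1 + cos (rdot t z + c)))%:E =
   \int[Q]_z (w z * \1_A (z ord0 j) * (1 + cos (rdot t z + c)))%:E)%E.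
Proof.
move=> mA t c; pose w' (z : borel 'rV[R]_n) := w z * (1 + cos (rdot t z + c)).
have mw' : measurable_fun setT w'.
  apply: measurable_funM => //; apply: measurable_funD => //.
  exact: (measurable_cos_comp (measurable_rdotD t c)).
have w'0 z : 0 <= w' z.
  by rewrite mulr_ge0// -lerBlDl sub0r cos_geN1.
have w'k z : w' z <= k * 2.
  by rewrite ler_pM// -?lerBlDl ?sub0r ?cos_geN1// -[2]/(1 + 1) lerD2l cos_le1.
have mj := @measurable_coord R n j.
pose pw (m : fmeasure) := pushm (wmeasure m mw' w'0 w'k)
  (mj : measurable_fun setT (_ : borel 'rV[R]_n -> measurableTypeR R)).
have pwE (m : fmeasure) (f : R -> R) : measurable_fun [set: R] f -> (forall x, 0 <= f x) ->
    (\int[pw m]_x (f x)%:E = \int[m]_z (w' z * f (z ord0 j))%:E)%E.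
  move=> mf f0; have mfj := measurableT_comp mf mj.
  rewrite ge0_integral_pushforward//; last first.
  - by move=> x _; rewrite lee_fin.
  - exact/measurable_EFinP.
  rewrite preimage_setT ge0_integral_wmeasure//.
  - by apply: eq_integral => z _; rewrite /= -EFinM mulrC.
  - exact/measurable_EFinP.
  - by move=> z; rewrite lee_fin.
have pwoo m : (pw m setT < +oo)%E by exact: wmeasure_lty.
pose fw m : {finite_measure set (measurableTypeR R) -> \bar R} := finite_pack (pwoo m).
have key : forall A : set (measurableTypeR R), measurable A -> fw P A = fw Q A.
  apply: cos_unique1 => r c'.
  have E (m : fmeasure) : (\int[fw m]_x (1 + cos (r * x + c'))%:E =
      \int[m]_z (w z * (1 + cos (rdot t z + c)) *
        (1 + cos (rdot (r *: delta_mx ord0 j) z + c')))%:E)%E.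
    have mr : measurable_fun [set: R] (fun x : R => 1 + cos (r * x + c')).
      apply: measurable_funD => //; apply: measurable_cos_comp.
      by apply: measurable_funD => //; exact: measurable_funM.
    transitivity (\int[pw m]_x (1 + cos (r * x + c'))%:E)%E; first by [].
    have r0 (x : R) : 0 <= 1 + cos (r * x + c') by rewrite -lerBlDl sub0r cos_geN1.
    rewrite (pwE m _ mr r0).
    apply: eq_integral => z _; congr (_ * (1 + cos (_ + _)))%:E.
    rewrite rdotZl /rdot (bigD1 j)//= mxE !eqxx mul1r big1 ?addr0// => i ij.
    by rewrite mxE (negbTE ij) andbF mul0r.
  have mrc : measurable_fun [set: R] (fun x : R => r * x + c').
    by apply: measurable_funD => //; exact: measurable_funM.
  have fwT : fw P setT = fw Q setT.
    have F (m : fmeasure) : (fw m setT = \int[m]_z (w' z)%:E)%E.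
      transitivity (\int[pw m]_x (cst 1 x)%:E)%E.
        by rewrite /= integral_cst// mul1e.
      by rewrite pwE//; apply: eq_integral => z _; rewrite mulr1.
    by rewrite !F; exact: PQ.
  have := E P; have := E Q; rewrite (integral_onepcos (pwoo P) mrc).
  rewrite (integral_onepcos (pwoo Q) mrc) !integral_wonepcosM.
  rewrite !wcosE => <- -[]; rewrite -[pw P setT]/(fw P setT) fwT.
  exact: addrI.
have K (m : fmeasure) : (\int[m]_z (w z * \1_A (z ord0 j) *
    (1 + cos (rdot t z + c)))%:E = fw m A)%E.
  transitivity (\int[pw m]_x (\1_A x)%:E)%E.
    have i0 (x : R) : 0 <= (\1_A x : R) by rewrite indicE.
    rewrite (pwE m _ (measurable_indic mA) i0).
    by apply: eq_integral => z _; rewrite mulrAC.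
  by rewrite integral_indic// setIT.
by rewrite !K key.
Qed.

End weight.

(** [cos_restrict] inserts the indicators of a box one coordinate at a time, so the measures agree
    on boxes with measurable sides, a pi-system generating the Borel sets. *)
Lemma cos_unique (P Q : fmeasure) :
  (forall t c, \int[P]_z (1 + cos (rdot t z + c))%:E =
               \int[Q]_z (1 + cos (rdot t z + c))%:E)%E ->
  forall A, measurable A -> P A = Q A.
Proof.
move=> PQ.
pose w (s : seq 'I_n) (A : 'I_n -> set R) (z : borel 'rV[R]_n) : R :=
  \prod_(j <- s) \1_(A j) (z ord0 j).
have w0 s A z : 0 <= w s A z by apply: prodr_ge0 => j _.
have w1 s A z : w s A z <= 1.
  by apply: prodr_ile1 => j _; rewrite ler0n indicE lern1 leq_b1.
have mw s A : (forall j, measurable (A j)) -> measurable_fun setT (w s A).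
  move=> mA; apply: measurable_prod => j _.
  exact: (measurableT_comp (measurable_indic (mA j)) (@measurable_coord R n j)).
have key s A : (forall j, measurable (A j)) -> forall t c,
    (\int[P]_z (w s A z * (1 + cos (rdot t z + c)))%:E =
     \int[Q]_z (w s A z * (1 + cos (rdot t z + c)))%:E)%E.
  move=> mA; elim: s => [|j s IH] t c.
    by rewrite /w; under eq_integral do rewrite big_nil mul1r;
      under [RHS]eq_integral do rewrite big_nil mul1r.
  have wS : w (j :: s) A = (fun z => w s A z * \1_(A j) (z ord0 j)).
    by apply/funext => z; rewrite /w big_cons mulrC.
  rewrite wS; exact: (cos_restrict (mw s A mA) (w0 s A) (w1 s A) IH j (mA j) t c).
pose box (A : 'I_n -> set R) : set (borel 'rV[R]_n) := [set z | forall j, A j ((z : 'rV[R]_n) ord0 j)].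
pose G := [set box A | A in [set A | forall j, measurable (A j)]].
have mG : G `<=` measurable.
  move=> _ [A mA <-].
  have -> : box A = \bigcap_(j in [set: 'I_n]) ((fun z : borel 'rV[R]_n => z ord0 j) @^-1` A j).
    by apply/seteqP; split => [z h j _|z h j]; exact: h.
  apply: fin_bigcap_measurable => [|j _]; first exact: finite_finset.
  by rewrite -[X in measurable X]setTI; exact: measurable_coord.
apply: (@measure_unique _ R (borel 'rV[R]_n) G (fun=> setT)).
- apply/seteqP; split => [A mA|A]; last first.
    by apply: smallest_sub => //; exact: sigma_algebra_measurable.
  (* The identity into the Borel structure has measurable coordinates, so boxes generate all Borel
     sets. *)
  have mid : measurable_fun setT (id : g_sigma_algebraType G -> borel 'rV[R]_n).
    apply: measurable_rV => j _ B mB; rewrite setTI; apply: sub_gen_smallest.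
    exists (fun i => if i == j then B else setT) => [i|/=].
      by case: ifP.
    apply/seteqP; split => [z /(_ j)|z Bz i] /=; rewrite ?eqxx//.
    by case: eqP => // ->.
  by have := mid measurableT A mA; rewrite setTI.
- move=> _ _ [A mA <-] [B mB <-]; exists (fun j => A j `&` B j).
    by move=> j; exact: measurableI.
  by apply/seteqP; split => [z h|z [h1 h2] j]; [split => j; have [] := h j|split].
- by move=> _; exists (fun=> setT) => //; apply/seteqP; split.
- by apply/seteqP; split => // z _; exists 0%N.
- move=> _ [A mA <-].
  (* The factor 2 is [1 + cos 0]. *)
  have E (m : fmeasure) : (2%:E * m (box A) =
      \int[m]_z (w (enum 'I_n) A z * (1 + cos (rdot 0 z + 0)))%:E)%E.
    have mB : measurable (box A) by apply: mG; exists A.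
    rewrite -[box A in LHS]setIT -integral_indic// -ge0_integralZl//; last first.
    - by apply/measurable_EFinP; exact: measurable_indic.
    apply: eq_integral => z _; rewrite -EFinM; congr EFin.
    rewrite -[0 in RHS](scale0r 0) rdotZl mul0r addr0 cos0 mulrC; congr (_ * _).
    rewrite /w big_enum/= indicE; have [zA|zA] := boolP (z \in box A).
      rewrite big1// => j _; rewrite indicE mem_set//.
      by move: zA; rewrite inE => /(_ j).
    apply/esym/eqP; rewrite prodf_seq_eq0; apply: contraT => /hasPn h.
    case/negP: zA; rewrite inE => j; apply: contrapT => nA.
    have := h j; rewrite mem_index_enum => /(_ isT) /=.
    by rewrite indicE memNset// eqxx.
  have := key (enum 'I_n) A mA 0 0; rewrite -!E.
  have mB : measurable (box A) by apply: mG; exists A.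
  rewrite -[P _]fineK ?fin_num_measure// -[Q _]fineK ?fin_num_measure//.
  rewrite -!EFinM => -[/mulfI h].
  rewrite -[LHS]fineK ?fin_num_measure// -[RHS]fineK ?fin_num_measure//.
  by congr EFin; apply: h.
- by move=> _; exact: finite_measure_lty.
Qed.

End uniqueness.

(** * Laws of finite families of functionals *)

Section rdot_more.
Context (R : realType) (n : nat).
Implicit Types x y : 'rV[R]_n.

Lemma rdot_eq0 x : rdot x x = 0 -> x = 0.
Proof.
move=> /eqP; rewrite psumr_eq0; last by move=> i _; rewrite -expr2 sqr_ge0.
move=> /allP h; apply/rowP => i; rewrite mxE; apply/eqP.
by have := h i (mem_index_enum _); rewrite /= mulf_eq0 orbb.
Qed.

Lemma rdot_CS x y : rdot x y ^+ 2 <= rdot x x * rdot y y.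
Proof.
have [y0|yN0] := eqVneq (rdot y y) 0.
  by rewrite (rdot_eq0 y0) rdotC !rdot0l expr0n mulr0.
have ypos : 0 < rdot y y by rewrite lt_neqAle eq_sym yN0 rdot_ge0.
have := rdot_ge0 (rdot y y *: x - rdot x y *: y).
rewrite !(rdotDl, rdotDr, rdotNl, rdotNr, rdotZl, rdotZr) (rdotC y x) => h.
rewrite -subr_ge0 -(pmulr_rge0 _ ypos); move: h; congr (_ <= _); ring.
Qed.

Lemma rdot_snoc (v w : 'rV[R]_n) a b :
  rdot (row_snoc (v, a)) (row_snoc (w, b)) = rdot v w + a * b.
Proof.
pose F (i : 'I_n.+1) (u : R) : R := u * row_snoc (w, b) ord0 i.
rewrite /rdot (@big_row_snoc R R 0 _ n F (v, a)) /F row_snoc_max addrC; congr (_ + _).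
by apply: eq_bigr => i _; rewrite row_snoc_lift.
Qed.

End rdot_more.

(** * Continuous linear functionals *)

Section dual.
Context (R : realType) (X : completeNormedModType R).
Implicit Types f g : X -> R.

(** A predicate on bare functions, so that sums, multiples and functionals such as
    [fun x => rdot t (e x)] need no packing; [dual_linear] returns to the packed form. *)
Definition dual f := linear (f : X -> R^o) /\ continuous f.

Lemma dualE f a x y : dual f -> f (a *: x + y) = a * f x + f y.
Proof. by case=> h _; exact: h. Qed.

Lemma dual0 f : dual f -> f 0 = 0.
Proof.
move=> df; have := dualE 1 0 0 df; rewrite scale1r addr0 mul1r => /eqP.
by rewrite eq_sym -subr_eq0 addrK => /eqP.
Qed.

Lemma dualD f x y : dual f -> f (x + y) = f x + f y.
Proof. by move=> /(dualE 1 x y); rewrite scale1r mul1r. Qed.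

Lemma dualZ f a x : dual f -> f (a *: x) = a * f x.
Proof. by move=> df; have := dualE a x 0 df; rewrite addr0 (dual0 df) addr0. Qed.

Lemma dualN f x : dual f -> f (- x) = - f x.
Proof. by move=> df; rewrite -scaleN1r (dualZ _ _ df) mulN1r. Qed.

Lemma dualB f x y : dual f -> f (x - y) = f x - f y.
Proof. by move=> df; rewrite (dualD _ _ df) (dualN _ df). Qed.

Lemma dual_cst0 : dual (fun=> 0).
Proof. by split=> [a x y|x]; [rewrite scaler0 addr0|exact: cvg_cst]. Qed.

Lemma dual_add f g : dual f -> dual g -> dual (fun x => f x + g x).
Proof.
move=> df dg; split=> [a x y|x].
  by rewrite (dualE _ _ _ df) (dualE _ _ _ dg) scalerDr addrACA.
by apply: cvgD; [exact: df.2|exact: dg.2].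
Qed.

Lemma dual_scale c f : dual f -> dual (fun x => c * f x).
Proof.
move=> df; split=> [a x y|x].
  by rewrite (dualE _ _ _ df) mulrDr /GRing.scale/= mulrCA.
by apply: cvgM; [exact: cvg_cst|exact: df.2].
Qed.

Lemma dual_linear f : dual f ->
  exists2 l : {linear X -> R^o}, continuous l & forall x, l x = f x.
Proof.
move=> [lf cf]; pose l : {linear X -> R^o} :=
  HB.pack (f : X -> R^o) (GRing.isLinear.Build _ _ _ _ (f : X -> R^o) lf).
by exists l.
Qed.

Lemma measurable_dual f : dual f -> measurable_fun [set: borel X] (f : borel X -> R).
Proof. by move=> [_ cf]; exact: measurable_borelT. Qed.

End dual.

(** * Law and variance of one functional *)

Section gaussian_dual.
Context (R : realType) (X : completeNormedModType R).
Context (mu : probability (borel X) R) (hmu : centred_gaussian mu).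
Implicit Types f g : X -> R.
Local Opaque normal_char.

Lemma dual_law f : dual f -> exists s : R, forall g : R -> \bar R,
  measurable_fun [set: R] g -> (forall x, 0 <= g x)%E ->
  (\int[mu]_(x in [set: borel X]) g (f x) =
   if s == 0%R then g 0%R else \int[normal_prob 0 s]_x g x)%E.
Proof.
move=> df; have [l cl lE] := dual_linear df; have [s hs] := hmu cl.
exists s => g mg g0; have mf := measurable_dual df.
transitivity (\int[pushm mu (mf : measurable_fun setT (f : borel X -> measurableTypeR R))]_x g x)%E.
  by rewrite ge0_integral_pushforward.
have lf : (l : X -> R) = f by apply/funext.
case: eqP => s0.
  transitivity (\int[dirac (0%R : measurableTypeR R)]_x g x)%E; last first.
    by rewrite integral_dirac// diracT mul1e.
  apply: eq_measure_integral => A mA _; have := hs A mA.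
  by rewrite /centred_normal s0 eqxx lf.
apply: eq_measure_integral => A mA _; have := hs A mA.
by rewrite /centred_normal; case: eqP => // _; rewrite lf.
Qed.

(** Real-valued: an infinite integral would be read as 0, which [dual_varE] excludes for continuous
    functionals. *)
Definition var f : R := (\int[mu]_(x in [set: borel X]) (f x) ^+ 2)%R.

Lemma dual_varE f : dual f -> (\int[mu]_(x in [set: borel X]) ((f x) ^+ 2)%:E = (var f)%:E)%E.
Proof.
move=> df; have [s hs] := dual_law df.
have m2 : measurable_fun [set: R] (fun x : R => (x ^+ 2)%:E).
  by apply/measurable_EFinP; exact: measurable_funX.
rewrite /var /Rintegral (hs _ m2); last by move=> x; rewrite lee_fin sqr_ge0.
by case: ifPn => [//|s0]; rewrite normal_moment2.
Qed.

Lemma var_ge0 f : 0 <= var f.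
Proof. by apply: Rintegral_ge0 => x _; exact: sqr_ge0. Qed.

Lemma dual_law_var f : dual f -> exists2 s : R, var f = s ^+ 2 & forall g : R -> \bar R,
  measurable_fun [set: R] g -> (forall x, 0 <= g x)%E ->
  (\int[mu]_(x in [set: borel X]) g (f x) =
   if s == 0%R then g 0%R else \int[normal_prob 0 s]_x g x)%E.
Proof.
move=> df; have [s hs] := dual_law df; exists s => //.
have m2 : measurable_fun [set: R] (fun x : R => (x ^+ 2)%:E).
  by apply/measurable_EFinP; exact: measurable_funX.
have := dual_varE df; rewrite (hs _ m2); last by move=> x; rewrite lee_fin sqr_ge0.
case: eqP => [->|/eqP s0]; last by rewrite normal_moment2// => -[].
by move=> -[<-].
Qed.

Lemma dual_onepcos f c : dual f ->
  (\int[mu]_(x in [set: borel X]) (1 + cos (f x + c))%:E =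
   (1 + cos c * normal_char (Num.sqrt (var f)))%:E)%E.
Proof.
move=> df; have [s vE hs] := dual_law_var df.
have mc : measurable_fun [set: R] (fun x : R => (1 + cos (x + c))%:E).
  by apply: measurable_onepcos; exact: measurable_funD.
rewrite (hs _ mc) => [|x]; last exact: onepcos_ge0.
rewrite vE sqrtr_sqr normal_char_norm; case: eqP => [->|/eqP s0].
  by rewrite add0r normal_char0 mulr1.
have mxc : measurable_fun [set: R] (fun x : R => x + c) by exact: measurable_funD.
by have := prob_onepcos (normal_prob 0 s) mxc; rewrite /= (normal_cos c s0).
Qed.

Lemma dual_var0 f : dual f -> var f = 0 -> \forall x \ae mu, f x = 0.
Proof.
move=> df v0; have mf := measurable_dual df.
have := dual_varE df; rewrite v0 => h.
have m2 : measurable_fun [set: borel X] (fun x : borel X => ((f x) ^+ 2)%:E).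
  by apply/measurable_EFinP; exact: measurable_funX.
have := (@ae_eq_integral_abs _ _ _ mu setT measurableT _ m2).1.
move=> /(_ _)[]; first by rewrite -[RHS]h; apply: eq_integral => x _; rewrite gee0_abs// lee_fin sqr_ge0.
move=> B [mB B0 sB]; exists B; split=> //; apply: subset_trans sB => x /= fx h2.
by apply: fx; have /= := h2 Logic.I; case=> /eqP; rewrite sqrf_eq0 => /eqP.
Qed.

End gaussian_dual.

(** * Orthonormalisation in L^2 *)

Section gram_schmidt.
Context (R : realType) (X : completeNormedModType R).
Context (mu : probability (borel X) R) (hmu : centred_gaussian mu).
Implicit Types f g : X -> R.
Local Opaque normal_char.

Lemma integrable_sqr_dual f : dual f ->
  mu.-integrable [set: borel X] (EFin \o (fun x => f x ^+ 2)).
Proof.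
move=> df; have mf := measurable_dual df; apply/integrableP; split.
  by apply/measurable_EFinP; exact: measurable_funX.
under eq_integral do rewrite gee0_abs ?lee_fin ?sqr_ge0//.
by rewrite (dual_varE hmu df) ltry.
Qed.

Lemma integrable_dualM f g : dual f -> dual g ->
  mu.-integrable [set: borel X] (EFin \o (fun x => f x * g x)).
Proof.
move=> df dg; have mf := measurable_dual df; have mg := measurable_dual dg.
have i := integrableD measurableT (integrable_sqr_dual df) (integrable_sqr_dual dg).
apply: le_integrable i => //.
  by apply/measurable_EFinP; exact: measurable_funM.
move=> x _ /=; rewrite lee_fin [leRHS]ger0_norm ?addr_ge0 ?sqr_ge0//.
rewrite normrM -(real_normK (num_real (f x))) -(real_normK (num_real (g x))).
by move: (`|f x|) (`|g x|) (normr_ge0 (f x)) (normr_ge0 (g x)) => a b; nra.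
Qed.

Definition cov f g : R := (\int[mu]_(x in [set: borel X]) (f x * g x))%R.

Lemma varDZ f g c : dual f -> dual g ->
  var mu (fun x => f x + c * g x) = var mu f + 2 * c * cov f g + c ^+ 2 * var mu g.
Proof.
move=> df dg; have i1 := integrable_sqr_dual df.
have i2 := integrableZl measurableT (2 * c) (integrable_dualM df dg).
have i3 := integrableZl measurableT (c ^+ 2) (integrable_sqr_dual dg).
rewrite /var /cov -(RintegralZl (2 * c) measurableT (integrable_dualM df dg)).
rewrite -(RintegralZl (c ^+ 2) measurableT (integrable_sqr_dual dg)).
rewrite -(RintegralD measurableT i1 i2) -(RintegralD measurableT (integrableD measurableT i1 i2) i3).
by apply: eq_Rintegral => x _ /=; ring.
Qed.

Lemma covDZ f g h c : dual f -> dual g -> dual h ->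
  cov (fun x => f x + c * g x) h = cov f h + c * cov g h.
Proof.
move=> df dg dh; have i1 := integrable_dualM df dh.
have i2 := integrableZl measurableT c (integrable_dualM dg dh).
rewrite /cov -(RintegralZl c measurableT (integrable_dualM dg dh)).
rewrite -(RintegralD measurableT i1 i2).
by apply: eq_Rintegral => x _ /=; ring.
Qed.

Lemma covC f g : cov f g = cov g f.
Proof. by apply: eq_Rintegral => x _; rewrite mulrC. Qed.

(* [e] is an orthonormal family (with variance-zero remainders discarded). *)
Lemma gram_schmidt (l : nat -> X -> R) n : (forall i, dual (l i)) ->
  exists m (e : X -> 'rV[R]_m),
    [/\ forall t, dual (fun x => rdot t (e x)),
        forall t, var mu (fun x => rdot t (e x)) = rdot t t &
        forall i, (i < n)%N -> exists a : 'rV[R]_m, var mu (fun x => l i x - rdot a (e x)) = 0].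
Proof.
move=> dl; elim: n => [|n [m [e [de ve le]]]].
  have r0 (t s : 'rV[R]_0) : rdot t s = 0 by rewrite /rdot big_ord0.
  exists 0%N, (fun=> 0); split=> // t.
    by rewrite (_ : (fun x => _) = fun=> 0); [exact: dual_cst0|apply/funext => x; exact: r0].
  by rewrite !r0 /var; under eq_Rintegral do rewrite expr0n/=; rewrite Rintegral_cst// mul0r.
(* Coefficients of the orthogonal projection of [l n] onto the span of [e]. *)
pose b : 'rV[R]_m := \row_j cov (l n) (fun x => rdot (delta_mx ord0 j) (e x)).
have bE t : cov (l n) (fun x => rdot t (e x)) = rdot t b.
  have F0 : cov (l n) (fun x => rdot 0 (e x)) = 0.
    rewrite covC -[RHS](mul0r (cov (fun x => rdot 0 (e x)) (l n))).
    by rewrite /cov; under eq_Rintegral do rewrite rdot0l mul0r;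
      rewrite Rintegral_cst// !mul0r.
  have FD u w c : cov (l n) (fun x => rdot (u + c *: w) (e x)) =
      cov (l n) (fun x => rdot u (e x)) + c * cov (l n) (fun x => rdot w (e x)).
    rewrite !(covC (l n)) -covDZ//; congr cov; apply/funext => x.
    by rewrite rdotDl rdotZl.
  rewrite {1}[t](row_sum_delta t) /rdot.
  apply: (big_ind2 (fun (u : 'rV[R]_m) y => cov (l n) (fun x => rdot u (e x)) = y)) => //.
    by move=> u1 y1 u2 y2 <- <-; rewrite -[u2 in LHS]scale1r FD mul1r.
  by move=> j _; rewrite -[t _ _ *: _]add0r FD F0 add0r mxE.
pose r x := l n x - rdot b (e x).
have dr : dual r.
  rewrite (_ : r = fun x => l n x + -1 * rdot b (e x)); last by apply/funext => x; rewrite mulN1r.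
  by apply: dual_add => //; exact: dual_scale.
have re0 t : cov r (fun x => rdot t (e x)) = 0.
  (* Polarisation: covariances of combinations of [e] follow from their variances, known by [ve]. *)
  have h : cov (fun x => rdot b (e x)) (fun x => rdot t (e x)) = rdot b t.
    have := varDZ 1 (de b) (de t); have -> : (fun x => rdot b (e x) + 1 * rdot t (e x)) =
        fun x => rdot (b + t) (e x) by apply/funext => x; rewrite mul1r rdotDl.
    rewrite !ve !(rdotDl, rdotDr) (rdotC t b); set c := cov _ _; lra.
  have -> : cov r (fun x => rdot t (e x)) =
      cov (fun x => l n x + -1 * rdot b (e x)) (fun x => rdot t (e x)).
    by congr cov; apply/funext => x; rewrite mulN1r.
  by rewrite covDZ// bE h rdotC mulN1r subrr.
have [v0|vN0] := eqVneq (var mu r) 0.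
  exists m, e; split => // i; rewrite ltnS leq_eqVlt => /orP[/eqP ->|/le//].
  by exists b.
pose s := Num.sqrt (var mu r).
have s0 : s != 0 by rewrite sqrtr_eq0 -ltNge lt_neqAle eq_sym vN0 var_ge0.
exists m.+1, (fun x => row_snoc (e x, s^-1 * r x)).
have E t x : rdot t (row_snoc (e x, s^-1 * r x)) =
    rdot (row_split t).1 (e x) + (row_split t).2 * s^-1 * r x.
  by rewrite -[t in LHS]row_splitK; case: (row_split t) => v c; rewrite rdot_snoc mulrA.
split=> [t|t|i].
- rewrite (_ : (fun x => _) = fun x => rdot (row_split t).1 (e x) + (row_split t).2 * s^-1 * r x).
    by apply: dual_add => //; exact: dual_scale.
  by apply/funext => x.
- rewrite (_ : (fun x => _) = fun x => rdot (row_split t).1 (e x) + (row_split t).2 * s^-1 * r x); last first.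
    by apply/funext => x.
  rewrite varDZ// ve (_ : cov _ r = 0) ?mulr0 ?addr0; last first.
    by rewrite -[RHS](re0 (row_split t).1); apply: eq_Rintegral => x _; rewrite mulrC.
  rewrite -[t in RHS]row_splitK; case: (row_split t) => v c; rewrite rdot_snoc/=.
  rewrite exprMn exprVn /s sqr_sqrtr ?var_ge0// -mulrA mulVf// mulr1 expr2.
  by [].
- rewrite ltnS leq_eqVlt => /orP[/eqP ->|/le [a ha]].
    exists (row_snoc (b, s)); rewrite -[RHS](_ : var mu (fun=> 0) = 0).
      by congr var; apply/funext => x; rewrite rdot_snoc mulrA divff// mul1r /r; ring.
    by rewrite /var; under eq_Rintegral do rewrite expr0n/=; rewrite Rintegral_cst// mul0r.
  exists (row_snoc (a, 0)); rewrite -[RHS]ha; congr var; apply/funext => x.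
  by rewrite rdot_snoc mul0r addr0.
Qed.

End gram_schmidt.

(** * Inequalities for finitely many functionals *)

Section finite_family.
Context (R : realType) (X : completeNormedModType R).
Context (mu : probability (borel X) R) (hmu : centred_gaussian mu).
Context (l : nat -> X -> R) (n : nat).
Hypothesis dl : forall i, dual (l i).
Local Opaque normal_char.

Definition fam (x : X) : 'rV[R]_n := \row_(i < n) l i x.

Lemma measurable_fam : measurable_fun [set: borel X] (fam : borel X -> borel 'rV[R]_n).
Proof.
apply: measurable_rV => i; under eq_fun do rewrite mxE.
exact: measurable_dual.
Qed.

Definition lin m (a : 'I_n -> 'rV[R]_m) (z : 'rV[R]_m) : 'rV[R]_n := \row_i rdot (a i) z.

Lemma measurable_lin m (a : 'I_n -> 'rV[R]_m) :
  measurable_fun [set: borel 'rV[R]_m] (lin a : borel 'rV[R]_m -> borel 'rV[R]_n).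
Proof.
apply: measurable_rV => i; under eq_fun do rewrite mxE.
exact: measurable_rdot.
Qed.

(** Up to a null set, [fam] is the image of the orthonormal vector [e] under [lin a]. The law of [e]
    is standard Gaussian by [cos_unique]: each [rdot t (e x)] is normal with variance [rdot t t], so
    both cosine transforms are the same value of [normal_char]. *)
Lemma law_fam : exists m (e : X -> 'rV[R]_m) (a : 'I_n -> 'rV[R]_m),
  [/\ forall t, dual (fun x => rdot t (e x)),
      forall t, var mu (fun x => rdot t (e x)) = rdot t t,
      forall i : 'I_n, var mu (fun x => l i x - rdot (a i) (e x)) = 0,
      forall i : 'I_n, var mu (l i) = rdot (a i) (a i) &
      forall F : borel 'rV[R]_n -> \bar R, measurable_fun setT F -> (forall p, 0 <= F p)%E ->
        (\int[mu]_(x in [set: borel X]) F (fam x) = \int[gauss_rV R m]_z F (lin a z))%E].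
Proof.
have [m [e [de ve le]]] := gram_schmidt hmu n dl.
have /choice[a ha] : forall i : 'I_n, exists a : 'rV[R]_m, var mu (fun x => l i x - rdot a (e x)) = 0.
  by move=> i; exact: le.
have ae0 (i : 'I_n) : \forall x \ae mu, l i x - rdot (a i) (e x) = 0.
  apply: (dual_var0 hmu _ (ha i)).
  rewrite (_ : (fun x => _) = fun x => l i x + -1 * rdot (a i) (e x)).
    by apply: dual_add => //; apply: dual_scale; exact: de.
  by apply/funext => x; rewrite mulN1r.
have law (F : borel 'rV[R]_n -> \bar R) : measurable_fun setT F -> (forall p, 0 <= F p)%E ->
    (\int[mu]_(x in [set: borel X]) F (fam x) = \int[gauss_rV R m]_z F (lin a z))%E.
  move=> mF F0; have mFl := measurableT_comp mF (measurable_lin a).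
  have me : measurable_fun [set: borel X] (e : borel X -> borel 'rV[R]_m).
    apply: measurable_rV => j.
    rewrite (_ : (fun x => _) = (fun x => rdot (delta_mx ord0 j) (e x))).
      by apply: measurable_dual; exact: de.
    apply/funext => x; rewrite /rdot (bigD1 j)//= mxE !eqxx mul1r big1 ?addr0// => i ij.
    by rewrite mxE (negbTE ij) andbF mul0r.
  transitivity (\int[mu]_(x in [set: borel X]) F (lin a (e x)))%E.
    apply: ge0_ae_eq_integral => //.
    - exact: (measurableT_comp mF measurable_fam).
    - exact: (measurableT_comp mFl me).
    have h0 : \forall x \ae mu, forall i : 'I_n, l i x - rdot (a i) (e x) = 0.
      by apply: filter_forall => i; exact: ae0.
    case: h0 => B [mB B0 sB]; exists B; split => //.
    apply: subset_trans sB => x; apply: contra_not => h _; congr F; apply/rowP => i; rewrite !mxE.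
    by apply/eqP; rewrite -subr_eq0 h.
  have Poo : (pushm mu me setT < +oo)%E.
    by rewrite /pushm/= /pushforward preimage_setT probability_setT ltry.
  transitivity (\int[pushm mu me]_z F (lin a z))%E.
    by rewrite ge0_integral_pushforward.
  apply: eq_measure_integral => A mA _.
  apply: (cos_unique (P := finite_pack Poo)) => // t c.
  transitivity (\int[pushm mu me]_z (1 + cos (rdot t z + c))%:E)%E; first by [].
  have mrt : measurable_fun [set: borel 'rV[R]_m] (fun z : borel 'rV[R]_m => rdot t z + c).
    by apply: measurable_funD => //; exact: measurable_rdot.
  rewrite (ge0_integral_pushforward me) => [|//||z _]; last exact: onepcos_ge0.
    by rewrite gauss_onepcos preimage_setT -(ve t) -(dual_onepcos hmu c (de t)).
  exact: (measurable_onepcos mrt).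
exists m, e, a; split => // i.
have E : (\int[mu]_(x in [set: borel X]) ((l i x) ^+ 2)%:E =
    \int[mu]_(x in [set: borel X]) ((rdot (a i) (e x)) ^+ 2)%:E)%E.
  apply: ge0_ae_eq_integral => //.
  - by apply/measurable_EFinP; apply: measurable_funX; exact: measurable_dual.
  - by apply/measurable_EFinP; apply: measurable_funX; exact: measurable_dual.
  - by move=> x _; rewrite lee_fin sqr_ge0.
  - by move=> x _; rewrite lee_fin sqr_ge0.
  have [B [mB B0 sB]] := ae0 i; exists B; split => //.
  apply: subset_trans sB => x; apply: contra_not => h _; congr ((_ ^+ 2)%:E).
  by apply/eqP; rewrite -subr_eq0 h.
by move: E; rewrite (dual_varE hmu)// (dual_varE hmu)// ve => -[].
Qed.

(** [k] stands for the squared distance of two points in the Gaussian coordinates. Those coordinates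
    stay hidden: by Cauchy-Schwarz, all that is kept of [k] is that it bounds the differences of the
    functionals relative to their variances. *)
Lemma dual_prekopa (F G H : borel 'rV[R]_n -> \bar R) (v : 'I_n -> R) :
  measurable_fun setT F -> measurable_fun setT G -> measurable_fun setT H ->
  (forall p, (0 <= F p)%E) -> (forall p, (0 <= G p)%E) -> (forall p, (0 <= H p)%E) ->
  (forall i : 'I_n, var mu (l i) <= v i) ->
  (forall (p q : 'rV[R]_n) k, 0 <= k -> (forall i, (p ord0 i - q ord0 i) ^+ 2 <= k * v i) ->
     (F p * G q <= (expR (k / 4))%:E * (H (2^-1 *: (p + q)) * H (2^-1 *: (p + q))))%E) ->
  ((\int[mu]_(x in [set: borel X]) F (fam x)) * (\int[mu]_(x in [set: borel X]) G (fam x)) <=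
   (\int[mu]_(x in [set: borel X]) H (fam x)) * (\int[mu]_(x in [set: borel X]) H (fam x)))%E.
Proof.
move=> mF mG mH F0 G0 H0 lv FGH; have [m [e [a [de ve _ va law]]]] := law_fam.
rewrite !law//; have ml := @measurable_lin m a.
apply: gauss_prekopa => //; try exact: (measurableT_comp _ ml).
move=> z w; have -> : lin a (2^-1 *: (z + w)) = 2^-1 *: (lin a z + lin a w).
  by apply/rowP => i; rewrite !mxE rdotZr rdotDr.
apply: FGH => [|i]; first exact: rdot_ge0.
rewrite !mxE -rdotNr -rdotDr mulrC (le_trans (rdot_CS _ _))//.
by rewrite ler_wpM2r ?rdot_ge0// -va.
Qed.

Lemma dual_opp (F : borel 'rV[R]_n -> \bar R) : measurable_fun setT F -> (forall p, (0 <= F p)%E) ->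
  (\int[mu]_(x in [set: borel X]) F (- fam x)%R = \int[mu]_(x in [set: borel X]) F (fam x))%E.
Proof.
move=> mF F0; have [m [e [a [_ _ _ _ law]]]] := law_fam.
have mFN : measurable_fun setT (fun p : borel 'rV[R]_n => F (- p)%R).
  exact: (measurableT_comp mF (@measurable_rVN R n)).
have mFa := measurableT_comp mF (@measurable_lin m a).
rewrite (law _ mFN)// law// -(gauss_opp mFa) => [|z]; last exact: F0.
apply: eq_integral => z _; congr F; apply/rowP => i.
by rewrite !mxE rdotNr.
Qed.

(** [cm_norm] only tests functionals of variance at most 1; homogeneity gives the rest. A functional
    of variance 0 must vanish at [h], because all its multiples are admissible. *)
Lemma cm_bound (h : X) (f : X -> R) : cm_space mu h -> dual f ->
  `|f h| <= fine (cm_norm mu h) * Num.sqrt (var mu f).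
Proof.
move=> Eh df; set s := fine _.
have ub g : dual g -> var mu g <= 1 -> `|g h| <= s.
  move=> dg vg; have [g' cg' g'E] := dual_linear dg.
  have gh : (`|g h|%:E <= cm_norm mu h)%E.
    apply: ereal_sup_ubound; exists g'; last by rewrite g'E.
    split=> //; rewrite (_ : (g' : X -> R) = g); last exact/funext.
    by rewrite (dual_varE hmu dg) lee_fin.
  rewrite -lee_fin /s fineK// ge0_fin_numE; first exact: Eh.
  by apply: le_trans gh; rewrite lee_fin.
have vZ c : var mu (fun x => c * f x) = c ^+ 2 * var mu f.
  rewrite /var -(RintegralZl _ measurableT (integrable_sqr_dual hmu df)).
  by apply: eq_Rintegral => x _; rewrite exprMn.
have [v0|vN0] := eqVneq (var mu f) 0.
  rewrite v0 sqrtr0 mulr0; apply/ler_addgt0Pr => e e0; rewrite add0r.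
  (* The multiple [s / e + 1] still has variance 0, and [(s / e + 1) * y <= s] forces [y <= e]. *)
  have := ub _ (dual_scale (s / e + 1) df); rewrite vZ v0 mulr0 => /(_ ler01).
  have s0 : 0 <= s by have := ub _ (dual_cst0 X); rewrite /var; under eq_Rintegral do rewrite expr0n/=;
    rewrite Rintegral_cst// mul0r normr0 => /(_ ler01).
  rewrite normrM (ger0_norm (_ : 0 <= s / e + 1)) ?addr_ge0 ?divr_ge0 ?(ltW e0)//.
  move: (normr_ge0 (f h)); move: (`|f h|) => y y0 h1.
  rewrite leNgt; apply/negP => ey; move: h1; apply/negP; rewrite -ltNge.
  have : s / e * e = s by rewrite divfK// gt_eqF.
  have : 0 <= s / e by rewrite divr_ge0// ltW.
  move: (s / e) => q q0 qe; nra.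
have v0 : 0 < var mu f by rewrite lt_neqAle eq_sym vN0 var_ge0.
have q0 : 0 < Num.sqrt (var mu f) by rewrite sqrtr_gt0.
have := ub _ (dual_scale (Num.sqrt (var mu f))^-1 df).
rewrite vZ exprVn (sqr_sqrtr (ltW v0)) mulVf// => /(_ (lexx _)).
by rewrite normrM gtr0_norm ?invr_gt0// mulrC ler_pdivrMr.
Qed.

(** In the coordinates [e], the shift by [h] is a shift by [e h], whose length is at most the
    Cameron-Martin norm of [h]; [gauss_shift] then applies with [e h] and with [- e h]. *)
Lemma dual_shift (h : X) (F : borel 'rV[R]_n -> \bar R) :
  cm_space mu h -> measurable_fun setT F -> (forall p, (0 <= F p)%E) ->
  ((2 * expR (- (fine (cm_norm mu h) ^+ 2 / 2)))%:E * \int[mu]_(x in [set: borel X]) F (fam x) <=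
   \int[mu]_(x in [set: borel X]) F (fam x - fam h)%R +
   \int[mu]_(x in [set: borel X]) F (fam x + fam h)%R)%E.
Proof.
move=> Eh mF F0; have [m [e [a [de ve ae _ law]]]] := law_fam.
set s := fine _.
(* [cm_bound] for the functional [fun x => rdot (e h) (e x)]: its value at [h] and its variance are
   both [|e h|^2 = q], hence [q <= s * sqrt q]. *)
have eta2 : rdot (e h) (e h) <= s ^+ 2.
  have := cm_bound Eh (de (e h)); rewrite ve -/s (ger0_norm (rdot_ge0 _)).
  set q := rdot _ _ => hq; have q0 : 0 <= q := rdot_ge0 _.
  have := sqr_sqrtr q0; have := sqrtr_ge0 q; move: (Num.sqrt q) hq => y; nra.
(* Elsewhere this identity holds only almost everywhere. At the single point [h] it holds because
   functionals of variance 0 vanish on the Cameron-Martin space. *)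
have fh : fam h = lin a (e h).
  apply/rowP => i; rewrite !mxE; apply/eqP; rewrite -subr_eq0.
  have di : dual (fun x => l i x - rdot (a i) (e x)).
    rewrite (_ : (fun x => _) = fun x => l i x + -1 * rdot (a i) (e x)).
      by apply: dual_add => //; apply: dual_scale; exact: de.
    by apply/funext => x; rewrite mulN1r.
  by have := cm_bound Eh di; rewrite ae sqrtr0 mulr0 normr_le0.
have mFa := measurableT_comp mF (@measurable_lin m a).
have mFs b : measurable_fun setT (fun p : borel 'rV[R]_n => F (p + b)%R).
  exact: (measurableT_comp mF (@measurable_rVD R n b)).
rewrite (law _ mF)// (law _ (mFs _))// (law _ (mFs _))// fh.
have E1 : (\int[gauss_rV R m]_z F (lin a z - lin a (e h))%R =
   \int[gauss_rV R m]_z (F (lin a z) * (expR (- rdot (e h) z - rdot (e h) (e h) / 2))%:E))%E.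
  rewrite -(gauss_shift (e h) mFa) => [|z]; last exact: F0.
  apply: eq_integral => z _; congr F; apply/rowP => i.
  by rewrite !mxE rdotDr rdotNr.
have E2 : (\int[gauss_rV R m]_z F (lin a z + lin a (e h))%R =
   \int[gauss_rV R m]_z (F (lin a z) * (expR (rdot (e h) z - rdot (e h) (e h) / 2))%:E))%E.
  transitivity (\int[gauss_rV R m]_z (F \o lin a) (z - - e h)%R)%E.
    by apply: eq_integral => z _; congr F; apply/rowP => i; rewrite opprK !mxE rdotDr.
  rewrite (gauss_shift (- e h) mFa) => [|z]; last exact: F0.
  by apply: eq_integral => z _; rewrite !rdotNl rdotNr !opprK.
have mw c : measurable_fun [set: borel 'rV[R]_m]
    (fun z : borel 'rV[R]_m => (expR (c * rdot (e h) z - rdot (e h) (e h) / 2))%:E).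
  apply/measurable_EFinP; apply: measurableT_comp => //.
  by apply: measurable_funB => //; apply: measurable_funM => //; exact: measurable_rdot.
have m1 : measurable_fun [set: borel 'rV[R]_m] (fun z : borel 'rV[R]_m =>
   (F (lin a z) * (expR (- rdot (e h) z - rdot (e h) (e h) / 2))%:E)%E).
  by apply: emeasurable_funM => //; have := mw (-1); under eq_fun do rewrite mulN1r.
have m2 : measurable_fun [set: borel 'rV[R]_m] (fun z : borel 'rV[R]_m =>
   (F (lin a z) * (expR (rdot (e h) z - rdot (e h) (e h) / 2))%:E)%E).
  by apply: emeasurable_funM => //; have := mw 1; under eq_fun do rewrite mul1r.
rewrite E1 E2 -ge0_integralD//; last 2 first.
- by move=> z _; rewrite mule_ge0// lee_fin expR_ge0.
- by move=> z _; rewrite mule_ge0// lee_fin expR_ge0.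
have c0 : (0 <= (2 * expR (- (s ^+ 2 / 2)))%:E :> \bar R)%E by rewrite lee_fin mulr_ge0// expR_ge0.
rewrite -(ge0_integralZl (gauss_rV R m) measurableT mFa _ c0) => [|z _]; last exact: F0.
apply: ge0_le_integral => //.
- by move=> z _; apply: mule_ge0 => //; exact: F0.
- exact: measurable_funeM.
- exact: emeasurable_funD.
move=> z _; rewrite -ge0_muleDr ?lee_fin ?expR_ge0// muleC.
apply: lee_wpmul2l; first exact: F0.
rewrite -EFinD lee_fin !expRD.
have := expR_gt0 (rdot (e h) z); have := expRxMexpNx_1 (rdot (e h) z).
have : expR (- (s ^+ 2 / 2)) <= expR (- (rdot (e h) (e h) / 2)).
  by rewrite ler_expR lerN2 ler_pM2r.
have := expR_gt0 (- (rdot (e h) (e h) / 2)).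
move: (expR (- (s ^+ 2 / 2))) (expR (- (rdot _ _ / 2))) (expR (rdot _ z)) (expR (- rdot _ z)) => A B y y'.
move=> B0 AB yy y0.
have y'0 : 0 < y' by rewrite -(pmulr_rgt0 _ y0) yy.
(* Here [y'] is the inverse of [y], so the linear exponents cancel. *)
have : 2 <= y' + y by have := sqr_ge0 (y - y'); nra.
nra.
Qed.

End finite_family.

(** * Countable intersections of strips *)

Section strips.
Context (R : realType) (X : completeNormedModType R).
Context (mu : probability (borel X) R) (hmu : centred_gaussian mu).
Context (l : nat -> X -> R).
Hypothesis dl : forall i, dual (l i).
Implicit Types c d : nat -> R.

Definition strip c d : set (borel X) := [set x | forall i, `|l i x - c i| <= d i].

Definition box n c d : set (borel 'rV[R]_n) :=
  [set p | forall i : 'I_n, `|(p : 'rV[R]_n) ord0 i - c i| <= d i].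

Arguments box : clear implicits.

Lemma measurable_box n c d : measurable (box n c d).
Proof.
have -> : box n c d = \bigcap_(i in [set: 'I_n])
    ((fun a : borel 'rV[R]_n => `|a ord0 i - c i|) @^-1` `]-oo, d i]).
  apply/seteqP; split => a /= ar i; first by move=> _; rewrite /= in_itv/=; exact: ar.
  by have := ar i Logic.I; rewrite /= in_itv.
apply: fin_bigcap_measurable => [|i _]; first exact: finite_finset.
rewrite -[X in measurable X]setTI.
have m : measurable_fun [set: borel 'rV[R]_n] (fun a : borel 'rV[R]_n => `|a ord0 i - c i|).
  apply: measurableT_comp => //; apply: measurable_funB => //; exact: measurable_coord.
exact: m.
Qed.

Let stripn n c d : set (borel X) := (@fam R X l n) @^-1` box n c d.

Let measurable_stripn n c d : measurable (stripn n c d).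
Proof.
by have := @measurable_fam _ _ _ n dl measurableT _ (@measurable_box n c d); rewrite setTI.
Qed.

Let stripE c d : strip c d = \bigcap_n stripn n c d.
Proof.
apply/seteqP; split => [x h n _ i|x h i]; first by rewrite mxE; exact: h.
by have := h i.+1 Logic.I ord_max; rewrite mxE.
Qed.

Lemma measurable_strip c d : measurable (strip c d).
Proof. by rewrite stripE; apply: bigcapT_measurable. Qed.

Let strip_cvg c d : mu (stripn n c d) @[n --> \oo] --> mu (strip c d).
Proof.
rewrite stripE; apply: nonincreasing_cvg_mu => //.
- by apply: (le_lt_trans (probability_le1 _ _)); rewrite ?ltry.
- by rewrite -stripE; exact: measurable_strip.
- move=> n m nm; apply/subsetPset => x h i.
  by have := h (widen_ord nm i); rewrite !mxE.
Qed.

Let strip_sub n c d : (mu (strip c d) <= mu (stripn n c d))%E.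
Proof.
apply: le_measure; rewrite ?inE//; first exact: measurable_strip.
by rewrite stripE; exact: bigcap_inf.
Qed.

Let integral_stripn n c d :
  (\int[mu]_(x in [set: borel X]) (\1_(box n c d) (fam l n x : borel 'rV[R]_n))%:E =
   mu (stripn n c d))%E.
Proof. by rewrite -[in RHS](setIT (stripn n c d)) -integral_indic. Qed.

Let measurable_indic_box n c d :
  measurable_fun [set: borel 'rV[R]_n] (fun p => (\1_(box n c d) p)%:E : \bar R).
Proof. by apply/measurable_EFinP; apply: measurable_indic; exact: measurable_box. Qed.

Let indic_ge0 n c d (p : borel 'rV[R]_n) : (0 <= (\1_(box n c d) p)%:E :> \bar R)%E.
Proof. by rewrite lee_fin indicE. Qed.

Let mu_fin A : measurable A -> mu A \is a fin_num.
Proof. by move=> mA; exact: fin_num_measure. Qed.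

(* Index [0] carries the functional along which the two strips are far
   apart. *)
Lemma strip_prekopa c c' d r : var mu (l 0%N) <= 1 -> 0 <= r ->
  r <= `|c 0%N - c' 0%N| - 2 * d 0%N ->
  ((expR (r ^+ 2 / 4))%:E * (mu (strip c d) * mu (strip c' d)) <=
   mu (strip (fun i => (2^-1 * (c i + c' i))%R) d) *
   mu (strip (fun i => (2^-1 * (c i + c' i))%R) d))%E.
Proof.
move=> v1 r0 rc; set m := fun i => _.
have fin n : ((expR (r ^+ 2 / 4))%:E * (mu (stripn n.+1 c d) * mu (stripn n.+1 c' d)) <=
    mu (stripn n.+1 m d) * mu (stripn n.+1 m d))%E.
  (* Two copies of [H] contribute [expR (- (r ^+ 2 / 4))], which is absorbed by the allowed factor
     [expR (k / 4)] because the separation forces [r ^+ 2 <= k]. *)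
  pose H (p : borel 'rV[R]_n.+1) := ((expR (- (r ^+ 2 / 8)))%:E * (\1_(box n.+1 m d) p)%:E)%E.
  have mH : measurable_fun setT H by apply: measurable_funeM; exact: measurable_indic_box.
  have H0 p : (0 <= H p)%E by rewrite mule_ge0// lee_fin expR_ge0.
  have key := dual_prekopa hmu dl (@measurable_indic_box n.+1 c d) (@measurable_indic_box n.+1 c' d)
    mH (@indic_ge0 n.+1 c d) (@indic_ge0 n.+1 c' d) H0.
  (* Replacing the variance at index 0 by its bound 1 makes the condition there read
     [(p 0 - q 0) ^+ 2 <= k]. *)
  have {key} := key (fun i => if i == 0 :> nat then 1 else var mu (l i)).
  have -> : (\int[mu]_(x in [set: borel X]) H (fam l n.+1 x) =
      (expR (- (r ^+ 2 / 8)))%:E * mu (stripn n.+1 m d))%E.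
    have e0 : (0 <= (expR (- (r ^+ 2 / 8)))%:E :> \bar R)%E by rewrite lee_fin expR_ge0.
    rewrite -integral_stripn -(ge0_integralZl mu measurableT _ _ e0)//.
    exact: (measurableT_comp (@measurable_indic_box n.+1 m d) (@measurable_fam _ _ _ n.+1 dl)).
  rewrite !integral_stripn => key.
  have lv (i : 'I_n.+1) : var mu (l i) <= (if i == 0%N :> nat then 1 else var mu (l i)).
    by case: eqP => [->|].
  refine ((fun K FGH => K (key lv FGH)) _ _); last first.
    move=> p q k k0 pq.
    have [pc|pc] := boolP (p \in box n.+1 c d); last first.
      rewrite indicE (negbTE pc) mul0e.
      by rewrite mule_ge0 ?lee_fin ?expR_ge0// mule_ge0.
    have [qc|qc] := boolP (q \in box n.+1 c' d); last first.
      rewrite [X in (_ * X <= _)%E](_ : _ = 0%E) ?mule0; last by rewrite indicE (negbTE qc).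
      by rewrite mule_ge0 ?lee_fin ?expR_ge0// mule_ge0.
    move: pc qc; rewrite !inE => pc qc.
    have mpq : box n.+1 m d (2^-1 *: (p + q)).
      move=> i; rewrite !mxE /m -mulrBr normrM ger0_norm ?invr_ge0//.
      have := pc i; have := qc i; rewrite !ler_norml => /andP[h1 h2] /andP[h3 h4].
      rewrite mulrC ler_pdivrMr// ler_norml; apply/andP; split; lra.
    rewrite /H !indicE !mem_set// !mule1 -!EFinM lee_fin -!expRD -[leLHS]expR0 ler_expR.
    have := pq ord0; rewrite mulr1 => pq0.
    have rpq : r <= `|p ord0 ord0 - q ord0 ord0|.
      apply: le_trans rc _; have := pc ord0; have := qc ord0; rewrite /= => h1 h2.
      have := ler_normD (c 0%N - p ord0 ord0) (p ord0 ord0 - c' 0%N).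
      have := ler_normD (p ord0 ord0 - q ord0 ord0) (q ord0 ord0 - c' 0%N).
      rewrite !addrA !subrK (distrC (c 0%N) (p _ _)) => h3 h4; lra.
    have : r ^+ 2 <= k.
      by apply: le_trans pq0; rewrite -[leRHS]real_normK ?num_real// ler_sqr ?nnegrE.
    lra.
  rewrite -[mu (stripn n.+1 c d)]fineK ?mu_fin// -[mu (stripn n.+1 c' d)]fineK ?mu_fin//.
  rewrite -[mu (stripn n.+1 m d)]fineK ?mu_fin// -!EFinM !lee_fin.
  move: (fine _) (fine _) (fine _) => a b e h.
  have E : expR (r ^+ 2 / 4) * (expR (- (r ^+ 2 / 8)) * expR (- (r ^+ 2 / 8))) = 1.
    by rewrite -!expRD -[RHS]expR0; congr expR; field.
  rewrite -(ler_pM2l (expR_gt0 (r ^+ 2 / 4))) in h; apply: le_trans h _.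
  move: E; move: (expR (r ^+ 2 / 4)) (expR (- (r ^+ 2 / 8))) => A B E.
  have -> : A * (B * a * (B * a)) = A * (B * B) * (a * a) by ring.
  by rewrite E mul1r.
have cv : (mu (stripn n m d) * mu (stripn n m d))%E @[n --> \oo] -->
    (mu (strip m d) * mu (strip m d))%E.
  apply: cvgeM; [|exact: strip_cvg|exact: strip_cvg].
  by rewrite mule_def_fin// mu_fin//; exact: measurable_strip.
rewrite -(cvg_lim (@ereal_hausdorff R) cv).
apply: lime_ge.
  by apply/cvg_ex; eexists; exact: cv.
(* At [n = 0] the separating functional is absent, so the finite inequality starts at 1. *)
exists 1%N => // -[//|n] _ /=; apply: le_trans (fin n).
by rewrite lee_wpmul2l ?lee_fin ?expR_ge0// lee_pmul.
Qed.

Lemma strip_opp c d : mu (strip (fun i => - c i) d) = mu (strip c d).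
Proof.
have E n : mu (stripn n (fun i => - c i) d) = mu (stripn n c d).
  rewrite -!integral_stripn -(dual_opp hmu dl (@measurable_indic_box n c d))//.
  apply: eq_integral => x _; congr EFin; rewrite !indicE; congr (nat_of_bool _)%:R.
  apply/idP/idP; rewrite !inE => h i; have := h i; rewrite !mxE ?opprK.
    by rewrite -opprD normrN.
  by rewrite -opprD normrN.
have c1 : mu (stripn n c d) @[n --> \oo] --> mu (strip (fun i => - c i) d).
  rewrite (_ : (fun n => _) = (fun n => mu (stripn n (fun i => - c i) d))).
    exact: strip_cvg.
  by apply/funext => n; rewrite E.
have c2 : mu (stripn n c d) @[n --> \oo] --> mu (strip c d) by exact: strip_cvg.
exact: (cvg_unique (@ereal_hausdorff R) c1 c2).
Qed.

Lemma strip_shift h c d : cm_space mu h ->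
  ((2 * expR (- (fine (cm_norm mu h) ^+ 2 / 2)))%:E * mu (strip c d) <=
   mu (strip (fun i => (c i + l i h)%R) d) + mu (strip (fun i => (c i - l i h)%R) d))%E.
Proof.
move=> Eh.
have key n : ((2 * expR (- (fine (cm_norm mu h) ^+ 2 / 2)))%:E * mu (strip c d) <=
   mu (stripn n (fun i => (c i + l i h)%R) d) + mu (stripn n (fun i => (c i - l i h)%R) d))%E.
  have := dual_shift hmu dl Eh (@measurable_indic_box n c d) (@indic_ge0 n c d).
  rewrite (integral_stripn n c d).
  rewrite (_ : (fun x => _) = (fun x => (\1_(box n (fun i => c i + l i h) d)
    (fam l n x : borel 'rV[R]_n))%:E)); last first.
    apply/funext => x; congr EFin; rewrite !indicE; congr (nat_of_bool _)%:R.
    apply/idP/idP; rewrite !inE => xi i; have := xi i; rewrite !mxE.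
      by congr (`|_| <= _); ring.
    by congr (`|_| <= _); ring.
  rewrite (_ : (fun x => (\1_(box n c d) (fam l n x + fam l n h))%:E) =
    (fun x => (\1_(box n (fun i => c i - l i h) d)
    (fam l n x : borel 'rV[R]_n))%:E)); last first.
    apply/funext => x; congr EFin; rewrite !indicE; congr (nat_of_bool _)%:R.
    apply/idP/idP; rewrite !inE => xi i; have := xi i; rewrite !mxE.
      by congr (`|_| <= _); ring.
    by congr (`|_| <= _); ring.
  rewrite !integral_stripn; apply: le_trans.
  by rewrite lee_wpmul2l// lee_fin mulr_ge0// expR_ge0.
have cv : (mu (stripn n (fun i => (c i + l i h)%R) d) +
    mu (stripn n (fun i => (c i - l i h)%R) d))%E @[n --> \oo] -->
    (mu (strip (fun i => (c i + l i h)%R) d) + mu (strip (fun i => (c i - l i h)%R) d))%E.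
  apply: cvgeD; [|exact: strip_cvg|exact: strip_cvg].
  by rewrite fin_num_adde_defr// mu_fin//; exact: measurable_strip.
rewrite -(cvg_lim (@ereal_hausdorff R) cv).
apply: lime_ge; first by apply/cvg_ex; eexists; exact: cv.
by exists 0%N => // n _; exact: key.
Qed.

End strips.

(** * Norms and functionals on the product *)

Section norms.
Context (R : realType) (V : lmodType R) (N : V -> R).
Hypothesis hN : complete_norm N.

Lemma cnorm0 : N 0 = 0.
Proof. by rewrite -(scale0r 0) (cnorm_scale hN) normr0 mul0r. Qed.

Lemma cnormN x : N (- x) = N x.
Proof. by rewrite -scaleN1r (cnorm_scale hN) normrN1 mul1r. Qed.

Lemma cnormB x y : N (x - y) = N (y - x).
Proof. by rewrite -cnormN opprB. Qed.

Lemma cnorm_ge0 x : 0 <= N x.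
Proof.
have := cnorm_triangle hN x (- x); rewrite subrr cnorm0 cnormN -mulr2n.
by rewrite pmulrn_lge0.
Qed.

End norms.

(** * The open mapping argument for two complete norms *)

Section open_mapping.
Context (R : realType) (X : completeNormedModType R) (N : X -> R) (K : R).
Hypotheses (hN : complete_norm N) (NK : forall x, `|x| <= K * N x).

(** Baire: the sets [N x <= n] cover [X], so the closure of one of them has an interior point. *)
Let interior_approx : exists n x0 r, 0 < r /\ forall y : X, `|y - x0| < r ->
  forall e, 0 < e -> exists a, N a <= n /\ `|y - a| < e.
Proof.
apply: contrapT => H; pose A (n : nat) : set X := [set x | N x <= n%:R].
have FD : forall n : nat, open (~` closure (A n)) /\ dense (~` closure (A n)).
  move=> n; split; first exact/closed_openC/closed_closure.
  move=> O [x0 Ox0] oO; apply: contrapT => H'; apply: H.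
  have /nbhs_ballP[r /= r0 rO] : nbhs x0 O by exact: open_nbhs_nbhs.
  exists n%:R, x0, r; split => // y yr e e0.
  have : closure (A n) y.
    apply: contrapT => yA; apply: H'; exists y; split => //.
    by apply: rO; rewrite -ball_normE /= distrC.
  move=> /(_ (ball y e) (nbhsx_ballx y e e0)) [a [Aa ya]]; exists a; split => //.
  by move: ya; rewrite -ball_normE.
have [x [_ Fx]] := Baire FD (ex_intro _ (0 : X) Logic.I) openT.
have [n _ /(_ n (leqnn n)) /= nx] := nbhs_infty_ger (N x).
by apply: (Fx n Logic.I); exact: subset_closure.
Qed.

(** Differences of approximants near [x0 + y] and near [x0] move the centre to the origin, at the
    price [n + n]. Scaling [y] to length [r / 2] gives the factor [2 / r]; the summand 1 keeps the
    constant positive. *)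
Let approx : exists2 M, 0 < M & forall (y : X) e, 0 < e ->
  exists a, N a <= M * `|y| /\ `|y - a| < e.
Proof.
have [n [x0 [r [r0 H]]]] := interior_approx.
have n0 : 0 <= n.
  have x00 : `|x0 - x0| < r by rewrite subrr normr0.
  by have [a [na _]] := H x0 x00 1 ltr01; apply: le_trans na; exact: cnorm_ge0.
have H0 (y : X) : `|y| < r -> forall e, 0 < e -> exists a, N a <= n + n /\ `|y - a| < e.
  move=> yr e e0; have e2 : 0 < e / 2 by rewrite divr_gt0.
  have [|a [na ya]] := H (x0 + y) _ _ e2; first by rewrite addrAC subrr add0r.
  have [|b [nb yb]] := H x0 _ _ e2; first by rewrite subrr normr0.
  exists (a - b); split.
    by rewrite (le_trans (cnorm_triangle hN _ _))// (cnormN hN) lerD.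
  have -> : y - (a - b) = (x0 + y - a) - (x0 - b).
    by rewrite -[x0 + y - a]addrA [x0 + (y - a)]addrC -[RHS]addrA subKr opprB addrA addrAC.
  by rewrite (le_lt_trans (ler_normB _ _))// [ltRHS]splitr ltrD.
exists ((n + n + 1) * (2 / r)) => [|y e e0].
  by rewrite mulr_gt0// ?divr_gt0// ltr_wpDl// addr_ge0.
have [->|yN0] := eqVneq y 0.
  by exists 0; rewrite (cnorm0 hN) subr0 !normr0 mulr0.
have y0 : 0 < `|y| by rewrite normr_gt0.
pose t := r / 2 / `|y|; have t0 : 0 < t by rewrite !divr_gt0.
have [||a [na ya]] := H0 (t *: y) _ (t * e).
- rewrite normrZ (gtr0_norm t0) divfK ?gt_eqF// ltr_pdivrMr// mulr_natr mulr2n.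
  by rewrite ltrDl.
- by rewrite mulr_gt0.
exists (t^-1 *: a); split.
  rewrite (cnorm_scale hN) gtr0_norm ?invr_gt0// mulrC ler_pdivrMr//.
  apply: le_trans na _; rewrite (_ : _ * t = n + n + 1) ?lerDl//.
  by rewrite /t; field; rewrite !gt_eqF.
have -> : y - t^-1 *: a = t^-1 *: (t *: y - a).
  by rewrite scalerBr scalerA mulVf ?gt_eqF// scale1r.
by rewrite normrZ gtr0_norm ?invr_gt0// mulrC ltr_pdivrMr// mulrC.
Qed.

Lemma complete_norm_bound : exists2 C, 0 < C & forall x, N x <= C * `|x|.
Proof.
have [M M0 HM] := approx.
exists (2 * M) => [|y]; first by rewrite mulr_gt0.
have [->|yN0] := eqVneq y 0; first by rewrite (cnorm0 hN) normr0 mulr0.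
have y0 : 0 < `|y| by rewrite normr_gt0.
have e0 n : 0 < `|y| / 2 ^+ n by rewrite divr_gt0// exprn_gt0.
have /choice[a ha] : forall p : X * nat, exists a, N a <= M * `|p.1| /\ `|p.1 - a| < `|y| / 2 ^+ p.2.
  by move=> p; exact: HM.
(* Successive approximation: each step approximates the remainder [y - S m] with half the previous
   error. *)
pose S := fix S n := if n isn't m.+1 then 0 else S m + a (y - S m, m.+1).
have S1 n : `|y - S n| <= `|y| / 2 ^+ n.
  case: n => [|n]; first by rewrite subr0 expr0 divr1.
  by have [_ /ltW /=] := ha (y - S n, n.+1); rewrite opprD addrA.
have S2 n : N (S n.+1 - S n) <= M * (`|y| / 2 ^+ n).
  rewrite /= addrAC subrr add0r; have [/= h _] := ha (y - S n, n.+1).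
  by apply: le_trans h _; rewrite ler_pM2l.
(* The subtracted term makes the geometric sum telescope in the induction on [m]. *)
have S3 n m : N (S (n + m)%N - S n) <= 2 * M * (`|y| / 2 ^+ n) - 2 * M * (`|y| / 2 ^+ (n + m)).
  elim: m => [|m IH]; first by rewrite addn0 subrr (cnorm0 hN) subrr.
  rewrite addnS; have -> : S (n + m).+1 - S n = (S (n + m).+1 - S (n + m)%N) + (S (n + m)%N - S n).
    by rewrite addrA subrK.
  apply: le_trans (cnorm_triangle hN _ _) _; apply: le_trans (lerD (S2 _) IH) _.
  by rewrite exprS invfM; move: (2 ^+ (n + m))^-1 (2 ^+ n)^-1 => p q; lra.
have S4 n m : N (S (n + m)%N - S n) <= 2 * M * (`|y| / 2 ^+ n).
  by apply: le_trans (S3 n m) _; rewrite gerBl mulr_ge0 ?ltW// mulr_gt0.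
have small e : 0 < e -> \forall n \near \oo, 2 * M * (`|y| / 2 ^+ n) < e.
  move=> e_gt0; near=> n.
  have h : 2 * M * `|y| / e < n%:R by near: n; exact: nbhs_infty_gtr.
  rewrite mulrA ltr_pdivrMr ?exprn_gt0//; move: h; rewrite ltr_pdivrMr// => h.
  apply: lt_le_trans h _; rewrite mulrC ler_pM2l// -natrX ler_nat ltnW//; exact: ltn_expl.
have [e e_gt0|s hs] := cnorm_complete hN (w := S).
  have e2 : 0 < e / 2 by rewrite divr_gt0.
  have [n _ /(_ n (leqnn n)) /= hn] := small _ e2.
  exists n => m m' /subnKC <- /subnKC <-.
  rewrite -(subrKA (S n)) (le_lt_trans (cnorm_triangle hN _ _))// [ltRHS]splitr.
  rewrite [X in _ + X](cnormB hN).
  by rewrite ltrD// (le_lt_trans (S4 _ _)).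
have hs' e : 0 < e -> \forall n \near \oo, N (S n - s) < e.
  move=> e_gt0; have /cvgr0_norm_lt /(_ _ e_gt0) := hs.
  by apply: filterS => n; rewrite ger0_norm// (cnorm_ge0 hN).
(* [S n] tends to [s] for [N] and to [y] for the norm of [X]; [NK] makes the first convergence imply
   the second kind, so the limits coincide. *)
have sy : s = y.
  apply/eqP; rewrite -subr_eq0 -normr_le0; apply/ler_addgt0Pr => e e_gt0; rewrite add0r.
  have e2 : 0 < e / 2 by rewrite divr_gt0.
  have eK : 0 < e / 2 / (`|K| + 1) by rewrite divr_gt0// ltr_wpDl.
  have eM : 0 < 2 * M * (e / 2) by rewrite !mulr_gt0.
  near \oo => n.
  have h1 : N (S n - s) < e / 2 / (`|K| + 1) by near: n; exact: hs'.
  have h2 : 2 * M * (`|y| / 2 ^+ n) < 2 * M * (e / 2) by near: n; exact: small.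
  rewrite ltr_pM2l ?mulr_gt0// in h2.
  rewrite -(subrKA (S n)) (le_trans (ler_normD _ _))// [leRHS]splitr distrC lerD//; last first.
    by rewrite distrC (le_trans (S1 n))// ltW.
  rewrite (le_trans (NK _))//; move: h1; rewrite ltr_pdivlMr ?ltr_wpDl// => h1.
  have := ler_norm K; have := cnorm_ge0 hN (S n - s).
  move: (N _) (`|K|) h1 => u v h1 u0 Kv; nra.
apply/ler_addgt0Pr => e e_gt0; near \oo => n.
have h1 : N (S n - s) < e by near: n; exact: hs'.
rewrite -[y in N y](subrK (S n)) (le_trans (cnorm_triangle hN _ _))// addrC.
rewrite lerD//; last by rewrite (cnormB hN) -sy ltW.
by have := S4 0%N n; rewrite add0n subr0 expr0 divr1.
Unshelve. all: by end_near. Qed.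

End open_mapping.

(** * Hahn-Banach for an arbitrary norm *)

Section hahn_banach.
Context (R : realType) (V : lmodType R) (N : V -> R).
Hypothesis hN : complete_norm N.

(* Graphs of linear maps dominated by [N]; domination makes them
   single-valued. *)
Let graph (z0 : V) (A : set (V * R)) :=
  [/\ (forall p q c, A p -> A q -> A (c *: p.1 + q.1, c * p.2 + q.2)),
      (forall p, A p -> p.2 <= N p.1) &
      (A !=set0 -> A (z0, N z0))].

Let graph_scale z0 A p c : graph z0 A -> A p -> A (c *: p.1, c * p.2).
Proof.
move=> [Al _ _] Ap; have A0 : A (0, 0).
  by have := Al p p (-1) Ap Ap; rewrite scaleN1r mulN1r !addNr.
by have := Al p (0, 0) c Ap A0; rewrite !addr0.
Qed.

Let graph_fun z0 A z r r' : graph z0 A -> A (z, r) -> A (z, r') -> r = r'.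
Proof.
move=> gA Ar Ar'; have [Al Ad _] := gA.
have h c : c * (r - r') <= 0.
  have := Al (z, r') (z, r) (-1) Ar' Ar; rewrite /= scaleN1r mulN1r addNr => A0.
  by have := Ad _ (graph_scale c gA A0); rewrite /= scaler0 (cnorm0 hN) [- r' + r]addrC.
apply/eqP; rewrite -subr_eq0 eq_le; apply/andP; split; first by have := h 1; rewrite mul1r.
by have := h (-1); rewrite mulN1r oppr_le0.
Qed.

Lemma norming_functional (z0 : V) : exists L : V -> R,
  [/\ (forall c x y, L (c *: x + y) = c * L x + L y),
      (forall x, `|L x| <= N x) & L z0 = N z0].
Proof.
have [|A [gA Amax]] := @Zorn_bigcup _ (graph z0).
  move=> F FP Ftot; split=> [p q c [B FB Bp] [C FC Cq]|p [B FB Bp]|[p [B FB Bp]]].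
  - have [BC|CB] := Ftot B C FB FC.
      by exists C => //; have [h _ _] := FP _ FC; apply: h => //; exact: BC.
    by exists B => //; have [h _ _] := FP _ FB; apply: h => //; exact: CB.
  - by have [_ h _] := FP _ FB; exact: h.
  - by exists B => //; have [_ _ h] := FP _ FB; apply: h; exists p.
(* The empty graph is admissible, as required for unions of empty chains. Maximality excludes it,
   since the multiples of [(z0, N z0)] form a larger graph. *)
have Az0 : A (z0, N z0).
  have [[p Ap]|A0] := pselect (A !=set0); first by have [_ _ h] := gA; apply: h; exists p.
  exfalso; apply: (Amax [set p | exists c, p = (c *: z0, c * N z0)]).
    split; first by move=> p Ap; exfalso; apply: A0; exists p.
    by move=> h; apply: A0; exists (0 *: z0, 0 * N z0); apply: h; exists 0.
  split.
  - move=> _ _ c [a ->] [b ->] /=; exists (c * a + b).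
    by rewrite scalerDl mulrDl scalerA mulrA.
  - by move=> _ [c ->] /=; rewrite (cnorm_scale hN) ler_wpM2r ?(cnorm_ge0 hN)// ler_norm.
  - by move=> _; exists 1; rewrite scale1r mul1r.
have [Al Ad _] := gA.
have total z1 : exists r, A (z1, r).
  apply: contrapT => nz1.
  (* Every lower constraint on the value at [z1] lies below every upper one; [al] below is the
     supremum of the lower constraints. *)
  have cross p q : A p -> A q -> p.2 - N (p.1 - z1) <= N (q.1 + z1) - q.2.
    move=> Ap Aq; have := Ad _ (Al p q 1 Ap Aq); rewrite /= scale1r mul1r => h.
    have := cnorm_triangle hN (p.1 - z1) (q.1 + z1).
    have -> : p.1 - z1 + (q.1 + z1) = p.1 + q.1 by rewrite addrACA addNr addr0.
    lra.
  pose S := [set p.2 - N (p.1 - z1) | p in A].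
  have supS : has_sup S.
    split; first by exists (N z0 - N (z0 - z1)), (z0, N z0).
    by exists (N (z0 + z1) - N z0) => _ [p Ap <-]; exact: (cross p (z0, N z0)).
  pose al := sup S.
  have low p : A p -> p.2 - al <= N (p.1 - z1).
    move=> Ap; have : p.2 - N (p.1 - z1) <= al.
      by apply: sup_upper_bound => //; exists p.
    lra.
  have up p : A p -> p.2 + al <= N (p.1 + z1).
    move=> Ap; have : al <= N (p.1 + z1) - p.2.
      by apply: ge_sup; [exact: supS.1|move=> _ [q Aq <-]; exact: cross].
    lra.
  apply: (Amax [set p | exists q t, A q /\ p = (q.1 + t *: z1, q.2 + t * al)]).
    split; first by move=> p Ap; exists p, 0; rewrite scale0r mul0r !addr0; case: p Ap.
    move=> h; apply: nz1; exists (N z0 + al - N z0).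
    have /(Al (z0, N z0) _ (-1) Az0) : A (z0 + z1, N z0 + al).
      by apply: h; exists (z0, N z0), 1; rewrite scale1r mul1r.
    by rewrite /= scaleN1r mulN1r addrA addNr add0r addrC.
  split.
  - move=> _ _ c [p [s [Ap ->]]] [q [t [Aq ->]]] /=.
    exists (c *: p.1 + q.1, c * p.2 + q.2), (c * s + t); split; first exact: Al.
    rewrite /= scalerDr scalerDl scalerA addrACA; congr pair; ring.
  - move=> _ [p [t [Ap ->]]] /=; have [t0|t0|->] := ltgtP t 0.
    + have := low _ (graph_scale (- t)^-1 gA Ap); rewrite /=.
      have t0' : 0 < - t by rewrite oppr_gt0.
      have -> : (- t)^-1 *: p.1 - z1 = (- t)^-1 *: (p.1 + t *: z1).
        by rewrite scalerDr scalerA invrN mulNr mulVf ?lt_eqF// scaleN1r.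
      rewrite (cnorm_scale hN) gtr0_norm ?invr_gt0// [_^-1 * N _]mulrC ler_pdivlMr//.
      by rewrite mulrBl mulrAC mulVf ?mul1r ?gt_eqF// mulrN opprK mulrC.
    + have := up _ (graph_scale t^-1 gA Ap); rewrite /=.
      have -> : t^-1 *: p.1 + z1 = t^-1 *: (p.1 + t *: z1).
        by rewrite scalerDr scalerA mulVf ?gt_eqF// scale1r.
      rewrite (cnorm_scale hN) gtr0_norm ?invr_gt0// [_^-1 * N _]mulrC ler_pdivlMr//.
      by rewrite mulrDl mulrAC mulVf ?mul1r ?gt_eqF// [al * t]mulrC.
    + by rewrite scale0r mul0r !addr0; exact: Ad.
  - by move=> _; exists (z0, N z0), 0; rewrite scale0r mul0r !addr0.
have /choice[L hL] := total.
exists L; split.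
- move=> c x y; apply: (graph_fun gA (hL _)).
  exact: (Al (x, L x) (y, L y) c (hL x) (hL y)).
- move=> x; rewrite ler_norml; apply/andP; split; last exact: (Ad _ (hL x)).
  have := Ad _ (graph_scale (-1) gA (hL x)); rewrite /= scaleN1r mulN1r (cnormN hN).
  by rewrite lerNl.
- exact: (graph_fun gA (hL _) Az0).
Qed.

End hahn_banach.

(** * Equivalence with the product norm and norming sequences *)

Section product_norm.
Context (R : realType) (X : completeNormedModType R) (k : nat).
Context (N : X * 'rV[R]_k -> R).
Hypotheses (hN : complete_norm N)
  (hN0 : forall w : nat -> X * 'rV[R]_k,
     N (w n) @[n --> \oo] --> (0 : R) ->
     (`|(w n).1| @[n --> \oo] --> (0 : R)) /\
     (enorm (w n).2 @[n --> \oo] --> (0 : R))).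
Implicit Types z : X * 'rV[R]_k.

(** If no constant worked, vectors with [n.+1 * N z < p z], normalised to [p = 1], would tend to 0
    for [N] but not for [p]. *)
Let dominated (p : X * 'rV[R]_k -> R) :
  (forall a z, p (a *: z) = `|a| * p z) -> (forall z, 0 <= p z) ->
  (forall w : nat -> X * 'rV[R]_k, N (w n) @[n --> \oo] --> (0 : R) ->
     p (w n) @[n --> \oo] --> (0 : R)) ->
  exists2 K, 0 < K & forall z, p z <= K * N z.
Proof.
move=> pZ p0 pcvg; apply: contrapT => H.
have /choice[z hz] : forall n : nat, exists z, n.+1%:R * N z < p z.
  move=> n; apply: contrapT => H'; apply: H; exists n.+1%:R => // z.
  by rewrite leNgt; apply/negP => h; apply: H'; exists z.
have pz n : 0 < p (z n) by apply: le_lt_trans (hz n); rewrite mulr_ge0// (cnorm_ge0 hN).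
pose w n := (p (z n))^-1 *: z n.
have : p (w n) @[n --> \oo] --> (0 : R).
  apply: pcvg; apply: (@squeeze_cvgr _ _ _ _ (fun=> 0) harmonic).
  - near=> n; rewrite (cnorm_ge0 hN)/= /w (cnorm_scale hN) gtr0_norm ?invr_gt0//.
    rewrite mulrC ler_pdivrMr// -ler_pdivrMl ?invr_gt0// invrK.
    exact: ltW.
  - exact: cvg_cst.
  - exact: cvg_harmonic.
rewrite (_ : (fun n => _) = fun=> 1); last first.
  by apply/funext => n; rewrite /w pZ gtr0_norm ?invr_gt0// mulVf// gt_eqF.
move=> h; have h1 : (1 : R) @[_ --> \oo] --> (1 : R) by exact: cvg_cst.
have e01 : (0 : R) = 1 by exact: (cvg_unique (@norm_hausdorff _ _) h h1).
by have := oner_eq0 R; rewrite -e01 eqxx.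
Unshelve. all: by end_near. Qed.

Lemma enorm_scale (a : R) (c : 'rV[R]_k) : enorm (a *: c) = `|a| * enorm c.
Proof.
rewrite /enorm -sqrtr_sqr -sqrtrM ?sqr_ge0// mulr_sumr; congr Num.sqrt.
by apply: eq_bigr => i _; rewrite mxE exprMn.
Qed.

Lemma coord_enorm (c : 'rV[R]_k) i : `|c ord0 i| <= enorm c.
Proof.
rewrite /enorm -sqrtr_sqr ler_wsqrtr// (bigD1 i)//= lerDl.
by apply: sumr_ge0 => j _; exact: sqr_ge0.
Qed.

Lemma norm_lower : exists2 K, 0 < K &
  forall z, `|z.1| <= K * N z /\ forall i, `|z.2 ord0 i| <= K * N z.
Proof.
have [||w hw|K1 K10 hK1] := dominated (p := fun z => `|z.1|).
- by move=> a z; rewrite normrZ.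
- by move=> z; exact: normr_ge0.
- exact: (hN0 hw).1.
have [||w hw|K2 K20 hK2] := dominated (p := fun z => enorm z.2).
- by move=> a z; exact: enorm_scale.
- by move=> z; exact: sqrtr_ge0.
- exact: (hN0 hw).2.
exists (K1 + K2) => [|z]; first exact: addr_gt0.
split=> [|i]; rewrite mulrDl.
  by apply: ler_wpDr (hK1 z); rewrite mulr_ge0 ?(cnorm_ge0 hN)// ltW.
rewrite (le_trans (coord_enorm _ _))// ler_wpDl// mulr_ge0 ?(cnorm_ge0 hN)//.
exact: ltW.
Qed.

(** [N] is complete on the subspace [X * {0}], because the second component of an [N]-limit is the
    limit of the second components. There it dominates the norm of [X], so the open mapping argument
    applies. *)
Let norm_fst : exists2 C, 0 < C & forall x, N (x, 0) <= C * `|x|.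
Proof.
have [K K0 hK] := norm_lower.
apply: (@complete_norm_bound _ _ (fun x => N (x, 0)) K); last first.
  by move=> x; have [] := hK (x, 0).
have pD (x y : X) : (x + y, 0) = (x, 0) + (y, 0) :> X * 'rV[R]_k.
  by congr pair; rewrite addr0.
split.
- by move=> x y; rewrite pD; exact: (cnorm_triangle hN).
- move=> c x; rewrite -(cnorm_scale hN); congr N; congr pair.
  by rewrite scaler0.
- by move=> x /(cnorm_eq0 hN) [].
- move=> w hw; have [e e0|[l c] hl] := cnorm_complete hN (w := fun n => (w n, 0)).
    have [n0 hn] := hw e e0; exists n0 => m n mn nn.
    have -> : (w m, 0) - (w n, 0) = (w m - w n, 0) :> X * 'rV[R]_k.
      by congr pair; rewrite subr0.
    exact: hn.
  have c0 : c = 0.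
    have [_] := hN0 hl; rewrite /= => h; have h' : enorm (0 - c) = 0.
      exact: (cvg_unique (@norm_hausdorff _ _) (cvg_cst _) h).
    apply/rowP => i; rewrite mxE; apply/eqP; rewrite -normr_le0 -normrN -h'.
    by apply: le_trans (coord_enorm _ i); rewrite !mxE add0r.
  exists l; rewrite (_ : (fun n => _) = (fun n => N ((w n, 0) - (l, c))))//.
  by apply/funext => n; congr N; rewrite c0; congr pair; rewrite subr0.
Qed.

Lemma norm_upper : exists2 C, 0 < C &
  forall z e, `|z.1| <= e -> (forall i, `|z.2 ord0 i| <= e) -> N z <= C * e.
Proof.
have [C C0 hC] := norm_fst.
pose D := \sum_(i < k) N (0, delta_mx ord0 i).
have D0 : 0 <= D by apply: sumr_ge0 => i _; exact: cnorm_ge0.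
exists (C + D) => [|[x c] e /= xe ce]; first by rewrite ltr_wpDr.
have -> : (x, c) = (x, 0) + (0, c) by congr pair; rewrite ?addr0 ?add0r.
rewrite (le_trans (cnorm_triangle hN _ _))// mulrDl lerD//.
  by rewrite (le_trans (hC x))// ler_pM2l.
have -> : (0, c) = \sum_(i < k) c ord0 i *: (0, delta_mx ord0 i) :> X * 'rV[R]_k.
  transitivity ((0 : X), \sum_(i < k) c ord0 i *: (delta_mx ord0 i : 'rV[R]_k)).
    by rewrite -row_sum_delta.
  elim/big_rec2 : _ => [//|i y1 y2 _ <-].
  rewrite [RHS](_ : _ = (c ord0 i *: 0 + 0, c ord0 i *: delta_mx ord0 i + y2))//.
  by rewrite scaler0 addr0.
apply: (@le_trans _ _ (\sum_(i < k) N (c ord0 i *: (0, delta_mx ord0 i)))).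
  elim/big_rec2 : _ => [|i y1 y2 _ h]; first by rewrite (cnorm0 hN).
  by rewrite (le_trans (cnorm_triangle hN _ _))// lerD2l.
rewrite mulrC mulr_sumr; apply: ler_sum => i _.
by rewrite (cnorm_scale hN) ler_wpM2r// cnorm_ge0.
Qed.

Hypothesis hX : separable X.

Lemma dense_seq : exists z : nat -> X * 'rV[R]_k,
  forall w e, 0 < e -> exists n, N (w - z n) < e.
Proof.
have [D /countable_injP[f fD] dD] := hX.
pose e (n : nat) := xget 0 [set x | D x /\ f x = n].
have ef x : D x -> e (f x) = x.
  move=> Dx; rewrite /e; case: xgetP => [y _ [Dy fy]|/(_ x)[]//].
  by apply: fD => //; rewrite inE.
have [C C0 hC] := norm_upper.
pose g (p : nat * 'rV[rat]_k) : X * 'rV[R]_k := (e p.1, map_mx ratr p.2).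
exists (fun n => oapp g 0 (unpickle n)) => -[x c] d d0.
pose r := d / C / 2; have r0 : 0 < r by rewrite !divr_gt0.
have [y [yr Dy]] : ball x r `&` D !=set0.
  apply: dD; [by exists x; exact: ballxx|exact: ball_open].
have /choice[q hq] : forall i : 'I_k, exists q : rat, `|c ord0 i - ratr q| <= r.
  move=> i; have [|q] := @rat_in_itvoo _ (c ord0 i - r) (c ord0 i + r).
    by rewrite ltrBlDr -addrA ltrDl addr_gt0.
  rewrite in_itv/= => /andP[h1 h2]; exists q; rewrite ler_distl.
  by rewrite lerBlDr (ltW h2)/= -lerBlDr ltW.
exists (pickle (f y, \row_i q i)); rewrite pickleK /= /g/= ef//.
apply: (@le_lt_trans _ _ (C * r)).
  apply: hC => [|i] /=; first by rewrite ltW//; move: yr; rewrite -ball_normE.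
  by rewrite !mxE; exact: hq.
by rewrite /r mulrA mulrCA divff ?gt_eqF// mulr1 ltr_pdivrMr// mulr_natr mulr2n ltrDl.
Qed.

(** Norming functionals at the points of a dense sequence suffice: each has [N]-norm at most 1, so
    an error [e / 2] in the point costs at most [e] in the bound. *)
Lemma norming_seq : exists L : nat -> X * 'rV[R]_k -> R,
  [/\ (forall i c x y, L i (c *: x + y) = c * L i x + L i y),
      (forall i z, `|L i z| <= N z) &
      (forall z d, (forall i, `|L i z| <= d) -> N z <= d)].
Proof.
have [z hz] := dense_seq.
have /choice[L hL] : forall n, exists L : X * 'rV[R]_k -> R,
    [/\ (forall c x y, L (c *: x + y) = c * L x + L y),
      (forall x, `|L x| <= N x) & L (z n) = N (z n)].
  by move=> n; exact: norming_functional.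
exists L; split=> [i|i|w d hw]; [by have [] := hL i|by have [] := hL i|].
apply/ler_addgt0Pr => e e0; have e2 : 0 < e / 2 by rewrite divr_gt0.
have [n hn] := hz w _ e2; have [Ll LN Lz] := hL n.
have h1 : N w <= N (w - z n) + N (z n) by rewrite -{1}(subrK (z n) w) cnorm_triangle.
have h2 : L n (z n) = L n w - L n (w - z n).
  have := Ll (-1) (w - z n) w; rewrite scaleN1r opprB subrK mulN1r => ->.
  by rewrite addrC.
have := LN (w - z n); have := hw n; rewrite !ler_norml => /andP[_ h3] /andP[h4 _].
move: h1; rewrite -Lz h2; lra.
Qed.

End product_norm.

(** * Masses of small balls *)

Lemma dual_bounded (R : realType) (X : completeNormedModType R) (f : X -> R) :
  dual f -> exists2 C, 0 < C & forall x, `|f x| <= C * `|x|.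
Proof.
move=> df; have /cvgrPdist_lt/(_ 1 ltr01)/nbhs_ballP[r /= r0 rf] := df.2 0.
exists (2 / r) => [|x]; first by rewrite divr_gt0.
have [->|xN0] := eqVneq x 0; first by rewrite (dual0 df) !normr0 mulr0.
have x0 : 0 < `|x| by rewrite normr_gt0.
pose t := r / 2 / `|x|; have t0 : 0 < t by rewrite !divr_gt0.
have : ball (0 : X) r (t *: x).
  rewrite -ball_normE/= sub0r normrN normrZ gtr0_norm// /t divfK ?gt_eqF//.
  by rewrite ltr_pdivrMr// mulr_natr mulr2n ltrDl.
move=> /rf /=; rewrite (dual0 df) sub0r normrN (dualZ _ _ df) normrM gtr0_norm//.
rewrite mulrC -ltr_pdivlMr// => /ltW/le_trans; apply.
by rewrite le_eqVlt; apply/orP; left; apply/eqP; rewrite /t; field; rewrite !gt_eqF.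
Qed.

Lemma le_fine_ratio (R : realType) (e : R) (x y : \bar R) :
  x \is a fin_num -> y \is a fin_num -> 0 < fine y ->
  (e%:E * y <= x)%E -> e <= fine x / fine y.
Proof.
case: x y => [x||] [y||] // _ _ /= y0; rewrite -EFinM lee_fin.
by rewrite ler_pdivlMr.
Qed.

Lemma ge_fine_ratio (R : realType) (e : R) (x y : \bar R) :
  x \is a fin_num -> y \is a fin_num -> 0 < fine y ->
  ((expR e)%:E * x <= y)%E -> fine x / fine y <= expR (- e).
Proof.
case: x y => [x||] [y||] // _ _ /= y0; rewrite -EFinM lee_fin.
by rewrite ler_pdivrMr// expRN ler_pdivlMl ?expR_gt0.
Qed.

Lemma cm_norm_ge0 (R : realType) (X : completeNormedModType R)
    (mu : probability (borel X) R) (h : X) : (0 <= cm_norm mu h)%E.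
Proof.
have [l cl lE] := dual_linear (dual_cst0 (R := R) X).
apply: ereal_sup_ubound; exists l; last by rewrite lE normr0.
split=> //=; under eq_integral do rewrite lE expr0n/=.
by rewrite integral0.
Qed.

Lemma cm_space0 (R : realType) (X : completeNormedModType R)
  (mu : set (borel X) -> \bar R) : cm_space mu 0.
Proof.
apply: (@le_lt_trans _ _ 0%E); last exact: ltry.
by apply: ge_ereal_sup => _ [l _ <-]; rewrite linear0 normr0.
Qed.

(** * Balls under the product of the Gaussian and Lebesgue measures *)

Section small_ball.
Context (R : realType) (X : completeNormedModType R) (k : nat).
Context (N : X * 'rV[R]_k -> R) (hN : complete_norm N).
Context (mu : probability (borel X) R) (hmu : centred_gaussian mu).
Context (L : nat -> X * 'rV[R]_k -> R) (K C : R).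
Hypotheses
  (Ll : forall i c x y, L i (c *: x + y) = c * L i x + L i y)
  (LN : forall i z, `|L i z| <= N z)
  (LNn : forall z d, (forall i, `|L i z| <= d) -> N z <= d)
  (K0 : 0 < K)
  (NK : forall z, `|z.1| <= K * N z /\ forall i, `|z.2 ord0 i| <= K * N z)
  (C0 : 0 < C)
  (NC : forall (z : X * 'rV[R]_k) e, `|z.1| <= e -> (forall i, `|z.2 ord0 i| <= e) -> N z <= C * e).
Implicit Types (u x : X) (a c : 'rV[R]_k) (d : R).

Let l i x := L i (x, 0).
Let p i c := L i (0, c).

Let LE i x c : L i (x, c) = l i x + p i c.
Proof.
rewrite /l /p -[L i (x, 0)]mul1r -Ll scale1r; congr (L i).
by rewrite [RHS](_ : _ = (x + 0, 0 + c))// addr0 add0r.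
Qed.

Let L0 i : L i 0 = 0.
Proof. by have := Ll i (-1) 0 0; rewrite scaler0 addr0 mulN1r addNr. Qed.

Let pl i b c c' : p i (b *: c + c') = b * p i c + p i c'.
Proof.
rewrite /p -Ll; congr (L i).
by rewrite [RHS](_ : _ = (b *: 0 + 0, b *: c + c'))// scaler0 addr0.
Qed.

Let pN i c : p i (- c) = - p i c.
Proof.
have := pl i (-1) c 0; rewrite scaleN1r addr0 mulN1r => ->.
by rewrite /p -[(0, 0)]/(0 : X * 'rV[R]_k) L0 addr0.
Qed.

Let pB i c a : p i (c - a) = p i c - p i a.
Proof. by rewrite addrC -scaleN1r pl mulN1r addrC. Qed.

Lemma dual_fst i : dual (fun x => L i (x, 0)).
Proof.
rewrite -[fun x => _]/(l i).
have lin b x y : l i (b *: x + y) = b * l i x + l i y.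
  rewrite /l -Ll; congr (L i).
  by rewrite [RHS](_ : _ = (b *: x + y, b *: 0 + 0))// scaler0 addr0.
split; first exact: lin.
move=> x; apply/cvgrPdist_le => e e0.
have eC : 0 < e / C by rewrite divr_gt0.
near=> y.
have -> : l i x - l i y = l i (x - y).
  by have := lin (-1) y x; rewrite scaleN1r mulN1r [- y + x]addrC [- _ + _]addrC.
apply: (le_trans (LN i _)); rewrite -[e](@divfK _ C) ?gt_eqF// mulrC; apply: NC => /=.
  by rewrite ltW//; near: y; exact: cvgr_dist_lt.
by move=> j; rewrite mxE normr0 ltW.
Unshelve. all: by end_near. Qed.

Let dl i : dual (l i) := dual_fst i.

Let mp i : measurable_fun [set: borel 'rV[R]_k] (p i : borel 'rV[R]_k -> R).
Proof.
have -> : p i = fun c => rdot (\row_j p i (delta_mx ord0 j)) c.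
  apply/funext => c; rewrite {1}[c](row_sum_delta c) /rdot.
  apply: (big_ind2 (fun (u : 'rV[R]_k) y => p i u = y)).
  - exact: L0.
  - by move=> u1 y1 u2 y2 <- <-; rewrite -[u1 in LHS]scale1r pl mul1r.
  - move=> j _; rewrite -[_ *: _]addr0 pl -/(p i 0) [p i 0](_ : _ = 0) ?addr0; last exact: L0.
    by rewrite mxE mulrC.
exact: measurable_rdot.
Qed.

Definition cball (z0 : X * 'rV[R]_k) d : set (borel X * borel 'rV[R]_k) :=
  [set z | N (z - z0) <= d].

Let LB i z w : L i (z - w) = L i z - L i w.
Proof. by rewrite addrC -scaleN1r Ll mulN1r addrC. Qed.

Let cballE z0 d : cball z0 d = [set z | forall i, `|L i z - L i z0| <= d].
Proof.
apply/seteqP; split => z /= h; last by apply: LNn => i; rewrite LB.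
by move=> i; rewrite -LB (le_trans (LN i _)).
Qed.

Lemma measurable_cball z0 d : measurable (cball z0 d).
Proof.
rewrite cballE (_ : [set z | _] =
    \bigcap_i ((fun z => `|L i z - L i z0|) @^-1` `]-oo, d])); last first.
  apply/seteqP; split => [z h i _|z h i]; first by rewrite /= in_itv/=; exact: h.
  by have := h i Logic.I; rewrite /= in_itv.
apply: bigcapT_measurable => i; rewrite -[X in measurable X]setTI.
have m : measurable_fun [set: borel X * borel 'rV[R]_k] (fun z => `|L i z - L i z0|).
  apply: measurableT_comp => //; apply: measurable_funB => //.
  rewrite (_ : L i = (fun z => l i z.1 + p i z.2)); last first.
    by apply/funext => -[x c]; rewrite LE.
  apply: measurable_funD.
    exact: (measurableT_comp (measurable_dual (dl i)) measurable_fst).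
  exact: (measurableT_comp (mp i) measurable_snd).
exact: m.
Qed.

(** Section at height [c] of the closed ball at [(u, 0)]. The height only moves the centres of the
    strip, in general to values that no point of [X] realises. *)
Let slice d u c := strip l (fun i => l i u - p i c) (fun=> d).

Let ysection_cball u a d c : ysection (cball (u, a) d) c = slice d u (c - a).
Proof.
apply/seteqP; split => x; rewrite /ysection /= inE cballE /= => h i.
  by have := h i; rewrite !LE pB; congr (`|_| <= _); ring.
by have := h i; rewrite !LE pB; congr (`|_| <= _); ring.
Qed.

Local Notation leb := (leb_rV R k).

Let measurable_slice d u : measurable_fun [set: borel 'rV[R]_k] (fun c => mu (slice d u c)).
Proof.
have -> : (fun c => mu (slice d u c)) = mu \o ysection (cball (u, 0) d).
  by apply/funext => c /=; rewrite ysection_cball subr0.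
by apply: measurable_fun_ysection; exact: measurable_cball.
Qed.

(** Mass of a closed ball centred over [u]. The second component of the centre is absent by
    translation invariance of Lebesgue measure, as [measure_cball] shows. *)
Definition bmass d u : \bar R := (\int[leb]_c mu (slice d u c))%E.

Lemma measure_cball u a d : (mu \x leb)%E (cball (u, a) d) = bmass d u.
Proof.
have mB := @measurable_cball (u, a) d.
have -> : ((mu \x leb) (cball (u, a) d) = \int[leb]_c mu (ysection (cball (u, a) d) c))%E.
  have := indic_fubini_tonelli mu leb mB.
  by rewrite (indic_fubini_tonelli_FE leb mB) (indic_fubini_tonelli_GE mu mB).
under eq_integral do rewrite ysection_cball.
exact: (leb_rV_shift (- a) (measurable_slice d u)).
Qed.

Let sliceP d u c x : slice d u c x <-> N (x - u, c) <= d.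
Proof.
have E i : L i (x - u, c) = l i x - (l i u - p i c).
  by rewrite LE (dualB _ _ (dl i)) opprB addrA addrAC.
split=> [h|h i]; first by apply: LNn => i; rewrite E; exact: h.
by rewrite -E (le_trans (LN i _)).
Qed.

Lemma bmass_lty d u : (bmass d u < +oo)%E.
Proof.
apply: le_lt_trans (@leb_rV_box R k (K * d)).
rewrite -(setIT (box_rV _)) -integral_indic//; last exact: measurable_box_rV.
apply: ge0_le_integral => //.
  apply/measurable_EFinP; apply: measurable_indic; exact: measurable_box_rV.
move=> c _; rewrite indicE; have [cb|cb] := boolP (c \in _).
  by apply: probability_le1; exact: measurable_strip.
rewrite (_ : slice d u c = set0) ?measure0//; apply/seteqP; split => // x /sliceP h.
case/negP: cb; rewrite inE => i; have [_ /(_ i) /= hi] := NK (x - u, c).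
by apply: le_trans hi _; rewrite ler_pM2l.
Qed.

Let bmass_fin d u : bmass d u \is a fin_num.
Proof. by rewrite ge0_fin_numE ?bmass_lty//; exact: integral_ge0. Qed.

Let slice_opp d u c : mu (slice d (- u) c) = mu (slice d u (- c)).
Proof.
rewrite /slice -[RHS](strip_opp hmu dl); congr (mu (strip _ _ _)).
by apply/funext => i; rewrite (dualN _ (dl i)) pN opprK opprD.
Qed.

Let bmass_opp d u : bmass d (- u) = bmass d u.
Proof.
rewrite /bmass; under eq_integral do rewrite slice_opp.
exact: (leb_rV_opp (measurable_slice d u)).
Qed.

(** On [X], sections at heights [c] and [c'] of the balls at [u] and [- u] have their midpoints in
    the section at height [(c + c') / 2] of the ball at the origin. [strip_prekopa] thus yields the
    hypothesis of Prekopa-Leindler for the section masses as functions of the height. The balls at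
    [u] and [- u] have equal mass, so a square root halves the exponent. *)
Lemma bmass_upper (f : X -> R) Cf d u r : dual f -> var mu f <= 1 ->
  0 <= Cf -> (forall x c, `|f x| <= Cf * N (x, c)) -> 0 <= r -> r <= `|f u| - Cf * d ->
  ((expR (r ^+ 2 / 2))%:E * bmass d u <= bmass d 0%R)%E.
Proof.
move=> df vf Cf0 fC r0 rf.
pose l' i := if i is j.+1 then l j else f.
have dl' i : dual (l' i) by case: i => [|i] //=; exact: dl.
pose cc v (c : 'rV[R]_k) i := if i is j.+1 then l j v - p j c else f v.
pose dd i := if i is j.+1 then d else Cf * d.
(* Prepending [f] with half-width [Cf * d] leaves the sections unchanged, since points of the ball
   satisfy this constraint anyway. *)
have sliceE v c : slice d v c = strip l' (cc v c) dd.
  apply/seteqP; split => x h; last by move=> i; exact: (h i.+1).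
  case=> [|i]; last exact: h.
  rewrite /= -(dualB _ _ df) (le_trans (fC _ c))// ler_wpM2l//.
  exact/sliceP.
pose mid c c' : 'rV[R]_k := 2^-1 *: (c + c').
have sub c c' : strip l' (fun i => 2^-1 * (cc u c i + cc (- u) c' i)) dd `<=`
    strip l' (cc 0 (mid c c')) dd.
  move=> x h [|i]; [have /= := h 0%N|have /= := h i.+1].
    by rewrite (dualN _ df) subrr mulr0 (dual0 df).
  rewrite (dualN _ (dl i)) (dual0 (dl i)) /mid -[_ *: (c + c')]addr0 pl.
  have -> : p i 0 = 0 by exact: L0.
  by rewrite -[c in X in _ -> X]scale1r pl; congr (`|_| <= _); field.
have key c c' : ((expR (r ^+ 2))%:E * mu (slice d u c) * mu (slice d (- u)%R c') <=
    mu (slice d 0%R (mid c c')) * mu (slice d 0%R (mid c c')))%E.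
  rewrite -muleA !sliceE.
  have r2 : 0 <= 2 * r by rewrite mulr_ge0.
  have rc : 2 * r <= `|cc u c 0%N - cc (- u) c' 0%N| - 2 * dd 0%N.
    rewrite /= (dualN _ df) (_ : f u - - f u = 2 * f u); last by ring.
    rewrite normrM ger0_norm//.
    by rewrite -mulrBr ler_pM2l.
  have := strip_prekopa hmu dl' vf r2 rc.
  (* Along [f] the centres at [u] and [- u] differ by [2 * f u], so the strips are at least [2 * r]
     apart. *)
  rewrite (_ : (2 * r) ^+ 2 / 4 = r ^+ 2); last by field.
  move/le_trans; apply; apply: lee_pmul => //.
    by apply: le_measure; rewrite ?inE; [exact: measurable_strip|exact: measurable_strip|exact: sub].
  by apply: le_measure; rewrite ?inE; [exact: measurable_strip|exact: measurable_strip|exact: sub].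
have e2 : (0 <= (expR (r ^+ 2))%:E :> \bar R)%E by rewrite lee_fin expR_ge0.
have m0 v := measurable_slice d v.
have ge0 v (c : borel 'rV[R]_k) : (0 <= mu (slice d v c))%E by [].
have := prekopa_leindler_rV (measurable_funeM (expR (r ^+ 2))%:E (m0 u)) (m0 (- u)) (m0 0)
  (fun c => mule_ge0 e2 (ge0 u c)) (ge0 (- u)) (ge0 0) key.
rewrite (ge0_integralZl leb measurableT (m0 u) (fun c _ => ge0 u c) e2).
rewrite -/(bmass d u) -/(bmass d (- u)) -/(bmass d 0) bmass_opp.
rewrite -[bmass d u]fineK// -[bmass d 0]fineK// -!EFinM !lee_fin.
have w0 v : 0 <= fine (bmass d v) by rewrite fine_ge0//; exact: integral_ge0.
have E : expR (r ^+ 2) = expR (r ^+ 2 / 2) * expR (r ^+ 2 / 2).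
  by rewrite -expRD; congr expR; field.
have := w0 u; have := w0 0; have := expR_gt0 (r ^+ 2 / 2); rewrite E.
move: (expR _) (fine (bmass d u)) (fine _) => e a b e0 b0 a0 h.
by rewrite -ler_sqr ?nnegrE ?mulr_ge0 ?(ltW e0)// !expr2 mulrACA mulrA.
Qed.

Lemma bmass_lower d u : cm_space mu u ->
  ((expR (- (fine (cm_norm mu u) ^+ 2 / 2)))%:E * bmass d 0%R <= bmass d u)%E.
Proof.
move=> Eu; set e := expR _.
have key c : ((2 * e)%:E * mu (slice d 0%R c) <= mu (slice d u c) + mu (slice d (- u)%R c))%E.
  have := strip_shift hmu dl (fun i => l i 0 - p i c) (fun=> d) Eu.
  move/le_trans; apply; rewrite le_eqVlt; apply/orP; left; apply/eqP.
  congr (mu (strip _ _ _) + mu (strip _ _ _))%E.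
    by apply/funext => i; rewrite (dual0 (dl i)) add0r addrC.
  by apply/funext => i; rewrite (dual0 (dl i)) (dualN _ (dl i)) add0r addrC.
have e2 : (0 <= (2 * e)%:E :> \bar R)%E by rewrite lee_fin mulr_ge0// expR_ge0.
have m0 v := measurable_slice d v.
have ge0 v (c : borel 'rV[R]_k) : (0 <= mu (slice d v c))%E by [].
have : (\int[leb]_c ((2 * e)%:E * mu (slice d 0%R c)) <=
    \int[leb]_c (mu (slice d u c) + mu (slice d (- u)%R c)))%E.
  apply: ge0_le_integral => //.
  - by move=> c _; exact: mule_ge0.
  - exact: measurable_funeM.
  - exact: emeasurable_funD.
rewrite (ge0_integralD leb measurableT (fun c _ => ge0 u c) (m0 u) (fun c _ => ge0 (- u) c) (m0 (- u))).
rewrite (ge0_integralZl leb measurableT (m0 0) (fun c _ => ge0 0 c) e2).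
rewrite -/(bmass d u) -/(bmass d (- u)) -/(bmass d 0) bmass_opp.
rewrite -[bmass d u]fineK// -[bmass d 0]fineK// -!EFinM -EFinD !lee_fin.
lra.
Qed.

Hypothesis zd : exists z : nat -> X * 'rV[R]_k,
  forall w e, 0 < e -> exists n, N (w - z n) < e.

Local Notation M := (mu \x leb)%E.

(** [bmass_upper] with [f = 0] and [r = 0] says that balls at the origin are the heaviest. Were they
    null, all balls of radius [d] would be, yet countably many of them cover a space of positive
    mass. *)
Lemma bmass_gt0 d : 0 < d -> (0 < bmass d 0%R)%E.
Proof.
move=> d0; have [z hz] := zd.
have b0 v : (0 <= bmass d v)%E by exact: integral_ge0.
rewrite lt_neqAle b0 andbT; apply/negP => /eqP bd.
have bz u : bmass d u = 0%E.
  apply/eqP; rewrite eq_le b0 andbT [leRHS]bd.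
  have v0 : var mu (fun=> 0 : R) <= 1.
    by rewrite /var; under eq_Rintegral do rewrite expr0n/=; rewrite Rintegral_cst// mul0r.
  have := @bmass_upper (fun=> 0) 0 d u 0 (dual_cst0 X) v0 (lexx 0).
  rewrite (_ : 0 ^+ 2 / 2 = 0 :> R) ?expR0 ?mul1e; last by rewrite expr0n mul0r.
  apply=> //.
    by move=> x c; rewrite normr0 mul0r.
  by rewrite normr0 mul0r subr0.
have : (M setT <= 0)%E.
  have -> : [set: borel X * borel 'rV[R]_k] = \bigcup_n cball (z n) d.
    apply/seteqP; split => // w _; have [n hn] := hz w d d0.
    by exists n => //; exact: ltW.
  have -> : (0 = \sum_(n <oo) M (cball (z n) d))%E.
    rewrite eseries0// => n _ _; case: (z n) => u a.
    exact: (etrans (measure_cball u a d) (bz u)).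
  apply: measure_sigma_subadditive.
  - by move=> n; exact: measurable_cball.
  - by rewrite -(_ : setT = \bigcup_n cball (z n) d)//;
      apply/seteqP; split => // w _; have [n hn] := hz w d d0; exists n => //; exact: ltW.
  - by [].
rewrite -setXTT product_measure1E//.
have -> : (mu setT * leb setT = leb setT)%E.
  by rewrite -[RHS]mul1e; congr (_ * _)%E; exact: probability_setT.
by rewrite leNgt leb_rV_setT_gt0.
Qed.

Definition oball (z0 : X * 'rV[R]_k) d : set (borel X * borel 'rV[R]_k) :=
  [set z | N (z - z0) < d].

Let oballE z0 d : oball z0 d = \bigcup_n cball z0 (d - n.+1%:R^-1).
Proof.
apply/seteqP; split => z.
  rewrite /oball /= -subr_gt0 => h.
  have [n _ /(_ n (leqnn n)) /= hn] := nbhs_infty_gtr (d - N (z - z0))^-1.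
  exists n => //; rewrite /cball /= lerBrDr -lerBrDl -[leRHS]invrK lef_pV2 ?posrE ?invr_gt0//.
  by rewrite ltW// (lt_trans hn)// ltr_nat.
by move=> [n _] /= h; apply: le_lt_trans h _; rewrite ltrBlDr ltrDl invr_gt0.
Qed.

Lemma measurable_oball z0 d : measurable (oball z0 d).
Proof. by rewrite oballE; apply: bigcupT_measurable => n; exact: measurable_cball. Qed.

(** Carries the bounds from closed to open balls. For small [n] the radius may be negative and the
    closed ball empty, which does no harm in the limit. *)
Let cvg_oball u a d : bmass (d - n.+1%:R^-1) u @[n --> \oo] --> M (oball (u, a) d).
Proof.
rewrite oballE (_ : (fun n => _) = M \o (fun n => cball (u, a) (d - n.+1%:R^-1))); last first.
  by apply/funext => n; exact/esym/measure_cball.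
apply: nondecreasing_cvg_mu.
- by move=> n; exact: measurable_cball.
- by rewrite -oballE; exact: measurable_oball.
- move=> n m nm; apply/subsetPset => z /= h; apply: le_trans h _.
  by rewrite lerD2l lerN2 lef_pV2 ?posrE// ler_nat.
Qed.

Lemma oball_gt0 u d : cm_space mu u -> 0 < d -> forall a, (0 < M (oball (u, a) d))%E.
Proof.
move=> Eu d0 a; have d2 : 0 < d / 2 by rewrite divr_gt0.
apply: (@lt_le_trans _ _ (bmass (d / 2) u)).
  apply: lt_le_trans (bmass_lower _ Eu); apply: mule_gt0; last exact: bmass_gt0.
  by rewrite lte_fin expR_gt0.
rewrite -(measure_cball u a); apply: le_measure; rewrite ?inE.
- exact: measurable_cball.
- exact: measurable_oball.
- by move=> z /= /le_lt_trans; apply; rewrite ltr_pdivrMr// mulr_natr mulr2n ltrDl.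
Qed.

Lemma oball_lty u a d : (M (oball (u, a) d) < +oo)%E.
Proof.
apply: le_lt_trans (bmass_lty d u); rewrite -(measure_cball u a).
apply: le_measure; rewrite ?inE; [exact: measurable_oball|exact: measurable_cball|].
by move=> z /= /ltW.
Qed.

Lemma oball_upper (f : X -> R) Cf d u a r : dual f -> var mu f <= 1 ->
  0 <= Cf -> (forall x c, `|f x| <= Cf * N (x, c)) -> 0 <= r -> r <= `|f u| - Cf * d ->
  ((expR (r ^+ 2 / 2))%:E * M (oball (u, a) d) <= M (oball (0%R, 0%R) d))%E.
Proof.
move=> df vf Cf0 fC r0 rf.
have c1 : ((expR (r ^+ 2 / 2))%:E * bmass (d - n.+1%:R^-1) u)%E @[n --> \oo] -->
    ((expR (r ^+ 2 / 2))%:E * M (oball (u, a) d))%E.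
  by apply: cvgeZl => //; exact: cvg_oball.
have c2 : bmass (d - n.+1%:R^-1) 0 @[n --> \oo] --> M (oball (0, 0) d) by exact: cvg_oball.
rewrite -(cvg_lim (@ereal_hausdorff R) c1) -(cvg_lim (@ereal_hausdorff R) c2).
apply: lee_lim; [by apply/cvg_ex; eexists; exact: c1|by apply/cvg_ex; eexists; exact: c2|].
near=> n; apply: (bmass_upper df vf Cf0 fC r0).
by rewrite (le_trans rf)// lerD2l lerN2 ler_wpM2l// gerBl invr_ge0.
Unshelve. all: by end_near. Qed.

Lemma oball_lower d u a : cm_space mu u ->
  ((expR (- (fine (cm_norm mu u) ^+ 2 / 2)))%:E * M (oball (0%R, 0%R) d) <= M (oball (u, a) d))%E.
Proof.
move=> Eu; set e := expR _.
have c1 : (e%:E * bmass (d - n.+1%:R^-1) 0%R)%E @[n --> \oo] --> (e%:E * M (oball (0, 0)%R d))%E.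
  by apply: cvgeZl => //; exact: cvg_oball.
have c2 : bmass (d - n.+1%:R^-1) u @[n --> \oo] --> M (oball (u, a) d) by exact: cvg_oball.
rewrite -(cvg_lim (@ereal_hausdorff R) c1) -(cvg_lim (@ereal_hausdorff R) c2).
apply: lee_lim; [by apply/cvg_ex; eexists; exact: c1|by apply/cvg_ex; eexists; exact: c2|].
by near=> n; exact: bmass_lower.
Unshelve. all: by end_near. Qed.

Lemma small_ball_ratio u a : cm_space mu u ->
  fine (M (oball (u, a) d)) / fine (M (oball (0, 0) d)) @[d --> 0^'+] -->
  expR (- (fine (cm_norm mu u) ^+ 2 / 2)).
Proof.
move=> Eu; set s := fine _.
(* The maximum with 0 extends the upper bound to negative [t], where it is the trivial one. This
   covers [s = 0], where every [t < s] is negative. *)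
pose E (t : R) := expR (- (Num.max 0 t ^+ 2 / 2)).
have E0 : cm_space mu 0 by exact: cm_space0.
have finM v b d : M (oball (v, b) d) \is a fin_num.
  by rewrite ge0_fin_numE ?oball_lty.
pose q d := fine (M (oball (u, a) d)) / fine (M (oball (0, 0) d)).
have pos d : 0 < d -> 0 < fine (M (oball (0, 0) d)).
  by move=> d0; rewrite fine_gt0// oball_lty andbT; exact: oball_gt0.
have s0 : 0 <= s by rewrite fine_ge0// cm_norm_ge0.
have lower d : 0 < d -> E s <= q d.
  move=> d0; apply: (le_fine_ratio (finM u a d) (finM 0 0 d) (pos d d0)).
  by rewrite /E (max_r s0); exact: oball_lower.
have upper_dual (f : X -> R) Cf r d : dual f -> var mu f <= 1 ->
    0 <= Cf -> (forall x c, `|f x| <= Cf * N (x, c)) -> 0 <= r -> r <= `|f u| - Cf * d ->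
    0 < d -> q d <= expR (- (r ^+ 2 / 2)).
  move=> df vf Cf0 fC r0 rd d0.
  apply: (ge_fine_ratio (finM u a d) (finM 0 0 d) (pos d d0)).
  exact: oball_upper df vf Cf0 fC r0 rd.
have v0 : var mu (fun=> 0 : R) <= 1.
  by rewrite /var; under eq_Rintegral do rewrite expr0n/=; rewrite Rintegral_cst// mul0r.
have upper t : t < s -> \forall d \near 0^'+, q d <= E t.
  move=> ts; have [t0|t0] := leP 0 t; last first.
    near=> d; rewrite /E max_l ?(ltW t0)//.
    apply: (upper_dual (fun=> 0) 0 0 d (dual_cst0 X) v0 (lexx 0)) => //.
    - by move=> x c; rewrite normr0 mul0r.
    - by rewrite normr0 mul0r subr0.
  have : (t%:E < cm_norm mu u)%E.
    by rewrite -[cm_norm mu u]fineK ?lte_fin// ge0_fin_numE// cm_norm_ge0.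
  move=> /ereal_sup_gt[_ [f [cf vf] <-]]; rewrite lte_fin => tf.
  have df : dual (f : X -> R) by split=> // b x y; rewrite linearP.
  have [Cf Cf0 fC] := dual_bounded df.
  have CK0 : 0 < Cf * K by rewrite mulr_gt0.
  have dpos : 0 < (`|f u| - t) / (Cf * K) by rewrite divr_gt0// subr_gt0.
  have vf1 : var mu f <= 1 by rewrite -lee_fin -(dual_varE hmu df).
  have fCK x c : `|f x| <= Cf * K * N (x, c).
    by rewrite (le_trans (fC x))// -mulrA ler_pM2l//; have [] := NK (x, c).
  near=> d; rewrite /E (max_r t0).
  have d0 : 0 < d by near: d; exact: nbhs_right_gt.
  have dle : d <= (`|f u| - t) / (Cf * K).
    by rewrite ltW//; near: d; exact: nbhs_right_lt.
  apply: (upper_dual f (Cf * K) t d df vf1 (ltW CK0) fCK t0 _ d0).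
  by rewrite lerBrDl -lerBrDr -ler_pdivlMl// mulrC.
(* From [1 - expR (- x) <= x] and [(s + m) / 2 <= s]; it allows one explicit [t] instead of a limit
   in [t]. *)
have Es t : t <= s -> E t - E s <= s * (s - t).
  move=> ts; pose m := Num.max 0 t.
  have m0 : 0 <= m by rewrite le_max lexx.
  have ms : m <= s by rewrite ge_max s0.
  have mt : t <= m by rewrite le_max lexx orbT.
  have Ee (x : R) : 1 - expR (- x) <= x.
    by have := expR_ge1Dx (- x); lra.
  have -> : E s = E t * expR (- ((s ^+ 2 - m ^+ 2) / 2)).
    by rewrite /E (max_r s0) -/m -expRD; congr expR; field.
  have Et1 : 0 <= E t <= 1.
    by rewrite expR_ge0/= -[leRHS]expR0 ler_expR oppr_le0 divr_ge0// sqr_ge0.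
  have := Ee ((s ^+ 2 - m ^+ 2) / 2).
  have : 0 <= s ^+ 2 - m ^+ 2 by rewrite subr_ge0 ler_sqr ?nnegrE.
  case/andP: Et1; move: (E t) (expR _) => A B A0 A1 h0 h1.
  nra.
apply/cvgrPdist_le => e e0.
(* With [t = s - e / (s + 1)] the gap [s * (s - t)] is at most [e], also when [s = 0]. *)
have e1 : 0 < e / (s + 1) by rewrite divr_gt0// ltr_wpDl.
have tls : s - e / (s + 1) < s by rewrite gtrBl.
have Ets : E s = expR (- (s ^+ 2 / 2)) by rewrite /E (max_r s0).
rewrite -Ets; near=> d.
have d0 : 0 < d by near: d; exact: nbhs_right_gt.
have h1 := lower d d0.
have h2 : q d <= E (s - e / (s + 1)) by near: d; exact: upper.
have h3 := Es _ (ltW tls).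
rewrite ler0_norm ?subr_le0// opprB.
have : s * (e / (s + 1)) <= e.
  by rewrite mulrA ler_pdivrMr ?ltr_wpDl// mulrC ler_pM2l// lerDl.
rewrite subKr in h3; rewrite -/(q d) => h4; rewrite lerBlDl.
apply: le_trans h2 _; rewrite -lerBlDl; exact: le_trans h3 h4.
Unshelve. all: by end_near. Qed.

End small_ball.

(** * Fernique's theorem *)

Lemma rV_norm_le (R : realType) n (v : 'rV[R]_n) (b : R) :
  0 <= b -> (`|v| <= b) = [forall i, `|v ord0 i| <= b].
Proof.
move=> b0; rewrite [`|v|]mx_normrE; apply/idP/idP => [/bigmax_leP[_ h]|/forallP h].
  by apply/forallP => i; exact: (h (ord0, i)).
by apply/bigmax_leP; split => // -[i j] _ /=; rewrite (ord1 i).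
Qed.

Lemma rV_norm_coord (R : realType) n (v : 'rV[R]_n) i : `|v ord0 i| <= `|v|.
Proof.
by move: (lexx `|v|); rewrite (rV_norm_le v (normr_ge0 v)) => /forallP.
Qed.

Section fernique.
Context (R : realType) (X : completeNormedModType R).
Context (mu : probability (borel X) R) (hmu : centred_gaussian mu).
Context (l : nat -> X -> R) (nrm : X -> R).
Hypotheses (dl : forall i, dual (l i)) (nrm0 : forall x, 0 <= nrm x)
  (l_nrm : forall i x, `|l i x| <= nrm x)
  (nrm_l : forall x d, (forall i, `|l i x| <= d) -> nrm x <= d).
Implicit Types f : X -> R.

Let measurable_le f d : dual f -> measurable [set x : borel X | `|f x| <= d].
Proof.
move=> df; have m : measurable_fun [set: borel X] (fun x : borel X => `|f x|).
  by apply: measurableT_comp => //; exact: measurable_dual.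
rewrite (_ : [set x : borel X | _] = (fun x : borel X => `|f x|) @^-1` `]-oo, d]).
  by rewrite -[X in measurable X]setTI; exact: m.
by apply/seteqP; split => x /=; rewrite in_itv.
Qed.

(** A normal density is at most its peak, so mass one half on [[- r, r]] gives
    [1 <= 4 * r * normal_peak s]. Squaring produces the 16, and [normal_peak s ^+ 2 * s ^+ 2 <= 1]
    finishes. *)
Lemma var_small_ball f r : dual f -> 0 < r ->
  (2^-1%:E <= mu [set x : borel X | (`|f x| <= r)%R])%E -> var mu f <= 16 * r ^+ 2.
Proof.
move=> df r0; have [s -> hs] := dual_law_var hmu df.
have [->|s0] := eqVneq s 0; first by move=> _; rewrite expr0n mulr_ge0// sqr_ge0.
pose A : set R := `[- r, r]%classic.
have mA : measurable A by exact: measurable_itv.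
have mI : measurable_fun [set: R] (fun x : R => (\1_A x)%:E : \bar R).
  by apply/measurable_EFinP; exact: measurable_indic.
have I0 (x : R) : (0 <= (\1_A x)%:E :> \bar R)%E by rewrite lee_fin indicE.
have -> : mu [set x : borel X | `|f x| <= r] = (\int[normal_prob 0 s]_x (\1_A x)%:E)%E.
  have := hs _ mI I0; rewrite (negbTE s0) => <-.
  rewrite -[X in mu X = _]setIT -integral_indic//; last exact: measurable_le.
  apply: eq_integral => x _; congr EFin; rewrite !indicE; congr (nat_of_bool _)%:R.
  by apply/idP/idP; rewrite !inE /A /= in_itv/= ler_norml.
rewrite (integral_normal_prob s mI I0).
have le1 : (\int[lebesgue_measure]_x ((\1_A x)%:E * (normal_pdf 0 s x)%:E) <=
    \int[lebesgue_measure]_x ((normal_peak s)%:E * (\1_A x)%:E))%E.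
  apply: ge0_le_integral => //.
  - by move=> x _; rewrite mule_ge0// lee_fin normal_pdf_ge0.
  - by apply: emeasurable_funM => //; apply/measurable_EFinP; exact: measurable_normal_pdf.
  - by apply: emeasurable_funM => //.
  - by move=> x _; rewrite muleC lee_wpmul2r// lee_fin normal_pdf_ub.
move=> /le_trans/(_ le1).
rewrite ge0_integralZl//; last by rewrite lee_fin normal_peak_ge0.
have -> : (\int[lebesgue_measure]_x (\1_A x)%:E = (r + r)%:E :> \bar R)%E.
  have mAr : (@lebesgue_measure R A = (r + r)%:E)%E.
    by rewrite /A lebesgue_measure_itv/= lte_fin gtrN// -EFinB opprK.
  by rewrite integral_indic// setIT; exact: mAr.
rewrite -EFinM lee_fin.
have p0 := normal_peak_gt0 s0; have pE : normal_peak s ^+ 2 * (s ^+ 2 * pi * 2) = 1.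
  rewrite /normal_peak exprVn sqr_sqrtr; last by rewrite mulrn_wge0// mulr_ge0 ?sqr_ge0// pi_ge0.
  by rewrite -mulr_natr mulVf// !mulf_neq0 ?expf_neq0// ?gt_eqF// pi_gt0.
move=> h; have pi2 := pi_ge2 R.
have h2 : 1 <= 16 * (normal_peak s ^+ 2 * r ^+ 2).
  by move: (normal_peak s) p0 h => q q0 h; nra.
have s20 : 0 <= s ^+ 2 := sqr_ge0 s.
have p20 : 0 < normal_peak s ^+ 2 by rewrite exprn_gt0.
rewrite -(ler_pM2l p20).
have : normal_peak s ^+ 2 * s ^+ 2 <= 1 by move: (normal_peak s ^+ 2) (s ^+ 2) pE p20 s20 => a b; nra.
by move=> h3; apply: le_trans h3 _; rewrite mulrCA.
Qed.

(** Prekopa-Leindler for the indicator of a box of mass at least one half, the function [G] growing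
    like a Gaussian in the excess of the norm over [r], and the constant 1. If [p] is in the box
    then [|q| - r <= sqrt (k * v)], so [G q <= expR (k / 4)], exactly the allowed factor. The bound
    is free of the number of functionals, so monotone convergence applies. *)
Lemma fernique : exists2 e : R, 0 < e &
  (\int[mu]_(x in [set: borel X]) (expR (e * nrm x ^+ 2))%:E < +oo)%E.
Proof.
(* Balls of integer radius exhaust [X], so one of them has mass at least one half; it then bounds
   all variances at once. *)
have [r r0 hr] : exists2 r : R, 0 < r & (2^-1%:E <= mu (strip l (fun=> 0%R) (fun=> r)))%E.
  apply: contrapT => H; pose S (m : nat) : set (borel X) := strip l (fun=> 0) (fun=> m.+1%:R).
  have mS m : measurable (S m) by exact: measurable_strip.
  have SU : \bigcup_m S m = setT.
    apply/seteqP; split => // x _.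
    have [m _ /(_ m (leqnn m)) /= hm] := nbhs_infty_ger (nrm x).
    exists m => // i; rewrite subr0 (le_trans (l_nrm i x))// (le_trans hm)// ler_nat.
    exact: leqnSn.
  have cv : mu (S m) @[m --> \oo] --> (1 : \bar R)%E.
    rewrite -(@probability_setT _ _ _ mu) -SU; apply: nondecreasing_cvg_mu => //.
      by rewrite SU.
    move=> a b ab; apply/subsetPset => x h i; apply: le_trans (h i) _.
    by rewrite ler_nat.
  have : (limn (mu \o S) <= 2^-1%:E)%E.
    apply: lime_le; first by apply/cvg_ex; eexists; exact: cv.
    near=> m; rewrite leNgt; apply/negP => h; apply: H; exists m.+1%:R => //.
    exact: ltW.
  by rewrite (cvg_lim (@ereal_hausdorff R) cv) lee_fin; lra.
pose v := 16 * r ^+ 2; have v0 : 0 < v by rewrite mulr_gt0// exprn_gt0.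
have lv i : var mu (l i) <= v.
  apply: var_small_ball => //; apply: le_trans hr _; apply: le_measure; rewrite ?inE.
  - exact: measurable_strip.
  - exact: measurable_le.
  - by move=> x /(_ i); rewrite subr0.
have mn n : measurable_fun [set: borel 'rV[R]_n] (fun q : borel 'rV[R]_n => `|q : 'rV[R]_n|).
  by apply: measurable_borelT; exact: norm_continuous.
have mh n : measurable_fun [set: borel X]
    (fun x : borel X => (expR (`|fam l n x| ^+ 2 / (8 * v)))%:E).
  apply/measurable_EFinP; apply: measurableT_comp => //.
  apply: measurable_funM => //; apply: measurable_funX.
  exact: (measurableT_comp (mn n) (@measurable_fam _ _ _ n dl)).
have bound n : (\int[mu]_(x in [set: borel X]) (expR (`|fam l n x| ^+ 2 / (8 * v)))%:E <=
    (2 * expR (r ^+ 2 / (4 * v)))%:E)%E.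
  pose G (q : borel 'rV[R]_n) := (expR (Num.max 0 (`|q : 'rV[R]_n| - r) ^+ 2 / (4 * v)))%:E.
  have mG : measurable_fun setT G.
    apply/measurable_EFinP; apply: measurableT_comp => //.
    apply: measurable_funM => //; apply: measurable_funX; apply: measurable_maxr => //.
    exact: measurable_funB.
  have G0 q : (0 <= G q)%E by rewrite lee_fin expR_ge0.
  pose B := @box R n (fun=> 0) (fun=> r).
  have mB : measurable_fun [set: borel 'rV[R]_n] (fun p => (\1_B p)%:E : \bar R).
    by apply/measurable_EFinP; apply: measurable_indic; exact: measurable_box.
  have B0 (p : borel 'rV[R]_n) : (0 <= (\1_B p)%:E :> \bar R)%E by rewrite lee_fin indicE.
  have FGH (p q : 'rV[R]_n) (k : R) : 0 <= k ->
      (forall i, (p ord0 i - q ord0 i) ^+ 2 <= k * v) ->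
      ((\1_B (p : borel 'rV[R]_n))%:E * G q <= (expR (k / 4))%:E * (1 * 1))%E.
    move=> k0 pq; have [pB|pB] := boolP ((p : borel 'rV[R]_n) \in B); last first.
      by rewrite indicE (negbTE pB) mul0e !mule1 lee_fin expR_ge0.
    rewrite indicE pB mul1e !mule1 /G lee_fin mul1r ler_expR.
    move: pB; rewrite inE => pB.
    have qr : `|q| <= r + Num.sqrt (k * v).
      rewrite rV_norm_le ?addr_ge0 ?sqrtr_ge0 ?(ltW r0)//; apply/forallP => i.
      have := pB i; rewrite subr0 => pi.
      rewrite -[q ord0 i](subrK (p ord0 i)) addrC (le_trans (ler_normD _ _))// lerD//.
      by rewrite distrC -sqrtr_sqr ler_wsqrtr.
    have m2 : Num.max 0 (`|q| - r) ^+ 2 <= k * v.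
      have kv0 : 0 <= k * v by rewrite mulr_ge0// ltW.
      rewrite -[leRHS](sqr_sqrtr kv0) ler_sqr ?nnegrE ?sqrtr_ge0 ?le_max ?lexx//.
      by rewrite ge_max sqrtr_ge0/= lerBlDl.
    by rewrite ler_pdivrMr ?mulr_gt0// (_ : k / 4 * (4 * v) = k * v)//; field.
  have m1 : measurable_fun [set: borel 'rV[R]_n] (cst 1%E : _ -> \bar R) by exact: measurable_cst.
  have ge1 (p : borel 'rV[R]_n) : (0 <= cst 1%E p :> \bar R)%E by exact: lee01.
  have := dual_prekopa hmu dl mB mG m1 B0 G0 ge1 (fun i => lv i) FGH.
  rewrite integral_cst// mul1e.
  have -> : (mu setT * mu setT = 1)%E.
    by rewrite -[RHS]mul1e; congr (_ * _)%E; exact: probability_setT.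
  have IF : (2^-1%:E <= \int[mu]_(x in [set: borel X]) (\1_B (fam l n x : borel 'rV[R]_n))%:E)%E.
    pose FB : set (borel X) := fam l n @^-1` B.
    have mfB : measurable FB.
      have := @measurable_fam _ _ _ n dl measurableT _ (@measurable_box R n (fun=> 0) (fun=> r)).
      by rewrite setTI.
    have -> : (\int[mu]_(x in [set: borel X]) (\1_B (fam l n x : borel 'rV[R]_n))%:E = mu FB)%E.
      by rewrite -[in RHS](setIT FB) -integral_indic.
    apply: le_trans hr _; apply: le_measure; rewrite ?inE//; first exact: measurable_strip.
    by move=> x h i; rewrite mxE; exact: h.
  move=> h; have IG : (\int[mu]_(x in [set: borel X]) G (fam l n x) <= 2%:E)%E.
    have : (2^-1%:E * \int[mu]_(x in [set: borel X]) G (fam l n x) <= 1)%E.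
      apply: le_trans h; apply: lee_wpmul2r => //; exact: integral_ge0.
    case: (\int[mu]_(x in [set: borel X]) G (fam l n x))%E => [y||_].
    - by rewrite -EFinM !lee_fin; lra.
    - by rewrite gt0_muley ?lte_fin ?invr_gt0.
    - exact: leNye.
  apply: (@le_trans _ _ ((expR (r ^+ 2 / (4 * v)))%:E * \int[mu]_(x in [set: borel X]) G (fam l n x))%E).
    have mGf : measurable_fun [set: borel X] (fun x : borel X => G (fam l n x)).
      exact: (measurableT_comp mG (@measurable_fam _ _ _ n dl)).
    have e0 : (0 <= (expR (r ^+ 2 / (4 * v)))%:E :> \bar R)%E by rewrite lee_fin expR_ge0.
    rewrite -(ge0_integralZl mu measurableT mGf (fun x _ => G0 _) e0).
    apply: ge0_le_integral => //.
    - exact: measurable_funeM.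
    - move=> x _; rewrite -EFinM lee_fin -expRD ler_expR.
      have q0 := normr_ge0 (fam l n x); move: (`|fam l n x|) q0 => q q0.
      have mm : q <= r + Num.max 0 (q - r) by rewrite -lerBlDl le_max lexx orbT.
      have : 0 <= Num.max 0 (q - r) by rewrite le_max lexx.
      move: (Num.max _ _) mm => m qm m0.
      (* [(r + m) ^+ 2 <= 2 * r ^+ 2 + 2 * m ^+ 2] is what turns the rate [4 * v] into [8 * v]. *)
      have -> : r ^+ 2 / (4 * v) + m ^+ 2 / (4 * v) = (2 * r ^+ 2 + 2 * m ^+ 2) / (8 * v).
        by field; rewrite gt_eqF.
      rewrite ler_pM2r ?invr_gt0 ?mulr_gt0//.
      by have := sqr_ge0 (r - m); nra.
  by rewrite EFinM [leRHS]muleC; apply: lee_wpmul2l => //; rewrite lee_fin expR_ge0.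
exists (8 * v)^-1; first by rewrite invr_gt0 mulr_gt0.
pose g n (x : borel X) := (expR (`|fam l n x| ^+ 2 / (8 * v)))%:E.
have mg n : measurable_fun setT (g n) by exact: mh.
have normcv x : `|fam l n x| @[n --> \oo] --> nrm x.
  apply/cvgrPdist_le => e e0.
  have up n : `|fam l n x| <= nrm x.
    by rewrite rV_norm_le//; apply/forallP => i; rewrite mxE.
  have [i hi] : exists i, nrm x - e <= `|l i x|.
    apply: contrapT => H; have : nrm x <= nrm x - e.
      by apply: nrm_l => i; rewrite leNgt; apply/negP => h; apply: H; exists i; exact: ltW.
    by rewrite leNgt ltrBlDr ltrDl e0.
  near=> n; rewrite ger0_norm ?subr_ge0// lerBlDr -lerBlDl (le_trans hi)//.
  have in_ : (i < n)%N by near: n; exact: nbhs_infty_gt.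
  by have := rV_norm_coord (fam l n x) (Ordinal in_); rewrite mxE.
have gcv x : g n x @[n --> \oo] --> (expR ((8 * v)^-1 * nrm x ^+ 2))%:E.
  apply: cvg_EFin; first by near=> n.
  apply: (@cvg_comp _ _ _ _ expR); last exact: continuous_expR.
  rewrite [_^-1 * _]mulrC; apply: cvgM; last exact: cvg_cst.
  by rewrite !expr2; apply: cvgM; exact: normcv.
have nd x : {homo g^~ x : n m / (n <= m)%N >-> (n <= m)%E}.
  move=> n m nm; rewrite lee_fin ler_expR ler_pM2r ?invr_gt0 ?mulr_gt0//.
  rewrite ler_sqr ?nnegrE// rV_norm_le//; apply/forallP => i.
  by have := rV_norm_coord (fam l m x) (widen_ord nm i); rewrite !mxE.
have g0 n x : setT x -> (0 <= g n x)%E by move=> _; rewrite lee_fin expR_ge0.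
have cv := cvg_monotone_convergence (mu := mu) measurableT mg g0 (fun x _ => nd x).
have -> : (\int[mu]_(x in [set: borel X]) (expR ((8 * v)^-1 * nrm x ^+ 2))%:E =
   \int[mu]_(x in [set: borel X]) limn (g^~ x))%E.
  by apply: eq_integral => x _; apply/esym/cvg_lim => //; exact: gcv.
apply: (@le_lt_trans _ _ (2 * expR (r ^+ 2 / (4 * v)))%:E); last exact: ltry.
rewrite -(cvg_lim (@ereal_hausdorff R) cv).
apply: lime_le; first by apply/cvg_ex; eexists; exact: cv.
by near=> n; exact: bound.
Unshelve. all: by end_near. Qed.

End fernique.

(** * The posterior *)

(** Works on the supremum over simple functions that defines the integral: [phi] comes with no joint
    measurability hypothesis and [Lam] is an arbitrary set. *)
Lemma ge0_integral_le d (T : measurableType d) (R : realType)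
    (m : {measure set T -> \bar R}) (D D' : set T) (f g : T -> \bar R) :
  D `<=` D' -> (forall x, D x -> 0 <= f x)%E -> (forall x, D' x -> 0 <= g x)%E ->
  (forall x, D x -> f x <= g x)%E ->
  (\int[m]_(x in D) f x <= \int[m]_(x in D') g x)%E.
Proof.
move=> DD' f0 g0 fg; rewrite !ge0_integralE//; apply: ereal_sup_le => _ [h hf <-].
exists h => // x; apply: le_trans (hf x) _; rewrite !patchE.
have [xD|xD] := boolP (x \in D).
  by rewrite mem_set ?fg//; [rewrite inE in xD|apply: DD'; rewrite inE in xD].
by case: ifPn => //; rewrite inE; exact: g0.
Qed.

(** * Comparison of the prior with Lebesgue measure *)

Section density_bounds.
Context (R : realType) d (T : measurableType d) (mu : probability T R) (k : nat).
Context (nu : probability (borel 'rV[R]_k) R) (rho : borel 'rV[R]_k -> R).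
Hypothesis hrho : is_density nu rho.

Let rho_lebE (A : set (borel 'rV[R]_k)) : measurable A ->
  (nu A = \int[leb_rV R k]_(a in A) (rho a)%:E)%E.
Proof. by move=> mA; have [_ _ ->//] := hrho; rewrite leb_rVE. Qed.

Lemma density_upper c (B : set (T * borel 'rV[R]_k)) : 0 <= c -> measurable B ->
  (forall z, B z -> rho z.2 <= c) ->
  ((mu \x nu) B <= c%:E * (mu \x leb_rV R k) B)%E.
Proof.
move=> c0 mB Bc; have [mrho rho0 _] := hrho.
have mx x : measurable (xsection B x) by exact: measurable_xsection.
change (\int[mu]_x nu (xsection B x) <= c%:E * \int[mu]_x leb_rV R k (xsection B x))%E.
have ms := measurable_fun_xsection (leb_rV R k) mB.
have ce : (0 <= c%:E)%E by rewrite lee_fin.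
rewrite -(ge0_integralZl mu measurableT ms _ ce)//.
apply: ge0_le_integral => //.
- exact: (measurable_fun_xsection nu mB).
- exact: measurable_funeM.
move=> x _; rewrite rho_lebE// -integral_cst//.
by apply: ge0_integral_le => // a; rewrite /xsection /= inE lee_fin => /Bc.
Qed.

Lemma density_lower c (B : set (T * borel 'rV[R]_k)) : 0 <= c -> measurable B ->
  (forall z, B z -> c <= rho z.2) ->
  (c%:E * (mu \x leb_rV R k) B <= (mu \x nu) B)%E.
Proof.
move=> c0 mB Bc; have [mrho rho0 _] := hrho.
have mx x : measurable (xsection B x) by exact: measurable_xsection.
change (c%:E * \int[mu]_x leb_rV R k (xsection B x) <= \int[mu]_x nu (xsection B x))%E.
have ms := measurable_fun_xsection (leb_rV R k) mB.
have ce : (0 <= c%:E)%E by rewrite lee_fin.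
rewrite -(ge0_integralZl mu measurableT ms _ ce)//.
apply: ge0_le_integral => //.
- by move=> x _; rewrite mule_ge0.
- exact: measurable_funeM.
- exact: (measurable_fun_xsection nu mB).
move=> x _; rewrite rho_lebE// -integral_cst//.
by apply: ge0_integral_le => // a; rewrite /xsection /= inE lee_fin => /Bc.
Qed.

End density_bounds.

(** Multiplicative errors suit the estimates below, where those of [exp (- phi)] and of [rho]
    combine by adding exponents. *)
Lemma cvg_expR_bounds (R : realType) (F : set_system R) {FF : Filter F} (f : R -> R) (A : R) :
  0 < A -> (forall e, 0 < e -> \forall d \near F, A * expR (- e) <= f d <= A * expR e) ->
  f d @[d --> F] --> A.
Proof.
move=> A0 fA; apply/cvgrPdist_le => e e0.
have : (expR t : R) @[t --> (0 : R)] --> (1 : R) by rewrite -(@expR0 R); exact: continuous_expR.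
move=> /cvgrPdist_le/(_ (e / A))[]; first by rewrite divr_gt0.
move=> r /= r0 hr.
have r2 : 0 < r / 2 by rewrite divr_gt0.
have h1 : expR (r / 2) - 1 <= e / A.
  have := hr (r / 2); rewrite /= sub0r normrN gtr0_norm//; rewrite ltr_pdivrMr// mulr_natr mulr2n ltrDl => /(_ r0).
  by rewrite ler_distlC => /andP[_]; rewrite -lerBlDl.
have h2 : 1 - expR (- (r / 2)) <= expR (r / 2) - 1.
  have := expR_ge1Dx (r / 2); have := expR_ge1Dx (- (r / 2)); lra.
near=> d.
have /andP[l1 l2] : A * expR (- (r / 2)) <= f d <= A * expR (r / 2) by near: d; exact: fA.
have h3 : A * (expR (r / 2) - 1) <= e by rewrite mulrC -ler_pdivlMr.
have h4 : A * (1 - expR (- (r / 2))) <= e by apply: le_trans h3; rewrite ler_pM2l.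
rewrite ler_distlC; apply/andP; split.
  by move: l1 h4; move: (expR _) => x; nra.
by move: l2 h3; move: (expR _) => x; nra.
Unshelve. all: by end_near. Qed.

Lemma ratio_cancel (R : realType) (p q : \bar R) (z m1 m2 m3 : R) :
  p \is a fin_num -> q \is a fin_num -> 0 < fine q -> 0 < z ->
  m1 != 0 -> m2 != 0 -> m3 != 0 ->
  ((fine p / m1 * (m1 / m3)) / (fine q / m2 * (m2 / m3)))%:E = (p / z%:E / (q / z%:E))%E.
Proof.
case: p => // p _; case: q => // q _ /= q0 z0 m10 m20 m30.
rewrite inver gt_eqF// -!EFinM inver gt_eqF ?divr_gt0//= -EFinM; congr EFin.
have q1 := lt0r_neq0 q0; have z1 := lt0r_neq0 z0.
by field; rewrite q1 z1 m10 m20 m30.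
Qed.

(** * Ratios of posterior masses *)

Section posterior_limit.
Context (R : realType) (X : completeNormedModType R) (k : nat).
Context (Lam S : set 'rV[R]_k) (N : X * 'rV[R]_k -> R).
Context (mu : probability (borel X) R) (nu : probability (borel 'rV[R]_k) R).
Context (rho : 'rV[R]_k -> R) (phi : X -> 'rV[R]_k -> R).
Hypotheses (hX : separable X) (hN : complete_norm N)
  (hN0 : forall w : nat -> X * 'rV[R]_k,
     N (w n) @[n --> \oo] --> (0 : R) ->
     (`|(w n).1| @[n --> \oo] --> (0 : R)) /\
     (enorm (w n).2 @[n --> \oo] --> (0 : R)))
  (hmu : centred_gaussian mu) (SLam : S `<=` Lam)
  (hrho : is_density nu rho) (rho_cont : {within S, continuous rho})
  (rho_pos : forall a, S° a -> 0 < rho a)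
  (phi_low : forall e, 0 < e -> exists M, forall u a, Lam a -> M - e * `|u| ^+ 2 <= phi u a)
  (phi_cont : forall u, {within Lam, continuous (phi u)})
  (phi_lip : exists M : R -> 'rV[R]_k -> R,
     (forall r, 0 <= r -> {within Lam, continuous (M r)}) /\
     forall r a u v, 0 < r -> Lam a -> `|u| < r -> `|v| < r ->
       `|phi u a - phi v a| <= M r a * `|u - v|).
Implicit Types (u v x : X) (a b c : 'rV[R]_k) (d e : R).

Local Notation leb := (leb_rV R k).
Local Notation M := (mu \x leb)%E.
Local Notation P := (mu \x nu)%E.

Let oball_theory :
  [/\ forall z0 d, measurable (oball N z0 d),
      forall u a d, cm_space mu u -> 0 < d -> (0 < M (oball N (u, a) d))%E,
      forall u a d, (M (oball N (u, a) d) < +oo)%E &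
      forall u a, cm_space mu u ->
        fine (M (oball N (u, a) d)) / fine (M (oball N (0, 0) d)) @[d --> 0^'+] -->
        expR (- (fine (cm_norm mu u) ^+ 2 / 2))].
Proof.
have [L [Ll LN LNn]] := norming_seq hN hN0 hX.
have [K K0 NK] := norm_lower hN hN0; have [C C0 NC] := norm_upper hN hN0.
have zd := dense_seq hN hN0 hX.
split.
- exact: (measurable_oball Ll LN LNn C0 NC).
- move=> u a d Eu d0; exact: (oball_gt0 hmu Ll LN LNn K0 NK C0 NC zd).
- exact: (oball_lty _ Ll LN LNn K0 NK C0 NC).
- by move=> u a; exact: (small_ball_ratio hmu Ll LN LNn K0 NK C0 NC zd).
Qed.

(** Fernique's theorem is applied to [fun x => N (x, 0)], for which norming functionals are at hand;
    [|x| <= K * N (x, 0)] transfers it at the cost of [K ^+ 2] in the rate. *)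
Let fernique_norm : exists2 e, 0 < e &
  (\int[mu]_(x in [set: borel X]) (expR (e * `|x : X| ^+ 2))%:E < +oo)%E.
Proof.
have [L [Ll LN LNn]] := norming_seq hN hN0 hX.
have [K K0 NK] := norm_lower hN hN0; have [C C0 NC] := norm_upper hN hN0.
have [e e0 he] := fernique hmu (dual_fst Ll LN C0 NC) (fun x => cnorm_ge0 hN (x, 0))
  (fun i x => LN i (x, 0)) (fun x d h => LNn (x, 0) d h).
exists (e / K ^+ 2); first by rewrite divr_gt0// exprn_gt0.
apply: le_lt_trans he; apply: ge0_integral_le => // x _.
rewrite lee_fin ler_expR -mulrA ler_pM2l// mulrC ler_pdivrMr ?exprn_gt0//.
rewrite -exprMn ler_sqr ?nnegrE// ?mulr_ge0 ?(cnorm_ge0 hN) ?(ltW K0)//.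
by have [h _] := NK (x, 0); rewrite mulrC.
Qed.

Let near_oball u a r : 0 < r -> \forall d \near 0^'+, forall z,
  oball N (u, a) d z -> `|z.1 - u| < r /\ `|z.2 - a| < r.
Proof.
move=> r0; have [K K0 NK] := norm_lower hN hN0.
have rK : 0 < r / K by rewrite divr_gt0.
near=> d => z zd.
have dr : d < r / K by near: d; exact: nbhs_right_lt.
have [h1 h2] := NK (z - (u, a)).
have KN : K * N (z - (u, a)) < r.
  by rewrite mulrC -ltr_pdivlMr// (lt_trans zd).
split; first exact: le_lt_trans h1 KN.
apply: le_lt_trans KN; rewrite rV_norm_le ?mulr_ge0 ?(cnorm_ge0 hN) ?(ltW K0)//.
by apply/forallP => i; exact: h2.
Unshelve. all: by end_near. Qed.

Let cont_interior (f : 'rV[R]_k -> R) (A : set 'rV[R]_k) a :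
  S `<=` A -> {within A, continuous f} -> S° a -> f c @[c --> a] --> f a.
Proof.
move=> SA fA Sa; have SoA : S° `<=` A by exact: subset_trans (@interior_subset _ S) SA.
have := continuous_subspaceW SoA fA.
by rewrite continuous_open_subspace; [apply; rewrite inE|exact: open_interior].
Qed.

(** Joint control of [phi] from separate hypotheses: moving [c] at fixed [u] uses continuity, moving
    [x] at fixed [c] uses the Lipschitz bound, whose constant is locally bounded in [c] by its own
    continuity. *)
Let near_phi u a e : S° a -> 0 < e -> exists2 r, 0 < r & forall x c,
  `|x - u| < r -> `|c - a| < r ->
  [/\ S° c, `|phi x c - phi u a| <= e &
      rho a * expR (- e) <= rho c <= rho a * expR e].
Proof.
move=> Sa e0; have [M3 [cM lip]] := phi_lip.
pose r0 := `|u| + 1; have r00 : 0 < r0 by rewrite ltr_wpDl.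
have c1 := cont_interior SLam (@phi_cont u) Sa.
have c2 := cont_interior SLam (cM r0 (ltW r00)) Sa.
have c3 := cont_interior (@subset_refl _ S) rho_cont Sa.
have ra := rho_pos Sa.
have : \forall c \near a, [/\ S° c, `|phi u c - phi u a| <= e / 2, `|M3 r0 c| <= `|M3 r0 a| + 1 &
      rho a * expR (- e) <= rho c <= rho a * expR e].
  (* The tolerance comes from the lower bound for [rho]; it is enough for the upper one since
     [1 - expR (- e) <= expR e - 1]. *)
  have e1 : 0 < rho a * (1 - expR (- e)).
    by rewrite mulr_gt0// subr_gt0 -[ltRHS]expR0 ltr_expR oppr_lt0.
  near=> c; split.
  - by near: c; apply: open_nbhs_nbhs; split => //; exact: open_interior.
  - rewrite distrC; near: c; move/cvgrPdist_le: c1; apply; exact: divr_gt0.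
  - rewrite -lerBlDl (le_trans (lerB_dist _ _))// distrC; near: c.
    by move/cvgrPdist_le: c2; apply.
  - have : `|rho a - rho c| <= rho a * (1 - expR (- e)).
      by near: c; move/cvgrPdist_le: c3; apply; exact: e1.
    rewrite ler_distlC => /andP[h1 h2]; apply/andP; split.
      by move: h1; rewrite mulrBr mulr1 subKr.
    apply: le_trans h2 _; have := expR_ge1Dx e; have := expR_ge1Dx (- e).
    by move: (expR e) (expR (- e)) => p q h3 h4; nra.
move=> /nbhs_ballP[r1 /= r10 h1].
pose m := `|M3 r0 a| + 1; have m0 : 0 < m by rewrite ltr_wpDl.
(* The bound 1 keeps [x] within the radius [r0] of the Lipschitz estimate, and [e / 2 / m] makes
   that estimate at most [e / 2]. *)
pose r := Num.min r1 (Num.min 1 (e / 2 / m)).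
have rpos : 0 < r by rewrite !lt_min r10 ltr01/= !divr_gt0.
exists r => // x c xr cr.
have [|Sc h2 h3 h4] := h1 c.
  by rewrite -ball_normE /= distrC (lt_le_trans cr)// ge_min lexx.
split => //.
rewrite -(subrKA (phi u c)) (le_trans (ler_normD _ _))// [leRHS]splitr lerD//.
have xu1 : `|x - u| < 1 by rewrite (lt_le_trans xr)// !ge_min lexx !orbT.
have Lc : Lam c by apply: SLam; exact: interior_subset.
apply: le_trans (lip r0 c x u r00 Lc _ _) _.
- rewrite -(subrK u x) (le_lt_trans (ler_normD _ _))// addrC ltrD2l//.
- by rewrite ltrDl.
apply: (@le_trans _ _ (m * (e / 2 / m))); last by rewrite mulrC divfK// gt_eqF.
apply: le_trans (ler_wpM2r (normr_ge0 _) (ler_norm _)) _.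
apply: ler_pM => //; apply: ltW; apply: lt_le_trans xr _.
by rewrite /r !ge_min lexx !orbT.
Unshelve. all: by end_near. Qed.

Let num u a d : \bar R :=
  (\int[P]_(z in oball N (u, a) d) (expR (- phi z.1 z.2))%:E)%E.

Let num_bounds u a e : S° a -> 0 < e -> \forall d \near 0^'+,
  [/\ forall z, oball N (u, a) d z -> S° z.2,
      ((expR (- phi u a) * rho a * expR (- e))%:E * M (oball N (u, a) d) <= num u a d)%E &
      (num u a d <= (expR (- phi u a) * rho a * expR e)%:E * M (oball N (u, a) d))%E].
Proof.
move=> Sa e0; have e2 : 0 < e / 2 by rewrite divr_gt0.
have [mB _ _ _] := oball_theory.
have [r r0 hr] := near_phi u Sa e2; have ra := rho_pos Sa.
near=> d.
have hd z : oball N (u, a) d z -> [/\ S° z.2, `|phi z.1 z.2 - phi u a| <= e / 2 &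
    rho a * expR (- (e / 2)) <= rho z.2 <= rho a * expR (e / 2)].
  move=> zd; have : `|z.1 - u| < r /\ `|z.2 - a| < r.
    by move: z zd; near: d; exact: near_oball.
  by move=> [h1 h2]; exact: hr.
split; first by move=> z /hd[].
- have -> : expR (- phi u a) * rho a * expR (- e) =
      expR (- phi u a - e / 2) * (rho a * expR (- (e / 2))).
    rewrite expRD {1}(splitr e) opprD expRD; ring.
  rewrite EFinM -muleA; apply: (@le_trans _ _ ((expR (- phi u a - e / 2))%:E * P (oball N (u, a) d))%E).
    rewrite lee_pmul2l ?lte_fin ?expR_gt0//.
    have c0 : 0 <= rho a * expR (- (e / 2)) by rewrite mulr_ge0// ?expR_ge0// ltW.
    by apply: (density_lower mu hrho c0 (mB (u, a) d)) => z /hd[_ _ /andP[]].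
  rewrite -integral_cst//; apply: ge0_integral_le => // [z _|z].
    by rewrite lee_fin expR_ge0.
  move=> /hd[_ h _]; rewrite lee_fin ler_expR -opprD lerN2.
  by move: h; rewrite ler_distl => /andP[_].
- have -> : expR (- phi u a) * rho a * expR e =
      expR (- phi u a + e / 2) * (rho a * expR (e / 2)).
    rewrite expRD {1}(splitr e) expRD; ring.
  rewrite EFinM -muleA; apply: (@le_trans _ _ ((expR (- phi u a + e / 2))%:E * P (oball N (u, a) d))%E); last first.
    rewrite lee_pmul2l ?lte_fin ?expR_gt0//.
    have c0 : 0 <= rho a * expR (e / 2) by rewrite mulr_ge0// ?expR_ge0// ltW.
    by apply: (density_upper mu hrho c0 (mB (u, a) d)) => z /hd[_ _ /andP[]].
  rewrite -integral_cst//; apply: ge0_integral_le => // [z _|z].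
    by rewrite lee_fin expR_ge0.
  move=> /hd[_ h _]; rewrite lee_fin ler_expR.
  by move: h; rewrite ler_distl => /andP[]; lra.
Unshelve. all: by end_near. Qed.

Let num_limit u a : cm_space mu u -> S° a ->
  (\forall d \near 0^'+, num u a d \is a fin_num /\ 0 < fine (num u a d)) /\
  fine (num u a d) / fine (M (oball N (u, a) d)) @[d --> 0^'+] --> expR (- phi u a) * rho a.
Proof.
move=> Eu Sa; have [mB B0 Boo _] := oball_theory; have ra := rho_pos Sa.
have A0 : 0 < expR (- phi u a) * rho a by rewrite mulr_gt0// expR_gt0.
have Mf d : M (oball N (u, a) d) = (fine (M (oball N (u, a) d)))%:E.
  by rewrite fineK// ge0_fin_numE// Boo.
have M0 d : 0 < d -> 0 < fine (M (oball N (u, a) d)).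
  by move=> d0; rewrite -lte_fin -Mf; exact: B0.
have nf e : 0 < e -> \forall d \near 0^'+, num u a d \is a fin_num /\
    expR (- phi u a) * rho a * expR (- e) <= fine (num u a d) / fine (M (oball N (u, a) d))
      <= expR (- phi u a) * rho a * expR e.
  move=> e0; near=> d.
  have d0 : 0 < d by near: d; exact: nbhs_right_gt.
  have [_ h1 h2] : [/\ forall z, oball N (u, a) d z -> S° z.2,
      ((expR (- phi u a) * rho a * expR (- e))%:E * M (oball N (u, a) d) <= num u a d)%E &
      (num u a d <= (expR (- phi u a) * rho a * expR e)%:E * M (oball N (u, a) d))%E].
    by near: d; exact: num_bounds.
  have nf : num u a d \is a fin_num.
    rewrite ge0_fin_numE; last by apply: integral_ge0 => z _; rewrite lee_fin expR_ge0.
    by apply: le_lt_trans h2 _; rewrite Mf -EFinM ltry.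
  split => //; move: h1 h2; rewrite Mf -(fineK nf) -!EFinM !lee_fin => h1 h2.
  by rewrite ler_pdivlMr ?ler_pdivrMr ?M0// h1 h2.
split; last first.
  by apply: cvg_expR_bounds => // e e0; apply: filterS (nf _ e0) => d [].
near=> d; have d0 : 0 < d by near: d; exact: nbhs_right_gt.
have [h1 /andP[h2 _]] : num u a d \is a fin_num /\
    expR (- phi u a) * rho a * expR (- 1) <= fine (num u a d) / fine (M (oball N (u, a) d))
      <= expR (- phi u a) * rho a * expR 1.
  by near: d; exact: nf.
split => //; have := lt_le_trans (mulr_gt0 A0 (expR_gt0 _)) h2.
by rewrite pmulr_lgt0// invr_gt0 M0.
Unshelve. all: by end_near. Qed.

Let XLam : set (borel X * borel 'rV[R]_k) := [set z | Lam z.2].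
Let Z : \bar R := (\int[P]_(z in XLam) (expR (- phi z.1 z.2))%:E)%E.

(** The rate [e] is taken from Fernique's theorem first; only then does it fix the constant in the
    lower bound for [phi]. *)
Let Z_lty : (Z < +oo)%E.
Proof.
have [e e0 he] := fernique_norm; have [M1 hM1] := phi_low e0.
pose F (x : borel X) : \bar R := (expR (- M1) * expR (e * `|x : X| ^+ 2))%:E.
have mF : measurable_fun setT F.
  apply: measurableT_comp => //; apply: measurable_funM => //.
  apply: measurableT_comp => //; apply: measurable_funM => //.
  apply: measurable_funX; apply: measurable_borelT; exact: norm_continuous.
have F0 x : (0 <= F x)%E by rewrite lee_fin mulr_ge0// expR_ge0.
have mF1 : measurable_fun setT (fun z : borel X * borel 'rV[R]_k => F z.1).
  by apply: measurableT_comp => //; exact: measurable_fst.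
have : (\int[mu]_x F x < +oo)%E.
  rewrite /F; under eq_integral do rewrite EFinM.
  have mG : measurable_fun setT (fun x : borel X => (expR (e * `|x : X| ^+ 2))%:E).
    apply: measurableT_comp => //.
    apply: measurableT_comp => //; apply: measurable_funM => //.
    apply: measurable_funX; apply: measurable_borelT; exact: norm_continuous.
  have c0 : (0 <= (expR (- M1))%:E :> \bar R)%E by rewrite lee_fin expR_ge0.
  rewrite (ge0_integralZl mu measurableT mG _ c0).
    by rewrite lte_mul_pinfty// ?lte_fin ?expR_gt0.
  by move=> x _; rewrite lee_fin expR_ge0.
apply: le_lt_trans; apply: (@le_trans _ _ (\int[P]_(z in setT) F z.1)%E).
  apply: ge0_integral_le => // z Lz; rewrite lee_fin -expRD ler_expR.
  by have := hM1 z.1 z.2 Lz; lra.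
rewrite (fubini_tonelli1 _ mF1)//.
rewrite le_eqVlt; apply/orP; left; apply/eqP; apply: eq_integral => x _.
change (\int[nu]_c cst (F x) c = F x)%E; rewrite integral_cst//.
by rewrite -[RHS]mule1; congr (_ * _)%E; exact: probability_setT.
Qed.

Let post u a d : \bar R := posterior Lam mu nu phi (ball_on Lam N (u, a) d).

(** Small balls at interior points of [S] project into [S°], hence into [Lam], so restricting to
    [Lam] changes nothing. *)
Let postE u a : S° a -> \forall d \near 0^'+, post u a d = (num u a d / Z)%E.
Proof.
move=> Sa; apply: filterS (num_bounds u Sa ltr01) => d [h _ _].
rewrite /post /posterior; congr (_ / _)%E; rewrite /num; congr integral.
apply/seteqP; split => [z [[]]//|z zd]; have Lz : Lam z.2.
  by apply: SLam; apply: interior_subset; exact: h.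
by [].
Qed.

(** A single small ball already has positive mass. Together with [Z_lty] this lets [Z] cancel in the
    extended reals. *)
Let Z_gt0 u a : cm_space mu u -> S° a -> (0 < Z)%E.
Proof.
move=> Eu Sa; have [nf _] := num_limit Eu Sa.
near (0 : R)^'+ => d.
have [h1 h2] : num u a d \is a fin_num /\ 0 < fine (num u a d) by near: d; exact: nf.
have [h _ _] : [/\ forall z, oball N (u, a) d z -> S° z.2,
      ((expR (- phi u a) * rho a * expR (- 1))%:E * M (oball N (u, a) d) <= num u a d)%E &
      (num u a d <= (expR (- phi u a) * rho a * expR 1)%:E * M (oball N (u, a) d))%E].
  by near: d; exact: num_bounds.
apply: (@lt_le_trans _ _ (num u a d)); first by rewrite -(fineK h1) lte_fin.
by apply: ge0_integral_le => // z /h /interior_subset /SLam.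
Unshelve. all: by end_near. Qed.

Lemma posterior_ratio u a v b : cm_space mu u -> S° a -> cm_space mu v -> S° b ->
  (post u a d / post v b d)%E @[d --> 0^'+] -->
  ((expR (- phi u a) * rho a * expR (- (fine (cm_norm mu u) ^+ 2 / 2))) /
   (expR (- phi v b) * rho b * expR (- (fine (cm_norm mu v) ^+ 2 / 2))))%:E.
Proof.
move=> Eu Sa Ev Sb; have [_ B0 Boo Br] := oball_theory.
have ra := rho_pos Sa; have rb := rho_pos Sb.
have [nu1 lu] := num_limit Eu Sa; have [nv1 lv] := num_limit Ev Sb.
have Zf : Z = (fine Z)%:E.
  by rewrite fineK// ge0_fin_numE ?Z_lty// ltW// (Z_gt0 Eu Sa).
have Z0 : 0 < fine Z by rewrite -lte_fin -Zf (Z_gt0 Eu Sa).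
have M0 w c d : cm_space mu w -> 0 < d -> 0 < fine (M (oball N (w, c) d)).
  by move=> Ew d0; apply: fine_gt0; rewrite B0// Boo.
have n2 : expR (- phi v b) * rho b * expR (- (fine (cm_norm mu v) ^+ 2 / 2)) != 0.
  by rewrite gt_eqF// !mulr_gt0// expR_gt0.
(* Both masses are compared with that of the ball at the origin, so the limit splits into those of
   [num_limit] and [small_ball_ratio]. *)
have c4 : ((fine (num u a d) / fine (M (oball N (u, a) d)) *
    (fine (M (oball N (u, a) d)) / fine (M (oball N (0, 0) d)))) /
   (fine (num v b d) / fine (M (oball N (v, b) d)) *
    (fine (M (oball N (v, b) d)) / fine (M (oball N (0, 0) d)))))%:E @[d --> 0^'+] -->
  ((expR (- phi u a) * rho a * expR (- (fine (cm_norm mu u) ^+ 2 / 2))) /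
   (expR (- phi v b) * rho b * expR (- (fine (cm_norm mu v) ^+ 2 / 2))))%:E.
  apply: cvg_EFin; first exact: nearW.
  apply: cvgM; first by apply: cvgM; [exact: lu|exact: Br].
  by apply: cvgV n2 _; apply: cvgM; [exact: lv|exact: Br].
apply: cvg_trans c4; apply: near_eq_cvg.
apply: filterS3 (filterI nu1 nv1) (filterI (postE u Sa) (postE v Sb)) (nbhs_right_gt 0).
move=> d [[nuf nu0] [nvf nv0]] [E1 E2] d0.
rewrite E1 E2 Zf; apply: ratio_cancel => //; apply: lt0r_neq0; apply: M0 => //.
exact: cm_space0.
Qed.


(** * The Onsager-Machlup functional *)

Local Notation I := (OM_func mu S rho phi).
Let E := cm_space mu.

Let JE u : E u -> J_func mu u = (fine (cm_norm mu u) ^+ 2 / 2)%:E.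
Proof. by move=> Eu; rewrite /J_func mem_set// mulrC. Qed.

Let KE a : S° a -> K_func S rho a = (- ln (rho a))%:E.
Proof. by move=> Sa; rewrite /K_func mem_set. Qed.

Let IE u a : E u -> S° a ->
  I u a = (phi u a + fine (cm_norm mu u) ^+ 2 / 2 - ln (rho a))%:E.
Proof. by move=> Eu Sa; rewrite /OM_func JE// KE. Qed.

Lemma onsager_machlup_ratio u a v b : E u -> S° a -> E v -> S° b ->
  (post u a d / post v b d)%E @[d --> 0^'+] --> expeR (I v b - I u a)%E.
Proof.
move=> Eu Sa Ev Sb; have [ra rb] := (rho_pos Sa, rho_pos Sb).
have := posterior_ratio Eu Sa Ev Sb.
set l := (X in _ --> X); suff -> : l = expeR (I v b - I u a)%E by [].
rewrite /l !IE//=; congr EFin.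
rewrite -[rho a in LHS]lnK ?posrE// -[rho b in LHS]lnK ?posrE//.
by rewrite -!expRD -expRN -expRD; congr expR; ring.
Qed.

Hypothesis Scl : S = closure S°.

(** The [lim] in [K_func] is determined only along a proper filter, and properness at [a] means that
    [a] lies in the closure of the interior. *)
Let proper_boundary a : (S `\` S°) a -> ProperFilter (within S° (nbhs a)).
Proof. by move=> [Sa _]; apply: within_nbhs_proper; rewrite -Scl. Qed.

Let cvg_within_interior (A : set 'rV[R]_k) (f : 'rV[R]_k -> R) a :
  S `<=` A -> {within A, continuous f} -> A a -> f b @[b --> within S° (nbhs a)] --> f a.
Proof.
move=> SA /subspace_continuousP fA Aa; apply: cvg_trans (fA _ Aa).
by apply: cvg_app; apply: within_subset => x /interior_subset /SA.
Qed.

(** [rho] may vanish at a boundary point. Then [ln (rho b)] tends to [-oo] through interior points,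
    where [rho b > 0], and the value of [ln] at 0 does not intervene. That [l] is not [+oo] keeps
    [K_func] away from [-oo]. *)
Let K_boundary a : (S `\` S°) a -> exists2 l : \bar R, l <> +oo%E &
  (ln (rho b))%:E @[b --> within S° (nbhs a)] --> l /\ K_func S rho a = (- l)%E.
Proof.
move=> Ba; have PF := proper_boundary Ba; have [Sa nSa] := Ba.
have crho := cvg_within_interior (@subset_refl _ S) rho_cont Sa.
have [l loo hl] : exists2 l : \bar R, l <> +oo%E &
    (ln (rho b))%:E @[b --> within S° (nbhs a)] --> l.
  have : 0 <= rho a by have [_ r0 _] := hrho; exact: r0.
  rewrite le_eqVlt => /predU1P[r0|r0]; last first.
    exists (ln (rho a))%:E => //; apply: cvg_EFin; first exact: nearW.
    apply: (cvg_comp _ _ crho); exact: continuous_ln.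
  exists -oo%E => //; apply/cvgeNyPle => A; near=> b.
  have Sb : S° b by near: b; exact: withinT.
  rewrite lee_fin -ler_expR lnK ?posrE ?rho_pos//.
  near: b; have := expR_gt0 A; rewrite r0 => rA.
  (* Near [a] the density falls below [expR A], since its limit there is 0. *)
  by have := crho; move=> /cvgr_lt/(_ _ rA); apply: filterS => b /ltW.
exists l => //; split => //.
by rewrite /K_func memNset// mem_set// (cvg_lim (@ereal_hausdorff R) hl).
Unshelve. all: by end_near. Qed.

Lemma onsager_machlup_boundary (u : X) (a : 'rV[R]_k) : E u -> (S `\` S°) a ->
  I u b @[b --> within S° (nbhs a)] --> I u a.
Proof.
move=> Eu Ba; have PF := proper_boundary Ba; have [l _ [hl Kl]] := K_boundary Ba.
have cphi := cvg_within_interior SLam (@phi_cont u) (SLam Ba.1).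
have Kc : K_func S rho b @[b --> within S° (nbhs a)] --> K_func S rho a.
  rewrite Kl; apply: cvg_trans (cvgeN hl); apply: near_eq_cvg; near=> b.
  have Sb : S° b by near: b; exact: withinT.
  by rewrite KE.
rewrite /OM_func JE//; apply: cvgeD => //.
apply: cvg_EFin; first exact: nearW.
by apply: cvgD => //; exact: cvg_cst.
Unshelve. all: by end_near. Qed.

Let K_NNy a : K_func S rho a <> -oo%E.
Proof.
have [Sa|nSa] := pselect (S° a); first by rewrite KE.
have [Sa|nS] := pselect (S a); last by rewrite /K_func !memNset.
by have [l loo [_ ->]] := K_boundary (conj Sa nSa); case: l loo.
Qed.

Let J_NNy u : J_func mu u <> -oo%E.
Proof. by rewrite /J_func; case: ifP. Qed.

Lemma onsager_machlup_NNy u a : I u a <> -oo%E.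
Proof.
rewrite /OM_func; have := @K_NNy a; have := @J_NNy u.
by case: (J_func mu u) => [x| |] //; case: (K_func S rho a) => [y| |].
Qed.

Lemma onsager_machlup_infinite u a : ~ E u \/ ~ S a -> I u a = +oo%E.
Proof.
rewrite /OM_func => -[nE|nS].
  have -> : J_func mu u = +oo%E by rewrite /J_func memNset.
  by have := @K_NNy a; case: (K_func S rho a) => [y| |].
have -> : K_func S rho a = +oo%E.
  by rewrite /K_func !memNset// => /interior_subset.
by have := @J_NNy u; case: (J_func mu u) => [x| |].
Qed.

End posterior_limit.

Theorem theorem5p1 (R : realType) (X : completeNormedModType R) (k J : nat)
    (Lam : set 'rV[R]_k) (N : X * 'rV[R]_k -> R)
    (mu0 : probability (borel X) R) (nu0 : probability (borel 'rV[R]_k) R)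
    (S : set 'rV[R]_k) (rho : 'rV[R]_k -> R)
    (Phi : X -> 'rV[R]_k -> 'rV[R]_J -> R) (y : 'rV[R]_J)
    (hX : separable X)
    (hN : complete_norm N)
    (hN0 : forall w : nat -> X * 'rV[R]_k,
       N (w n) @[n --> \oo] --> (0 : R) ->
       (`|(w n).1| @[n --> \oo] --> (0 : R)) /\
       (enorm (w n).2 @[n --> \oo] --> (0 : R)))
    (hmu0 : centred_gaussian mu0)
    (hS : S = msupport nu0) (Scompact : compact S) (SLam : S `<=` Lam)
    (Sint : S = closure S°)
    (hrho : is_density nu0 rho)
    (rho_cont : {within S, continuous rho})
    (rho_pos : forall a, S° a -> 0 < rho a)
    (hA1 : condA1 Lam Phi) (hA2 : condA2 Lam Phi)
    (hA3 : condA3 Lam Phi) (hA4 : condA4 Lam Phi) :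
  let phi := fun u a => Phi u a y in
  let mu := posterior Lam mu0 nu0 phi in
  let B := ball_on Lam N in
  let E := cm_space mu0 in
  let I := OM_func mu0 S rho phi in
  [/\ (forall u a, Lam a -> I u a <> -oo%E),
      (forall u a v b, E u -> S° a -> E v -> S° b ->
         (mu (B (u, a) d) / mu (B (v, b) d))%E @[d --> 0^'+]
           --> expeR (I v b - I u a)%E),
      (forall u a, E u -> (S `\` S°) a ->
         I u b @[b --> within S° (nbhs a)] --> I u a) &
      (forall u a, Lam a -> ~ E u \/ ~ S a -> I u a = +oo%E)].
Proof.
move=> phi mu B E I.
have low e : 0 < e -> exists M, forall u a, Lam a -> M - e * `|u| ^+ 2 <= phi u a.
  by move=> /hA1[M h]; exists M => u a La; exact: h.
have cont u : {within Lam, continuous (phi u)} by exact: hA2.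
have lip : exists M : R -> 'rV[R]_k -> R,
    (forall r, 0 <= r -> {within Lam, continuous (M r)}) /\
    forall r a u v, 0 < r -> Lam a -> `|u| < r -> `|v| < r ->
      `|phi u a - phi v a| <= M r a * `|u - v|.
  have [M [_ cM h]] := hA4; exists (fun r a => M r a y).
  by split => [r r0|r a u v r0 La ur vr]; [exact: cM|exact: h].
split.
- by move=> u a _; exact: (onsager_machlup_NNy hrho rho_cont rho_pos Sint).
- by move=> u a v b Eu Sa Ev Sb; exact: (onsager_machlup_ratio hX hN hN0 hmu0 SLam hrho
    rho_cont rho_pos low cont lip).
- by move=> u a Eu Sa; exact: (onsager_machlup_boundary SLam hrho rho_cont rho_pos cont Sint).
- by move=> u a _; exact: (onsager_machlup_infinite phi hrho rho_cont rho_pos Sint).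
Qed.
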